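(* Let $p$ be a prime and $0<\alpha\le2$. The $p$-adic log-fractional stable motion, the $p$-adic linear fractional stable motion (for every $H>0$ with $H\neq 1/\alpha$), and the $p$-adic harmonizable fractional stable motion (for every $H>0$) are $p$-adic sssi. Moreover, the BRW tree process (for every $H>0$) is discrete $p$-adic sssi.
   Context: Conventions: $\mathbb N_0=\{0,1,2,\dots\}$, $\mathbb N=\{1,2,\dots\}$, $\mathbb Q_p^\times=\mathbb Q_p\setminus\{0\}$, $|x|_p=p^{-v_p(x)}$; $m$ is Haar measure on $\mathbb Q_p$ with $m(\mathbb Z_p)=1$; $\overset{d}{=}$ is equality of finite-dimensional distributions. A real process $\{X(t)\}_{t\in\mathbb Q_p}$ is $p$-adic sssi with index $H>0$ if $\{X(at)\}_{t}\overset{d}{=}\{|a|_p^HX(t)\}_{t}$ and $\{X(t+h)-X(h)\}_{t}\overset{d}{=}\{X(t)\}_{t}$ for all $a\in\mathbb Q_p^\times$, $h\in\mathbb Q_p$; it is $p$-adic sssi if this holds for some $H>0$. A real process $\{X_n\}_{n\in\mathbb N_0}$ is discrete $p$-adic sssi if for some $H>0$, $\{X_{an}\}_{n}\overset{d}{=}\{|a|_p^HX_n\}_{n}$ and $\{X_{n+h}-X_h\}_{n}\overset{d}{=}\{X_n\}_{n}$ for all $a\in\mathbb N$, $h\in\mathbb N_0$. A real symmetric $\alpha$-stable ($S\alpha S$) random measure $M_\alpha$ on $(E,\mathcal E)$ with $\sigma$-finite control measure $\mu$ is independently scattered with $\mathbb E[e^{i\theta M_\alpha(A)}]=\exp(-|\theta|^\alpha\mu(A))$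 when $\mu(A)<\infty$; for real $f\in L^\alpha(E,\mu)$, $\int f\,dM_\alpha$ is the stable integral, with $\mathbb E[\exp(i\theta\int f\,dM_\alpha)]=\exp(-|\theta|^\alpha\int|f|^\alpha d\mu)$. A complex isotropic $S\alpha S$ random measure $\widetilde M_\alpha$ with control measure $\mu$ is the complex analogue, with $\mathbb E[\exp(i\,\mathrm{Re}(\bar\theta\int f\,d\widetilde M_\alpha))]=\exp(-|\theta|^\alpha\int|f|^\alpha d\mu)$ for $\theta\in\mathbb C$ and complex $f\in L^\alpha(E,\mu)$. Being well-defined (kernels in $L^\alpha$) is part of the assertion. Kernels at singular points ($x=0$, $x=t$, $\xi=0$) may be assigned arbitrary values since these are Haar-null. (1) $p$-adic log-fractional stable motion: $X(t)=\int_{\mathbb Q_p}(\log|t-x|_p-\log|x|_p)\,M_\alpha(dx)$, $t\in\mathbb Q_p$, where $M_\alpha$ is real $S\alpha S$ on $\mathbb Q_p$ with control measure $m$. (2) $p$-adic linear fractional stable motion ($H>0$, $H\ne1/\alpha$): $X(t)=\int_{\mathbb Q_p}(|t-x|_p^{H-1/\alpha}-|x|_p^{H-1/\alpha})\,M_\alpha(dx)$, with the same $M_\alpha$. (3) $p$-adic harmonizable fractional stable motion ($H>0$): $X(t)=\mathrm{Re}\int_{\mathbb Q_p}(\chi(t\xi)-1)|\xi|_p^{-H-1/\alpha}\,\widetilde M_\alpha(d\xi)$, where $\widetilde M_\alpha$ is complex isotropic $S\alpha S$ on $\mathbb Q_p$ with control measure $m$, and $\chi:\mathbb Q_p\to\{z\in\mathbb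 C:|z|=1\}$ is the additive character with $\chi(x)=1$ for $x\in\mathbb Z_p$ and $\chi(p^{-k}u)=\exp(2\pi i\,(u\bmod p^k)/p^k)$ for $k\ge1$, $u\in\mathbb Z_p^\times=\mathbb Z_p\setminus p\mathbb Z_p$. (4) BRW tree process ($H>0$): let $E=\bigsqcup_{k=0}^\infty\mathbb Z/p^{k+1}\mathbb Z$ with control measure equal to counting measure on each level $k$, $M_\alpha$ real $S\alpha S$ on $E$, and for $n\in\mathbb N_0$, $X_n=\int_E p^{-kH}\big(\mathbf 1_{\{r\equiv n\ (\mathrm{mod}\ p^{k+1})\}}-\mathbf 1_{\{r\equiv0\ (\mathrm{mod}\ p^{k+1})\}}\big)\,M_\alpha(dk,dr)$. *)

(* Defs.v *)
From HB Require Import structures.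
From mathcomp Require Import all_boot all_order all_algebra.
From mathcomp Require Import fraction.
From mathcomp Require Import all_classical all_reals all_analysis.
From mathcomp Require Import complex.
From mathcomp Require Import zify ring.

Set Implicit Arguments.
Unset Strict Implicit.
Unset Printing Implicit Defensive.
Import Order.TTheory GRing.Theory Num.Theory.
Import numFieldNormedType.Exports HBSimple.
Local Open Scope classical_set_scope.
Local Open Scope ring_scope.

(* The ring Z_p as the inverse limit of the rings Z/p^nZ: residue x n is the
   representative in {0, ..., p^n - 1} of x modulo p^n. *)
Record padic_int (p : nat) (p_pr : prime p) := PadicInt {
  residue :> nat -> nat;
  residue_compat : forall n, residue n = (residue n.+1 %% p ^ n)%N }.

Section PadicIntRing.
Variables (p : nat) (p_pr : prime p).
Local Notation Zp := (padic_int p_pr).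
Implicit Types x y z : Zp.

Lemma padic_int_ext x y : (forall n, x n = y n) -> x = y.
Proof.
case: x y => [x xP] [y yP] /= xy; have {}xy : x = y by apply/funext.
by subst y; congr PadicInt; apply: Prop_irrelevance.
Qed.

HB.instance Definition _ := gen_eqMixin Zp.
HB.instance Definition _ := gen_choiceMixin Zp.

Lemma expp_gt0 n : (0 < p ^ n)%N.
Proof. by rewrite expn_gt0 prime_gt0. Qed.

Lemma residue_lt x n : (x n < p ^ n)%N.
Proof. by rewrite residue_compat ltn_mod expp_gt0. Qed.

Lemma residue_mod x n : (x n %% p ^ n = x n)%N.
Proof. by rewrite modn_small ?residue_lt. Qed.

Lemma padic_mk_subproof (f : nat -> nat) :
  (forall n, f n = f n.+1 %[mod p ^ n]) ->
  forall n, (f n %% p ^ n = (f n.+1 %% p ^ n.+1) %% p ^ n)%N.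
Proof. by move=> fP n; rewrite modn_dvdm ?dvdn_exp2l. Qed.

Definition padic_mk f fP : Zp := PadicInt p_pr (@padic_mk_subproof f fP).

Lemma nat_subproof (k n : nat) : k = k %[mod p ^ n]. Proof. by []. Qed.
Definition padic_nat k := padic_mk (nat_subproof k).

Lemma residue_modS x n : x n = x n.+1 %[mod p ^ n].
Proof. by rewrite residue_mod -residue_compat. Qed.

Lemma add_subproof x y n : (x n + y n = x n.+1 + y n.+1 %[mod p ^ n])%N.
Proof. by rewrite -modnDm residue_modS (residue_modS y) modnDm. Qed.
Definition padic_add x y := padic_mk (add_subproof x y).

Lemma mul_subproof x y n : (x n * y n = x n.+1 * y n.+1 %[mod p ^ n])%N.
Proof. by rewrite -modnMm residue_modS (residue_modS y) modnMm. Qed.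
Definition padic_mul x y := padic_mk (mul_subproof x y).

Lemma opp_subproof x n : (p ^ n - x n = p ^ n.+1 - x n.+1 %[mod p ^ n])%N.
Proof.
apply/eqP; rewrite -(eqn_modDr (x n)) subnK 1?ltnW ?residue_lt//.
rewrite modnn -modnDmr residue_modS modnDmr subnK 1?ltnW ?residue_lt//.
by rewrite expnS modnMl.
Qed.
Definition padic_opp x := padic_mk (opp_subproof x).

Lemma padic_addA : associative padic_add.
Proof. by move=> x y z; apply/padic_int_ext => n /=; rewrite modnDml modnDmr addnA. Qed.
Lemma padic_addC : commutative padic_add.
Proof. by move=> x y; apply/padic_int_ext => n /=; rewrite addnC. Qed.
Lemma padic_add0 : left_id (padic_nat 0) padic_add.
Proof. by move=> x; apply/padic_int_ext => n /=; rewrite mod0n add0n residue_mod. Qed.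
Lemma padic_addN : left_inverse (padic_nat 0) padic_opp padic_add.
Proof.
move=> x; apply/padic_int_ext => n /=.
by rewrite modnDml subnK 1?ltnW ?residue_lt// modnn mod0n.
Qed.
HB.instance Definition _ :=
  GRing.isZmodule.Build Zp padic_addA padic_addC padic_add0 padic_addN.

Lemma padic_mulA : associative padic_mul.
Proof. by move=> x y z; apply/padic_int_ext => n /=; rewrite modnMml modnMmr mulnA. Qed.
Lemma padic_mulC : commutative padic_mul.
Proof. by move=> x y; apply/padic_int_ext => n /=; rewrite mulnC. Qed.
Lemma padic_mul1 : left_id (padic_nat 1) padic_mul.
Proof. by move=> x; apply/padic_int_ext => n /=; rewrite modnMml mul1n residue_mod. Qed.
Lemma padic_mulD : left_distributive padic_mul padic_add.
Proof.
move=> x y z; apply/padic_int_ext => n /=.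
by rewrite modnMml modnDml modnDmr mulnDl.
Qed.
Lemma padic_1neq0 : padic_nat 1 != 0.
Proof.
apply/eqP => /(congr1 (fun x : Zp => x 1%N)) /=.
by rewrite expn1 mod0n modn_small// prime_gt1.
Qed.
HB.instance Definition _ := GRing.Zmodule_isComNzRing.Build Zp
  padic_mulA padic_mulC padic_mul1 padic_mulD padic_1neq0.

Definition padic_int_unit : {pred Zp} := [pred x | `[< exists y, y * x = 1 >]].
Definition padic_int_inv x : Zp := xget x [set y | y * x = 1].

Lemma padic_int_mulV : {in padic_int_unit, left_inverse 1 padic_int_inv *%R}.
Proof. by move=> x /asboolP [y yx]; apply: (@xgetPex _ x [set y | y * x = 1]); exists y. Qed.
Lemma padic_int_unitP x y : y * x = 1 -> padic_int_unit x.
Proof. by move=> yx; apply/asboolP; exists y. Qed.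
Lemma padic_int_inv_out : {in [predC padic_int_unit], padic_int_inv =1 id}.
Proof.
move=> x /asboolP xU; apply: xgetPN => y yx; by apply: xU; exists y.
Qed.
HB.instance Definition _ := GRing.ComNzRing_hasMulInverse.Build Zp
  padic_int_mulV padic_int_unitP padic_int_inv_out.

Lemma residue0 n : (0 : Zp) n = 0%N. Proof. exact: mod0n. Qed.
Lemma residue1 n : (1 : Zp) n = (1 %% p ^ n)%N. Proof. by []. Qed.
Lemma residueD x y n : (x + y) n = ((x n + y n) %% p ^ n)%N. Proof. by []. Qed.
Lemma residueM x y n : (x * y) n = ((x n * y n) %% p ^ n)%N. Proof. by []. Qed.
Lemma residue_nat k n : (k%:R : Zp) n = (k %% p ^ n)%N.
Proof.
elim: k => [|k IH]; first by rewrite residue0 mod0n.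
by rewrite -addn1 natrD residueD IH modnDm.
Qed.

Lemma residueE x m n : (m <= n)%N -> x m = (x n %% p ^ m)%N.
Proof.
move=> /subnKC <-; elim: (n - m)%N => [|k IH]; first by rewrite addn0 residue_mod.
by rewrite IH addnS residue_compat modn_dvdm// dvdn_exp2l// leq_addr.
Qed.

Lemma padic_int_idomain x y : x * y = 0 -> (x == 0) || (y == 0).
Proof.
move=> xy0; apply/contraT; rewrite negb_or => /andP[/eqP x0 /eqP y0].
have nz (z : Zp) : z <> 0 -> exists n, z n != 0%N.
  move=> z0; apply: contrapT => /forallNP zn; apply: z0.
  by apply/padic_int_ext => n; rewrite residue0; move/negP : (zn n); rewrite negbK => /eqP.
have [m xm] := nz _ x0; have [n yn] := nz _ y0.
have /(congr1 (fun z : Zp => z (m + n)%N)) := xy0.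
rewrite residue0 residueM => /eqP; rewrite -/(dvdn _ _).
have hx : ~~ (p ^ m %| x (m + n)%N)%N by rewrite /dvdn -residueE ?leq_addr.
have hy : ~~ (p ^ n %| y (m + n)%N)%N by rewrite /dvdn -residueE ?leq_addl.
have hx0 : (0 < x (m + n)%N)%N by case: (x _) hx; rewrite ?dvdn0.
have hy0 : (0 < y (m + n)%N)%N by case: (y _) hy; rewrite ?dvdn0.
rewrite pfactor_dvdn ?muln_gt0 ?hx0// lognM//.
by move: hx hy; rewrite !pfactor_dvdn//; lia.
Qed.
HB.instance Definition _ :=
  GRing.ComUnitRing_isIntegral.Build Zp padic_int_idomain.

End PadicIntRing.

Section PadicIntTheory.
Variables (p : nat) (p_pr : prime p).
Local Notation Zp := (padic_int p_pr).
Implicit Types x y z : Zp.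

Lemma padic_int_unitE x : (x \is a GRing.unit) = (x 1%N != 0%N).
Proof.
apply/idP/idP => [xU|x1].
  apply/eqP => x0; move: (divrr xU) => /(congr1 (fun z : Zp => z 1%N)).
  by rewrite residueM x0 mul0n mod0n residue1 expn1 modn_small ?prime_gt1.
have xcop n : coprime (x n) (p ^ n).
  case: n => [|n]; first by rewrite expn0 coprimen1.
  rewrite coprimeXr// coprime_sym prime_coprime//.
  by rewrite /dvdn -{2}(expn1 p) -(residueE x (ltn0Sn n)).
pose f n := (egcdn (x n) (p ^ n)).1.
have fx n : (x n * f n = 1 %[mod p ^ n])%N.
  have [n0|n0] := posnP (x n); last first.
    rewrite /f; case: egcdnP => //= km kn e _.
    by rewrite mulnC e (eqP (xcop n)) modnMDl.
  by move: (xcop n); rewrite n0 /coprime gcd0n => /eqP ->; rewrite !modn1.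
have fP n : f n = f n.+1 %[mod p ^ n].
  have fx' : (x n * f n.+1 = 1 %[mod p ^ n])%N.
    rewrite -modnMml residue_modS modnMml -(modn_dvdm _ (dvdn_exp2l p (leqnSn n))).
    by rewrite fx modn_dvdm// dvdn_exp2l.
  rewrite -[f n]muln1 -modnMmr -fx' modnMmr mulnA [(f n * _)%N]mulnC.
  by rewrite -modnMml fx modnMml mul1n.
apply/unitrP; exists (padic_mk p_pr fP).
by split; apply/padic_int_ext => n; rewrite residue1 residueM /= ?modnMml ?modnMmr;
  [rewrite mulnC|]; rewrite fx.
Qed.

Lemma padic_int_decomp x : x != 0 ->
  exists n (u : Zp), u \is a GRing.unit /\ x = p%:R ^+ n * u.
Proof.
move=> x0.
have /ex_minnP[n xn nmin] : exists n, x n.+1 != 0%N.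
  apply: contrapT => /forallNP zn; case/eqP: x0.
  apply/padic_int_ext => n; rewrite residue0; case: n => [|n].
    by have := residue_lt x 0; rewrite expn0; case: (x 0%N).
  by move/negP : (zn n); rewrite negbK => /eqP.
have xn0 : x n = 0%N.
  case: n nmin {xn} => [|n] nmin.
    by have := residue_lt x 0; rewrite expn0; case: (x 0%N).
  by apply/eqP/contraT => /nmin; rewrite ltnn.
have xdvd m : (p ^ n %| x (n + m)%N)%N by rewrite /dvdn -residueE ?leq_addr ?xn0.
have uP m : (x (n + m) %/ p ^ n = x (n + m.+1) %/ p ^ n %[mod p ^ m])%N.
  apply/eqP; rewrite -(eqn_pmul2l (expp_gt0 p_pr n)) !muln_modr.
  by rewrite ![(p ^ n * (_ %/ _))%N]mulnC !divnK// addnS -expnD residue_modS.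
exists n, (padic_mk p_pr uP); split.
  rewrite padic_int_unitE /= expn1 addn1; apply: contra xn => pdv.
  have := xdvd 1%N; rewrite addn1 => d1.
  have : (p ^ n.+1 %| x n.+1)%N.
    by rewrite -(divnK d1) mulnC expnS mulnC dvdn_pmul2l ?expp_gt0.
  by rewrite /dvdn residue_mod.
apply/padic_int_ext => m; rewrite -natrX residueM residue_nat /= modnMmr modnMml.
rewrite mulnC divnK// -residueE// leq_addl//.
Qed.

End PadicIntTheory.

Definition padic (p : nat) (p_pr : prime p) := {fraction padic_int p_pr}.

Section Padic.
Variables (p : nat) (p_pr : prime p).
Local Notation Zp := (padic_int p_pr).
Local Notation Qp := (padic p_pr).

HB.instance Definition _ := GRing.Field.on Qp.
HB.instance Definition _ := isPointed.Build Qp 0.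

Definition Zp_to_Qp : Zp -> Qp := @FracField.tofrac Zp.

HB.instance Definition _ := GRing.RMorphism.on Zp_to_Qp.

Definition Zp_set : set Qp := range Zp_to_Qp.

(* v_p(x) is the integer k such that x = p^k u with u a unit of Z_p. *)
Definition padic_val (x : Qp) : int :=
  xget 0 [set k : int | exists2 u : Zp, u \is a GRing.unit &
                        x = p%:R ^ k * Zp_to_Qp u].

Definition padic_norm (R : realType) (x : Qp) : R :=
  if x == 0 then 0 else p%:R ^ (- padic_val x).

Definition padic_ball (x : Qp) (n : nat) : set Qp :=
  [set x + p%:R ^+ n * z | z in Zp_set].

Definition padic_nbhs (x : Qp) : set_system Qp :=
  filter_from [set: nat] (padic_ball x).

HB.instance Definition _ := hasNbhs.Build Qp padic_nbhs.

Let ball_center x n : padic_ball x n x.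
Proof. by exists 0; [exists 0; rewrite ?rmorph0|rewrite mulr0 addr0]. Qed.

Let ball_sub x m n : (m <= n)%N -> padic_ball x n `<=` padic_ball x m.
Proof.
move=> /subnKC <- _ [_ [z _ <-] <-].
exists (Zp_to_Qp (p%:R ^+ (n - m) * z)); first by exists (p%:R ^+ (n - m) * z).
by rewrite rmorphM rmorphXn /= rmorph_nat exprD mulrA.
Qed.

Let ball_trans x y n : padic_ball x n y -> padic_ball y n `<=` padic_ball x n.
Proof.
move=> [_ [z _ <-] <-] _ [_ [t _ <-] <-].
by exists (Zp_to_Qp (z + t)); [exists (z + t)|rewrite rmorphD /= mulrDr addrA].
Qed.

Let padic_nbhs_filter (x : Qp) : ProperFilter (nbhs x).
Proof.
apply: filter_from_proper => [|n _]; last by exists x; exact: ball_center.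
apply: filter_from_filter; first by exists 0%N.
move=> m n _ _; exists (maxn m n) => // y xy.
by split; move: y xy; apply: ball_sub; [exact: leq_maxl|exact: leq_maxr].
Qed.

Let padic_nbhs_singleton (x : Qp) (A : set Qp) : nbhs x A -> A x.
Proof. by move=> [n _]; apply; exact: ball_center. Qed.

Let padic_nbhs_nbhs (x : Qp) (A : set Qp) :
  nbhs x A -> nbhs x (nbhs^~ A).
Proof.
move=> [n _ xA]; exists n => // y xy; exists n => //.
by apply: subset_trans xA; exact: ball_trans.
Qed.

HB.instance Definition _ := Nbhs_isNbhsTopological.Build Qp
  padic_nbhs_filter padic_nbhs_singleton padic_nbhs_nbhs.

Definition padic_borel : set (set Qp) := <<s [set A : set Qp | open A] >>.

HB.instance Definition _ := @isMeasurable.Build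
  (sigma_display [set A : set Qp | open A]) Qp padic_borel
  (@sigma_algebra0 _ setT _) (@sigma_algebraC _ _)
  (@sigma_algebra_bigcup _ setT _).

(* For x = p^(-k) u outside Z_p, with k >= 1 and u a unit of Z_p,
   chi(x) = exp(2 pi i (u mod p^k) / p^k), and residue u k is u mod p^k. *)
Definition padic_char (R : realType) (x : Qp) : R[i] :=
  if `[< Zp_set x >] then 1 else
  let k := `|padic_val x|%N in
  let u := xget 0 [set u : Zp | x = p%:R ^- k * Zp_to_Qp u] in
  let theta := 2 * pi * (residue u k)%:R / (p ^ k)%:R in
  (cos theta +i* sin theta)%C.

Implicit Types u : Zp.

Lemma padic_p_neq0 : (p%:R : Qp) != 0.
Proof.
rewrite -(rmorph_nat Zp_to_Qp) tofrac_eq0; apply/eqP.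
move=> /(congr1 (fun z : Zp => z 2%N)); rewrite residue_nat residue0.
rewrite modn_small; first by move: p_pr; case: p.
by rewrite -{1}(expn1 p) ltn_exp2l// prime_gt1.
Qed.

Lemma padic_decomp (x : Qp) : x != 0 ->
  exists k : int, exists2 u : Zp, u \is a GRing.unit & x = p%:R ^ k * Zp_to_Qp u.
Proof.
have -> : x = Zp_to_Qp (frac (repr x)).1 / Zp_to_Qp (frac (repr x)).2.
  apply: (canRL (mulfK _)); first by rewrite tofrac_eq0 denom_ratioP.
  rewrite -{1}[x]reprK; rewrite /Zp_to_Qp; unlock FracField.tofrac.
  rewrite -[LHS]FracField.pi_mul; apply/eqmodP => /=.
  rewrite /FracField.equivf /FracField.mulf /= !numden_Ratio ?mulf_neq0 ?oner_neq0 ?denom_ratioP//.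
  by rewrite !mulr1 mulrC.
have d0 : (frac (repr x)).2 != 0 := denom_ratioP _.
rewrite mulf_eq0 negb_or tofrac_eq0 => /andP[n0 _].
have [m [v [vU ->]]] := padic_int_decomp n0.
have [n [w [wU ->]]] := padic_int_decomp d0.
exists (m%:Z - n%:Z), (v / w); first by rewrite unitrM vU unitrV.
rewrite !rmorphM rmorphV//= !rmorphXn /= !rmorph_nat expfzDr ?padic_p_neq0//.
rewrite -exprnN invfM -!exprnP; ring.
Qed.

Lemma padic_val_uniq (k l : int) u v : u \is a GRing.unit ->
  v \is a GRing.unit ->
  p%:R ^ k * Zp_to_Qp u = p%:R ^ l * Zp_to_Qp v -> k = l /\ u = v.
Proof.
wlog : k l u v / (k <= l)%R => [hw uU vU e|].
  have /orP[kl|lk] := le_total k l; first exact: hw.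
  by have [] := hw _ _ _ _ lk vU uU (esym e).
move=> kl uU vU e.
have {}e : u = p%:R ^+ `|(l - k)%R|%N * v.
  apply/eqP; rewrite -(tofrac_eq u) rmorphM rmorphXn /= rmorph_nat.
  rewrite exprnP gez0_abs ?subr_ge0// addrC expfzDr ?padic_p_neq0//.
  rewrite -mulrA -[X in _ == _ * X]e mulrA -expfzDr ?padic_p_neq0// addNr expr0z.
  by rewrite mul1r.
have : `|(l - k)%R|%N = 0%N.
  case E: `|_|%N e => [//|j] e; move: uU; rewrite e padic_int_unitE.
  by rewrite -natrX residueM residue_nat expn1 modnMml expnS -mulnA modnMr.
move=> e0; rewrite e e0 expr0 mul1r; split=> //; apply/eqP.
by rewrite eq_sym -subr_eq0 -absz_eq0 e0.
Qed.

Lemma padic_valE (k : int) u : u \is a GRing.unit ->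
  padic_val (p%:R ^ k * Zp_to_Qp u) = k.
Proof.
move=> uU; rewrite /padic_val; case: xgetP => [l _ [v vU]|].
  by move=> /(padic_val_uniq uU vU)[].
by move=> /(_ k); case; exists u.
Qed.

Lemma padic_char_Zp R (x : Qp) : Zp_set x -> padic_char R x = 1.
Proof. by move=> xZ; rewrite /padic_char asboolT. Qed.

Lemma padic_char_unit R (k : nat) u : (0 < k)%N -> u \is a GRing.unit ->
  padic_char R (p%:R ^- k * Zp_to_Qp u) =
  (cos (2 * pi * (residue u k)%:R / (p ^ k)%:R) +i*
   sin (2 * pi * (residue u k)%:R / (p ^ k)%:R))%C.
Proof.
move=> k0 uU.
have vE : padic_val (p%:R ^- k * Zp_to_Qp u) = - k%:Z.
  by rewrite exprnN padic_valE.
rewrite /padic_char asboolF; last first.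
  move=> [z _ ze].
  have {}ze : u = p%:R ^+ k * z.
    apply/eqP; rewrite -(tofrac_eq u) rmorphM rmorphXn /= rmorph_nat.
    by rewrite [X in _ == _ * X]ze mulrA divff ?mul1r// expf_neq0 ?padic_p_neq0.
  move: uU; rewrite ze padic_int_unitE -natrX residueM residue_nat expn1.
  by rewrite modnMml -(prednK k0) expnS -mulnA modnMr.
rewrite vE abszN absz_nat.
rewrite (_ : xget 0 _ = u)//; case: xgetP => [v _ /esym|/(_ u)]; last by case.
move/(mulfI _); rewrite invr_eq0 expf_neq0 ?padic_p_neq0// => /(_ isT).
by move/eqP; rewrite tofrac_eq => /eqP.
Qed.

End Padic.

Local Open Scope complex_scope.

(* The Borel structure of R[i] is that of R * R. *)
HB.instance Definition _ (R : realType) := isPointed.Build R[i] 0.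

Definition complex_pair (R : realType) (z : R[i]) : R * R :=
  (complex.Re z, complex.Im z).

HB.instance Definition _ (R : realType) :=
  Measurable.copy R[i] (g_sigma_algebra_preimageType (@complex_pair R)).

Definition Cmod (R : realType) (z : R[i]) : R := complex.Re `|z|.

Section StableIntegral.
Context {R : realType} {d d' : measure_display}.
Context {Omega : measurableType d} (P : probability Omega R).
Context {E : measurableType d'} (mu : {measure set E -> \bar R}) (alpha : R).

Definition independent d'' (V : measurableType d'') n
    (X : 'I_n -> {RV P >-> V}) : Prop :=
  forall B : 'I_n -> set V, (forall i, measurable (B i)) ->
    P (\bigcap_i (X i @^-1` B i)) = (\prod_(i < n) P (X i @^-1` B i))%E.

Definition independently_scattered d'' (V : measurableType d'')
    (M : set E -> {RV P >-> V}) : Prop :=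
  forall n (A : 'I_n -> set E),
    (forall i, measurable (A i) /\ (mu (A i) < +oo)%E) -> trivIset setT A ->
    independent (fun i => M (A i)).

(* E[exp(i Y)] *)
Definition expectation_expi (Y : Omega -> R) : R[i] :=
  fine 'E_P[fun w => cos (Y w)] +i* fine 'E_P[fun w => sin (Y w)].

(* M is constrained only on measurable sets of finite measure. *)
Record SaS_measure (M : set E -> {RV P >-> R}) : Prop := {
  SaS_scattered : independently_scattered M;
  SaS_additive : forall A : (set E)^nat,
    (forall i, measurable (A i)) -> trivIset setT A ->
    (mu (\bigcup_i A i) < +oo)%E ->
    {ae P, forall w,
      (fun n => \sum_(i < n) M (A i) w) @ \oo --> M (\bigcup_i A i) w};
  SaS_chf : forall A, measurable A -> (mu A < +oo)%E -> forall theta : R,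
    expectation_expi (fun w => theta * M A w) =
    (expR (- (`|theta| `^ alpha * fine (mu A))))%:C }.

Record isotropic_SaS_measure (M : set E -> {RV P >-> R[i]}) : Prop := {
  iSaS_scattered : independently_scattered M;
  iSaS_additive : forall A : (set E)^nat,
    (forall i, measurable (A i)) -> trivIset setT A ->
    (mu (\bigcup_i A i) < +oo)%E ->
    {ae P, forall w,
      (fun n => Cmod (\sum_(i < n) M (A i) w - M (\bigcup_i A i) w)) @ \oo --> 0};
  iSaS_chf : forall A, measurable A -> (mu A < +oo)%E -> forall theta : R[i],
    expectation_expi (fun w => complex.Re (theta^* * M A w)) =
    (expR (- (Cmod theta `^ alpha * fine (mu A))))%:C }.

(* The integral of a simple function f, vanishing off a set of finite
   measure, is the sum of c M(f = c) over the values c of f.  The term c = 0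
   drops out whatever the value of M on the set f = 0, whose measure may be
   infinite. *)
Definition simple_integral (M : set E -> {RV P >-> R}) (f : {sfun E >-> R})
    (w : Omega) : R :=
  \sum_(c \in range f) c * M (f @^-1` [set c]) w.

Definition simple_Cintegral (M : set E -> {RV P >-> R[i]})
    (f : {fimfun E >-> R[i]}) (w : Omega) : R[i] :=
  \sum_(c \in range f) c * M (f @^-1` [set c]) w.

Definition LalphaC (f : E -> R[i]) : Prop :=
  measurable_fun setT f /\ (fun x => Cmod (f x)) \in Lfun mu alpha%:E.

Definition is_stable_integral (M : set E -> {RV P >-> R}) (f : E -> R)
    (Y : {RV P >-> R}) : Prop :=
  f \in Lfun mu alpha%:E /\
  exists s : nat -> {sfun E >-> R},
    [/\ forall n, (mu (s n @^-1` [set~ 0%R]) < +oo)%E,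
        (fun n => \int[mu]_x (`|s n x - f x| `^ alpha)%:E)%E @ \oo --> 0%E &
        forall eps : R, 0 < eps ->
          (fun n => P [set w | eps <= `|simple_integral M (s n) w - Y w|])
            @ \oo --> 0%E].

Definition is_stable_Cintegral (M : set E -> {RV P >-> R[i]}) (f : E -> R[i])
    (Y : {RV P >-> R[i]}) : Prop :=
  LalphaC f /\
  exists s : nat -> {fimfun E >-> R[i]},
    [/\ forall n, measurable_fun setT (s n) /\
                  (mu (s n @^-1` [set~ 0%R]) < +oo)%E,
        (fun n => \int[mu]_x (Cmod (s n x - f x) `^ alpha)%:E)%E @ \oo --> 0%E &
        forall eps : R, 0 < eps ->
          (fun n => P [set w | eps <= Cmod (simple_Cintegral M (s n) w - Y w)])
            @ \oo --> 0%E].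

End StableIntegral.

Section SelfSimilarity.
Context {R : realType} {d : measure_display}.
Context {Omega : measurableType d} (P : probability Omega R).

Definition eq_fdd (T : Type) (X Y : T -> Omega -> R) : Prop :=
  forall n (t : n.-tuple T) (B : set (n.-tuple R)), measurable B ->
    P [set w | B [tuple X (tnth t i) w | i < n]] =
    P [set w | B [tuple Y (tnth t i) w | i < n]].

Variables (p : nat) (p_pr : prime p).
Local Notation Qp := (padic p_pr).

Definition padic_sssi_index (H : R) (X : Qp -> {RV P >-> R}) : Prop :=
  (forall a : Qp, a != 0 ->
    eq_fdd (fun t => X (a * t)) (fun t w => padic_norm R a `^ H * X t w)) /\
  (forall h : Qp, eq_fdd (fun t w => X (t + h) w - X h w) X).

Definition padic_sssi (X : Qp -> {RV P >-> R}) : Prop :=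
  exists2 H : R, 0 < H & padic_sssi_index H X.

Definition discrete_padic_sssi (X : nat -> {RV P >-> R}) : Prop :=
  exists2 H : R, 0 < H &
    (forall a : nat, (0 < a)%N ->
      eq_fdd (fun n => X (a * n)%N)
             (fun n w => padic_norm R (a%:R : Qp) `^ H * X n w)) /\
    (forall h : nat, eq_fdd (fun n w => X (n + h)%N w - X h w) X).

End SelfSimilarity.
Arguments padic_sssi {R d Omega P p p_pr}.
Arguments discrete_padic_sssi {R d Omega P p}.

Section Kernels.
Variables (R : realType) (p : nat) (p_pr : prime p).
Local Notation Qp := (padic p_pr).

Definition padic_haar (m : {measure set Qp -> \bar R}) : Prop :=
  (forall (a : Qp) (A : set Qp), measurable A ->
    m [set a + x | x in A] = m A) /\
  m (@Zp_set p p_pr) = 1%E.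

(* At the singular points, ln 0 = 0, and powR 0 r is 0 for r != 0. *)
Definition log_kernel (t x : Qp) : R :=
  ln (padic_norm R (t - x)) - ln (padic_norm R x).

Definition linear_kernel (alpha H : R) (t x : Qp) : R :=
  padic_norm R (t - x) `^ (H - alpha^-1) - padic_norm R x `^ (H - alpha^-1).

Definition harmonizable_kernel (alpha H : R) (t xi : Qp) : R[i] :=
  (padic_char R (t * xi) - 1) * (padic_norm R xi `^ (- H - alpha^-1))%:C.

End Kernels.

(* A pair (k, r) is the residue class r in Z/p^(k+1)Z at level k. *)
Definition brw_tree (p : nat) := {k : nat & 'Z_(p ^ k.+1)}.

HB.instance Definition _ (p : nat) := Choice.on (brw_tree p).
HB.instance Definition _ (p : nat) :=
  isPointed.Build (brw_tree p) (existT (fun k => 'Z_(p ^ k.+1)) 0%N 0).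
HB.instance Definition _ (p : nat) :=
  @isMeasurable.Build default_measure_display (brw_tree p) discrete_measurable
    discrete_measurable0 discrete_measurableC discrete_measurableU.

Definition brw_kernel (R : realType) (p : nat) (H : R) (n : nat)
    (e : brw_tree p) : R :=
  p%:R `^ (- ((tag e)%:R * H)) *
  ((tagged e == n%:R)%:R - (tagged e == 0)%:R).
Arguments brw_kernel {R} p H n e.

(* Main.v *)
Require Import Defs.
From HB Require Import structures.
From mathcomp Require Import all_boot all_order all_algebra.
From mathcomp Require Import finmap.
From mathcomp Require Import all_classical all_reals all_analysis.
From mathcomp Require Import measurable_realfun.
From mathcomp Require Import complex.
From mathcomp Require Import ring lra zify.
Import Order.TTheory GRing.Theory Num.Theory.
Import numFieldNormedType.Exports.
Local Open Scope classical_set_scope.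
Local Open Scope ring_scope.

Set Implicit Arguments.
Unset Strict Implicit.
Unset Printing Implicit Defensive.

(** In each of the assertions, both sides of an equality of finite-dimensional
    distributions are families of stable integrals with respect to one and the
    same random measure. The law of such a family is determined by its energies:
    the characteristic function of a linear combination of integrals is
    exp(- int |sum_i theta_i f_i|^alpha), and characteristic functions determine
    laws. So each assertion reduces to an identity between integrals of kernels,
    which a change of variables proves.

    The probabilistic part establishes this reduction, stable_int_eq_fdd. The
    uniqueness theorem eq_law_characteristic approximates indicators of boxes by
    trigonometric polynomials. The formula for the characteristic function,
    mean_stable_int, holds for elementary functions, whose sets can be made
    disjoint so that the terms of the integral are independent, and passes to
    limits. The real and the isotropic complex random measures are treated at
    once by the notion of a stable field.

    For the p-adic kernels, the affine map x |-> a x + h multiplies integrals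
    with respect to Haar measure by 1/|a| (haar_affine). With K_t the kernel:
    - the increment K_(t+h) - K_h of the logarithmic and of the linear kernel is
      K_t translated by h, and for the harmonizable kernel it is K_t times a
      character, of modulus one;
    - K_(at) at the point a x is K_t for the logarithmic kernel and
      |a|^(H - 1/alpha) K_t for the linear one; K_(at) at the point x / a is
      |a|^(H + 1/alpha) K_t for the harmonizable kernel.
    With the Jacobian, every energy is multiplied by |a|^(alpha H), where
    H = 1/alpha for the logarithmic kernel. The kernels belong to L^alpha because
    the first two vanish outside a ball and the third vanishes near 0, where the
    character is trivial; the rest is a geometric series over spheres.

    On the tree, translation of the residues and multiplication by an integer
    prime to p permute each level, while multiplication by p embeds level k into
    level k + 1, whose weight is smaller by the factor p^(-H), and the kernels
    K_(pn) vanish off the image. *)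

(** * Means of bounded random variables *)
Section BoundedMeans.
Context {R : realType} {d : measure_display} {Omega : measurableType d}.
Variable P : probability Omega R.

Definition bounded_rv (f : Omega -> R) :=
  measurable_fun setT f /\ exists M : R, forall w, `|f w| <= M.

Lemma bounded_rv_integrable f : bounded_rv f -> P.-integrable setT (EFin \o f).
Proof.
move=> [mf [M fM]]; apply: measurable_bounded_integrable => //.
  by rewrite [X in (X < _)%E](probability_setT P) ltry.
exists M; split; first exact: num_real.
by move=> x Mx w _ /=; exact: le_trans (fM w) (ltW Mx).
Qed.

Lemma bounded_rv_cst r : bounded_rv (fun=> r).
Proof. by split => //; exists `|r|. Qed.

Lemma bounded_rvD f g : bounded_rv f -> bounded_rv g ->
  bounded_rv (fun w => f w + g w).
Proof.
move=> [mf [M fM]] [mg [N gN]]; split; first exact: measurable_funD.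
by exists (M + N) => w; apply: le_trans (ler_normD _ _) _; apply: lerD.
Qed.

Lemma bounded_rvM f g : bounded_rv f -> bounded_rv g ->
  bounded_rv (fun w => f w * g w).
Proof.
move=> [mf [M fM]] [mg [N gN]]; split; first exact: measurable_funM.
by exists (M * N) => w; rewrite normrM ler_pM.
Qed.

Lemma bounded_rvZ r f : bounded_rv f -> bounded_rv (fun w => r * f w).
Proof. by move=> bf; apply: bounded_rvM => //; exact: bounded_rv_cst. Qed.

Lemma bounded_rvB f g : bounded_rv f -> bounded_rv g ->
  bounded_rv (fun w => f w - g w).
Proof.
move=> bf bg; apply: bounded_rvD => //.
by under eq_fun do rewrite -mulN1r; exact: bounded_rvZ.
Qed.

Lemma bounded_rv_cos f : measurable_fun setT f ->
  bounded_rv (fun w => cos (f w)).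
Proof.
move=> mf; split; last by exists 1 => w; rewrite ler_norml cos_geN1 cos_le1.
apply: (measurableT_comp (f := @cos R)) => //.
by apply: continuous_measurable_fun; exact: continuous_cos.
Qed.

Lemma bounded_rv_sin f : measurable_fun setT f ->
  bounded_rv (fun w => sin (f w)).
Proof.
move=> mf; split; last by exists 1 => w; rewrite ler_norml sin_geN1 sin_le1.
apply: (measurableT_comp (f := @sin R)) => //.
by apply: continuous_measurable_fun; exact: continuous_sin.
Qed.

Lemma bounded_rv_indic (X : Omega -> R) (B : set R) :
  measurable_fun setT X -> measurable B ->
  bounded_rv (fun w => \1_B (X w)).
Proof.
move=> mX mB; split; first by apply: (measurableT_comp _ mX); exact: measurable_indic.
by exists 1 => w; rewrite indicE; case: (_ \in _); rewrite ?normr1 ?normr0.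
Qed.

Lemma bounded_rv_prod I (s : seq I) (p : pred I) (f : I -> Omega -> R) :
  (forall i, bounded_rv (f i)) ->
  bounded_rv (fun w => \prod_(i <- s | p i) f i w).
Proof.
move=> bf; elim: s => [|i s IH].
  by under eq_fun do rewrite big_nil; exact: bounded_rv_cst.
under eq_fun do rewrite big_cons; case: (p i) => //.
exact: bounded_rvM.
Qed.

Definition mean (f : Omega -> R) := (\int[P]_w f w)%R.

Lemma meanD f g : bounded_rv f -> bounded_rv g ->
  mean (fun w => f w + g w) = mean f + mean g.
Proof. by move=> bf bg; rewrite /mean RintegralD//; exact: bounded_rv_integrable. Qed.

Lemma meanB f g : bounded_rv f -> bounded_rv g ->
  mean (fun w => f w - g w) = mean f - mean g.
Proof. by move=> bf bg; rewrite /mean RintegralB//; exact: bounded_rv_integrable. Qed.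

Lemma meanZ r f : bounded_rv f -> mean (fun w => r * f w) = r * mean f.
Proof. by move=> bf; rewrite /mean RintegralZl//; exact: bounded_rv_integrable. Qed.

Lemma mean_cst r : mean (fun=> r) = r.
Proof. by rewrite /mean Rintegral_cst// [X in fine X](probability_setT P) mulr1. Qed.

Lemma le_mean f g : bounded_rv f -> bounded_rv g -> (forall w, f w <= g w) ->
  mean f <= mean g.
Proof.
by move=> bf bg fg; apply: le_Rintegral => //; exact: bounded_rv_integrable.
Qed.

Lemma mean_indic (A : set Omega) : measurable A -> mean \1_A = fine (P A).
Proof. by move=> mA; rewrite /mean /Rintegral integral_indic// setIT. Qed.

(** Dominated convergence with a constant bound, as P is finite. *)
Lemma mean_cvg (f_ : nat -> Omega -> R) (f : Omega -> R) M :
  (forall n, measurable_fun setT (f_ n)) ->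
  (forall n w, `|f_ n w| <= M) -> (forall w, f_ ^~ w @ \oo --> f w) ->
  mean (f_ n) @[n --> \oo] --> mean f.
Proof.
move=> mf fM cf.
have mlim : measurable_fun setT f.
  by apply: (measurable_fun_cvg mf) => w _; exact: cf.
have bfM w : `|f w| <= M.
  have cn : `|f_ n w| @[n --> \oo] --> `|f w| by apply: cvg_norm; exact: cf.
  rewrite -(cvg_lim _ cn)//; apply: limr_le; first by apply/cvg_ex; eexists; exact: cn.
  by near=> n.
have [] := @dominated_convergence _ _ _ P setT measurableT
  (fun n w => (f_ n w)%:E) (EFin \o f) (fun=> M%:E).
- by move=> n; exact/measurable_EFinP.
- exact/measurable_EFinP.
- by apply: aeW => w _; apply: cvg_EFin; [near=> n|exact: cf].
- by apply: (@bounded_rv_integrable (fun=> M)); exact: bounded_rv_cst.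
- by apply: aeW => w n _; rewrite /= lee_fin.
move=> fi _ cv; rewrite /mean /Rintegral; apply: fine_cvg.
rewrite fineK; first exact: cv.
exact: integrable_fin_num.
Unshelve. all: by end_near. Qed.

End BoundedMeans.

(** * Cosines and sines of linear forms determine a law *)
Section TrigonometricPolynomials.
Context {R : realType} (n : nat).
Local Notation V := ('I_n -> R).

(** The phase c makes sines special cases of cosines, so that products stay in
    the class. *)
Inductive trigonometric : (V -> R) -> Prop :=
| trigonometric_cos (theta : V) (c : R) :
    trigonometric (fun x => cos (\sum_i theta i * x i + c))
| trigonometricD f g : trigonometric f -> trigonometric g ->
    trigonometric (fun x => f x + g x)
| trigonometricZ r f : trigonometric f -> trigonometric (fun x => r * f x).

Lemma trigonometric_cst r : trigonometric (fun=> r).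
Proof.
rewrite (_ : (fun=> r) = fun x : V => r * cos (\sum_i 0 * x i + 0)); last first.
  by apply/funext => x; rewrite addr0 big1 ?cos0 ?mulr1// => i _; rewrite mul0r.
by apply: trigonometricZ; exact: (trigonometric_cos (fun=> 0)).
Qed.

(** By the product-to-sum formula for two cosines. *)
Lemma trigonometricM f g : trigonometric f -> trigonometric g ->
  trigonometric (fun x => f x * g x).
Proof.
move=> tf; elim: tf g => {f} [theta c g tg|f1 f2 _ IH1 _ IH2 g tg|r f _ IH g tg].
- elim: tg => {g} [eta e|g1 g2 _ IH1 _ IH2|r g _ IH].
  + rewrite (_ : (fun x => _) = fun x : V => 2^-1 *
        (cos (\sum_i (theta i + eta i) * x i + (c + e)) +
         cos (\sum_i (theta i - eta i) * x i + (c - e)))).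
      by apply: trigonometricZ; apply: trigonometricD;
        [exact: (trigonometric_cos (fun i => theta i + eta i))
        |exact: (trigonometric_cos (fun i => theta i - eta i))].
    apply/funext => x.
    under [in X in cos X + _]eq_bigr do rewrite mulrDl.
    under [in X in _ + cos X]eq_bigr do rewrite mulrBl.
    rewrite big_split/= sumrB.
    set a := \sum_i theta i * x i; set b := \sum_i eta i * x i.
    rewrite (_ : a + b + _ = (a + c) + (b + e)); last by ring.
    rewrite (_ : a - b + _ = (a + c) - (b + e)); last by ring.
    by rewrite [cos (a + c + (b + e))]cosD cosB; field.
  + by under eq_fun do rewrite mulrDr; exact: trigonometricD.
  + by under eq_fun do rewrite mulrCA; exact: trigonometricZ.
- under eq_fun do rewrite mulrDl.
  by apply: trigonometricD; [exact: IH1|exact: IH2].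
- by under eq_fun do rewrite -mulrA; apply: trigonometricZ; exact: IH.
Qed.

Lemma trigonometricX f k : trigonometric f -> trigonometric (fun x => f x ^+ k).
Proof.
move=> tf; elim: k => [|k IH].
  by under eq_fun do rewrite expr0; exact: trigonometric_cst.
by under eq_fun do rewrite exprS; exact: trigonometricM.
Qed.

Lemma trigonometric_prod I (s : seq I) (f : I -> V -> R) :
  (forall i, trigonometric (f i)) ->
  trigonometric (fun x => \prod_(i <- s) f i x).
Proof.
move=> tf; elim: s => [|i s IH].
  by under eq_fun do rewrite big_nil; exact: trigonometric_cst.
by under eq_fun do rewrite big_cons; exact: trigonometricM.
Qed.

Lemma trigonometric_sin (i : 'I_n) (r c : R) :
  trigonometric (fun x => sin (r * (x i - c))).
Proof.
rewrite (_ : (fun x => _) = fun x : V =>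
  cos (\sum_j (r * (j == i)%:R) * x j + (- (r * c) - pi / 2))).
  exact: (trigonometric_cos (fun j => r * (j == i)%:R)).
apply/funext => x; rewrite (bigD1 i)//= eqxx mulr1 big1 ?addr0; last first.
  by move=> j /negPf ->; rewrite mulr0 mul0r.
by rewrite addrA cosBpihalf mulrBr.
Qed.

End TrigonometricPolynomials.

Section StepPolynomials.
Context {R : realType}.

(** The polynomials of the elementary proof of the Stone-Weierstrass theorem:
    on [0, 1] they converge boundedly to the indicator of [0, 1/2[. *)
Definition step_poly (n : nat) (y : R) : R := (1 - y ^+ n) ^+ (n * 2 ^ n).

Lemma step_poly_bound n y : 0 <= y <= 1 -> 0 <= step_poly n y <= 1.
Proof.
move=> /andP[y0 y1].
have yn0 : 0 <= y ^+ n by rewrite exprn_ge0.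
have yn1 : y ^+ n <= 1 by rewrite exprn_ile1.
by rewrite /step_poly exprn_ge0 ?subr_ge0//= exprn_ile1 ?subr_ge0// lerBlDr lerDl.
Qed.

Lemma bernoulli_ge (t : R) m : 0 <= t <= 1 -> 1 - m%:R * t <= (1 - t) ^+ m.
Proof.
move=> /andP[t0 t1]; elim: m => [|m IH]; first by rewrite mul0r subr0 expr0.
rewrite exprSr; apply: le_trans (_ : (1 - m%:R * t) * (1 - t) <= _); last first.
  by rewrite ler_wpM2r ?subr_ge0.
rewrite -natr1 -subr_ge0 (_ : _ - _ = m%:R * t ^+ 2); last by ring.
by rewrite mulr_ge0// sqr_ge0.
Qed.

Lemma bernoulli_le (t : R) m : 0 <= t <= 1 ->
  (1 - t) ^+ m * (1 + m%:R * t) <= 1.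
Proof.
move=> /andP[t0 t1]; elim: m => [|m IH]; first by rewrite mul0r addr0 expr0 mulr1.
apply: le_trans IH; rewrite exprSr -mulrA ler_wpM2l ?exprn_ge0 ?subr_ge0//.
rewrite -natr1 -subr_ge0 (_ : _ - _ = (m%:R + 1) * t ^+ 2); last by ring.
by rewrite mulr_ge0 ?addr_ge0// sqr_ge0.
Qed.

(** The first n terms of the geometric series are all at least s^n. *)
Lemma mulrn_expr_bound (s : R) n : 0 <= s < 1 -> n%:R * s ^+ n <= (1 - s)^-1.
Proof.
move=> /andP[s0 s1]; have s10 : 0 < 1 - s by rewrite subr_gt0.
suff h : n%:R * s ^+ n * (1 - s) <= 1 - s ^+ n.
  rewrite -ler_pdivlMr// in h; apply: le_trans h _.
  by rewrite ler_pdivrMr// mulVf ?gt_eqF// gerBl exprn_ge0.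
elim: n => [|n IH]; first by rewrite !mul0r expr0 subrr.
have sn : 0 <= s ^+ n by rewrite exprn_ge0.
rewrite -natr1 exprS.
have := ler_wpM2l s0 IH; have : 0 <= (1 - s) * (1 - s * s ^+ n).
  by rewrite mulr_ge0 ?subr_ge0 ?mulr_ile1 ?exprn_ile1// ltW.
move: (s ^+ n) sn => u u0 K H; lra.
Qed.

(** Write z^n as s^n s^n with s the square root of z: one factor absorbs n. *)
Lemma cvg_mulrn_expr (z : R) : 0 <= z < 1 -> n%:R * z ^+ n @[n --> \oo] --> 0.
Proof.
move=> /andP[z0 z1]; pose s := Num.sqrt z.
have s0 : 0 <= s by exact: sqrtr_ge0.
have sz : s ^+ 2 = z by rewrite sqr_sqrtr.
have s1 : s < 1 by rewrite -(@ltr_pXn2r _ 2)// ?nnegrE// sz expr1n.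
have h : (1 - s)^-1 * s ^+ n @[n --> \oo] --> 0.
  by apply: cvg_geometric; rewrite ger0_norm.
apply: (squeeze_cvgr (f := fun=> 0) _ _ h); last exact: cvg_cst.
apply: nearW => n; rewrite mulr_ge0 ?exprn_ge0//=.
rewrite -sz -exprM mulnC exprM expr2 mulrA ler_wpM2r ?exprn_ge0//.
by rewrite mulrn_expr_bound// s0.
Qed.

(** Bernoulli's inequalities squeeze the n-th polynomial between
    1 - n (2y)^n, which tends to 1 if y < 1/2, and 1 / (1 + n (2y)^n), which is
    at most 1 / (1 + n) if y >= 1/2. *)
Lemma cvg_step_poly (y : R) : 0 <= y <= 1 ->
  step_poly n y @[n --> \oo] --> ((y < 2^-1)%R%:R : R).
Proof.
move=> y01; have /andP[y0 y1] := y01.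
have yn n : 0 <= y ^+ n <= 1 by rewrite exprn_ge0// exprn_ile1.
case: ltP => y2.
- apply: (squeeze_cvgr (f := fun n => 1 - n%:R * (2 * y) ^+ n) (h := fun=> 1)).
  + apply: nearW => n; have /andP[_ ->] := step_poly_bound n y01; rewrite andbT.
    apply: le_trans (bernoulli_ge _ (yn n)).
    by rewrite exprMn natrM natrX mulrA.
  + rewrite -[X in _ --> X]subr0; apply: cvgB; first exact: cvg_cst.
    by apply: cvg_mulrn_expr; rewrite mulr_ge0//= mulrC -ltr_pdivlMr// mul1r.
  + exact: cvg_cst.
- apply: (squeeze_cvgr (f := fun=> 0) (h := fun n => (n.+1%:R)^-1)); last 2 first.
  + exact: cvg_cst.
  + exact: cvg_harmonic.
  apply: nearW => n; have /andP[-> _] := step_poly_bound n y01 => /=.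
  have h : 0 <= (n * 2 ^ n)%:R * y ^+ n by rewrite mulr_ge0//; case/andP : (yn n).
  have := bernoulli_le (n * 2 ^ n) (yn n); rewrite -ler_pdivlMr ?ltr_pwDl//.
  rewrite mul1r => /le_trans; apply; rewrite lef_pV2 ?posrE// ?ltr_pwDl//.
  rewrite -natr1 addrC lerD2l natrM natrX -mulrA -exprMn ler_peMr//.
  by rewrite exprn_ege1// mulrC -ler_pdivrMr// mul1r.
Qed.

End StepPolynomials.

Section CharacteristicUniqueness.
Context {R : realType} {d : measure_display} {Omega : measurableType d}.
Variable P : probability Omega R.

Lemma sin_small_lt0 (u : R) : - pi < u < pi -> (sin u < 0) = (u < 0).
Proof.
move=> /andP[u1 u2]; have [u0|u0] := ltP u 0.
  by rewrite -[u]opprK sinN oppr_lt0 sin_gt0_pi// oppr_gt0 u0 ltrNl.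
by apply/negbTE; rewrite -leNgt sin_ge0_pi// u0 ltW.
Qed.

(** Once |u| / (n + 1) < pi, the sine has the sign of u. *)
Lemma cvg_slow_sin (u : R) :
  ((1 + sin (n.+1%:R^-1 * u)) / 2 < 2^-1)%R%:R @[n --> \oo] --> ((u < 0)%R%:R : R).
Proof.
apply: cvg_near_cst.
have cu : n.+1%:R^-1 * u @[n --> \oo] --> 0.
  by rewrite -(mul0r u); apply: cvgM; [exact: cvg_harmonic|exact: cvg_cst].
have /cvgr0Pnorm_lt/(_ pi (pi_gt0 R)) [N _ hN] := cu.
exists N => // n /hN; rewrite ltr_norml => h.
rewrite ltr_pdivrMr// mulVf// gtrDl sin_small_lt0//.
by rewrite pmulr_rlt0// invr_gt0.
Qed.

Section SameCharacteristic.
Variables (n : nat) (X Y : 'I_n -> Omega -> R).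
Hypothesis mX : forall i, measurable_fun setT (X i).
Hypothesis mY : forall i, measurable_fun setT (Y i).
Hypothesis XYcos : forall theta : 'I_n -> R,
  mean P (fun w => cos (\sum_i theta i * X i w)) =
  mean P (fun w => cos (\sum_i theta i * Y i w)).
Hypothesis XYsin : forall theta : 'I_n -> R,
  mean P (fun w => sin (\sum_i theta i * X i w)) =
  mean P (fun w => sin (\sum_i theta i * Y i w)).

Let measurable_lin (Z : 'I_n -> Omega -> R) (theta : 'I_n -> R) :
  (forall i, measurable_fun setT (Z i)) ->
  measurable_fun setT (fun w => \sum_i theta i * Z i w).
Proof. by move=> mZ; apply: measurable_sum => i; exact: measurable_funM. Qed.

Let bounded_trigonometric (Z : 'I_n -> Omega -> R) f :
  (forall i, measurable_fun setT (Z i)) -> trigonometric f ->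
  bounded_rv (fun w => f (Z ^~ w)).
Proof.
move=> mZ; elim => {f} [theta c|f g _ IH1 _ IH2|r f _ IH].
- by apply: bounded_rv_cos; apply: measurable_funD => //; exact: measurable_lin.
- exact: bounded_rvD.
- exact: bounded_rvZ.
Qed.

Let mean_trigonometric f : trigonometric f ->
  mean P (fun w => f (X ^~ w)) = mean P (fun w => f (Y ^~ w)).
Proof.
elim => {f} [theta c|f g tf IHf tg IHg|r f tf IH].
- have E (Z : 'I_n -> Omega -> R) : (forall i, measurable_fun setT (Z i)) ->
    mean P (fun w => cos (\sum_i theta i * Z i w + c)) =
    cos c * mean P (fun w => cos (\sum_i theta i * Z i w)) -
    sin c * mean P (fun w => sin (\sum_i theta i * Z i w)).
    move=> mZ; have mL := measurable_lin theta mZ.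
    rewrite -meanZ; last exact: bounded_rv_cos.
    rewrite -meanZ; last exact: bounded_rv_sin.
    rewrite -meanB; last 2 first.
    + by apply: bounded_rvZ; exact: bounded_rv_cos.
    + by apply: bounded_rvZ; exact: bounded_rv_sin.
    by congr mean; apply/funext => w; rewrite cosD [cos c * _]mulrC [sin c * _]mulrC.
  by rewrite !E// XYcos XYsin.
- by rewrite !meanD ?IHf ?IHg//; exact: bounded_trigonometric.
- by rewrite !meanZ ?IH//; exact: bounded_trigonometric.
Qed.

(** A box is a bounded limit of trigonometric polynomials: products over the
    coordinates of step_poly n y, where y = (1 + sin ((x i - a i) / k)) / 2 is
    below 1/2 when x i < a i, provided k is large; n goes to infinity, then k. *)
Let mean_box (a : 'I_n -> R) :
  mean P (fun w => \prod_i (X i w < a i)%R%:R) =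
  mean P (fun w => \prod_i (Y i w < a i)%R%:R).
Proof.
pose y k (x : R) : R := (1 + sin (k.+1%:R^-1 * x)) / 2.
have y01 k x : 0 <= y k x <= 1.
  have h1 := sin_geN1 (k.+1%:R^-1 * x); have h2 := sin_le1 (k.+1%:R^-1 * x).
  by apply/andP; split; rewrite /y; lra.
pose f k m (x : 'I_n -> R) := \prod_i step_poly m (y k (x i - a i)).
pose g k (x : 'I_n -> R) : R := \prod_i (y k (x i - a i) < 2^-1)%R%:R.
pose h (x : 'I_n -> R) : R := \prod_i (x i < a i)%R%:R.
have tf k m : trigonometric (f k m).
  apply: trigonometric_prod => i; rewrite /step_poly; apply: trigonometricX.
  have -> : (fun x : 'I_n -> R => 1 - y k (x i - a i) ^+ m) =
    (fun x => 1 + -1 * y k (x i - a i) ^+ m) by apply/funext => x; rewrite mulN1r.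
  apply: trigonometricD; first exact: trigonometric_cst.
  apply: trigonometricZ; apply: trigonometricX; rewrite /y.
  under eq_fun do rewrite mulrC; apply: trigonometricZ.
  apply: trigonometricD; first exact: trigonometric_cst.
  exact: trigonometric_sin.
have cfg k x : f k m x @[m --> \oo] --> g k x.
  by apply: cvg_big; [exact: mul_continuous|move=> i _; exact: cvg_step_poly].
have cgh x : g k x @[k --> \oo] --> h x.
  apply: cvg_big; first exact: mul_continuous.
  by move=> i _; rewrite -subr_lt0; exact: cvg_slow_sin.
have prod1 (b : 'I_n -> R) : (forall i, 0 <= b i <= 1) -> `|\prod_i b i| <= 1.
  move=> b01; rewrite ger0_norm; last by apply: prodr_ge0 => i _; case/andP : (b01 i).
  by apply: prodr_ile1 => i _; exact: b01.
have bf k m x : `|f k m x| <= 1 by apply: prod1 => i; exact: step_poly_bound.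
have bg k x : `|g k x| <= 1.
  by apply: prod1 => i; case: (_ < _); rewrite lexx ler01.
have mfZ (Z : 'I_n -> Omega -> R) k m : (forall i, measurable_fun setT (Z i)) ->
    measurable_fun setT (fun w => f k m (Z ^~ w)).
  by move=> mZ; case: (bounded_trigonometric mZ (tf k m)).
have mgZ (Z : 'I_n -> Omega -> R) k : (forall i, measurable_fun setT (Z i)) ->
    measurable_fun setT (fun w => g k (Z ^~ w)).
  move=> mZ; apply: (measurable_fun_cvg (fun m => mfZ _ k m mZ)) => w _.
  exact: cfg.
have fg (Z : 'I_n -> Omega -> R) k : (forall i, measurable_fun setT (Z i)) ->
    mean P (fun w => f k m (Z ^~ w)) @[m --> \oo] --> mean P (fun w => g k (Z ^~ w)).
  move=> mZ; apply: (mean_cvg (M := 1)); [|by []|by []].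
  by move=> m; exact: mfZ.
have gh (Z : 'I_n -> Omega -> R) : (forall i, measurable_fun setT (Z i)) ->
    mean P (fun w => g k (Z ^~ w)) @[k --> \oo] --> mean P (fun w => h (Z ^~ w)).
  move=> mZ; apply: (mean_cvg (M := 1)); [|by []|by []].
  by move=> m; exact: mgZ.
have eg k : mean P (fun w => g k (X ^~ w)) = mean P (fun w => g k (Y ^~ w)).
  apply: (cvg_unique _ (fg X k mX)) => //=.
  have -> : (fun m => mean P (fun w => f k m (X ^~ w))) =
      (fun m => mean P (fun w => f k m (Y ^~ w))).
    by apply/funext => m; exact: mean_trigonometric.
  exact: fg.
apply: (cvg_unique _ (gh X mX)) => //=.
have -> : (fun k => mean P (fun w => g k (X ^~ w))) =
    (fun k => mean P (fun w => g k (Y ^~ w))) by apply/funext => k.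
exact: gh.
Qed.

Let tupleX (Z : 'I_n -> Omega -> R) w : n.-tuple R := [tuple Z i w | i < n].

Let measurable_tuple Z : (forall i, measurable_fun setT (Z i)) ->
  measurable_fun setT (tupleX Z).
Proof.
move=> mZ; apply/measurable_fun_tnthP => i.
by rewrite (_ : _ \o _ = Z i)//; apply/funext => w /=; rewrite tnth_mktuple.
Qed.

Let box (a : 'I_n -> R) : set (n.-tuple R) :=
  [set t | forall i, tnth t i < a i].

Let boxE (a : 'I_n -> R) : box a =
  \bigcap_(i in [set: 'I_n]) (fun t : n.-tuple R => tnth t i) @^-1` `]-oo, a i[%classic.
Proof.
apply/seteqP; split => t /=.
  by move=> ta i _ /=; rewrite in_itv/=.
by move=> ta i; have := ta i I; rewrite /= in_itv.
Qed.

Let measurable_box a : measurable (box a).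
Proof.
rewrite boxE; apply: fin_bigcap_measurable => // i _.
by rewrite -[X in measurable X]setTI; exact: measurable_tnth.
Qed.

Let boxes := [set box a | a in [set: 'I_n -> R]].

Let prob_box (Z : 'I_n -> Omega -> R) a :
  (forall i, measurable_fun setT (Z i)) ->
  P (tupleX Z @^-1` box a) = (mean P (fun w => \prod_i (Z i w < a i)%R%:R))%:E.
Proof.
move=> mZ.
have mA : measurable (tupleX Z @^-1` box a).
  by rewrite -[X in measurable X]setTI; exact: (measurable_tuple mZ).
rewrite -[LHS]fineK ?fin_num_measure//; congr EFin; rewrite -mean_indic//.
congr mean; apply/funext => w; rewrite indicE.
have [/set_mem/= wA|/negP wA] := boolP (w \in tupleX Z @^-1` box a).
  by rewrite big1// => i _; have := wA i; rewrite tnth_mktuple => ->.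
apply/esym/eqP; rewrite prodf_seq_eq0; apply/hasP.
apply: contrapT => h; apply: wA; apply/mem_set => i /=; rewrite tnth_mktuple.
apply: contrapT => /negP/negPf hi; apply: h.
by exists i; rewrite ?mem_index_enum//= hi.
Qed.

Let measurable_boxes : @measurable _ (n.-tuple R) = <<s boxes >>.
Proof.
apply/seteqP; split; last first.
  apply: smallest_sub; first exact: sigma_algebra_measurable.
  by move=> _ [a _ <-]; exact: measurable_box.
apply: smallest_sub; first exact: smallest_sigma_algebra.
rewrite -bigcup_seq/=; apply: bigcup_sub => i _.
pose T := g_sigma_algebraType boxes.
have mi : measurable_fun [set: T] (fun t : T => tnth (t : n.-tuple R) i).
  apply: (measurability _ (RGenInftyO.measurableE R)).
  move=> _ [_ [x ->] <-]; rewrite setTI.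
  (* A half-space is the union of the boxes whose other sides are k. *)
  have -> : (fun t : T => tnth (t : n.-tuple R) i) @^-1` `]-oo, x[%classic =
      \bigcup_k (box (fun j => if j == i then x else k%:R) : set T).
    apply/seteqP; split => t /=.
      rewrite in_itv/= => tx.
      pose M : R := \sum_j `|tnth t j|.
      exists (Num.bound M) => //= j; case: eqP => [->//|_].
      apply: le_lt_trans (_ : M < _); last first.
        by rewrite archi_boundP// sumr_ge0.
      by rewrite /M (bigD1 j)//= (le_trans (ler_norm _))// lerDl sumr_ge0.
    by move=> [k _ /(_ i)]; rewrite eqxx in_itv.
  by apply: bigcupT_measurable => k; apply: sub_sigma_algebra; eexists.
move=> _ [B mB <-].
exact: (mi measurableT B mB).
Qed.

(** The uniqueness theorem for characteristic functions. The boxes form a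
    pi-system that generates the measurable sets, and their probabilities are
    given by mean_box. *)
Lemma eq_law_characteristic (B : set (n.-tuple R)) : measurable B ->
  P [set w | B [tuple X i w | i < n]] = P [set w | B [tuple Y i w | i < n]].
Proof.
move=> mB.
pose mX' := measurable_tuple mX; pose mY' := measurable_tuple mY.
pose fX : {mfun Omega >-> n.-tuple R} :=
  HB.pack (tupleX X) (isMeasurableFun.Build _ _ _ _ _ mX').
pose fY : {mfun Omega >-> n.-tuple R} :=
  HB.pack (tupleX Y) (isMeasurableFun.Build _ _ _ _ _ mY').
have := @measure_unique _ R (n.-tuple R) boxes (fun k => box (fun=> k%:R)) measurable_boxes
  _ _ _ (distribution P fX) (distribution P fY) _ _ B mB.
apply.
- move=> _ _ [a _ <-] [b _ <-]; exists (fun i => Num.min (a i) (b i)) => //.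
  apply/seteqP; split => t /=.
    by move=> h; split => i; have := h i; rewrite lt_min => /andP[].
  by move=> [h1 h2] i; rewrite lt_min h1 h2.
- by move=> k; eexists.
- apply/seteqP; split => t _ //=; pose M : R := \sum_j `|tnth t j|.
  exists (Num.bound M) => //= j; apply: le_lt_trans (_ : M < _); last first.
    by rewrite archi_boundP// sumr_ge0.
  by rewrite /M (bigD1 j)//= (le_trans (ler_norm _))// lerDl sumr_ge0.
- move=> _ [a _ <-].
  exact: etrans (prob_box a mX) (etrans (congr1 EFin (mean_box a)) (esym (prob_box a mY))).
- by move=> k; rewrite [X in (X < _)%E](prob_box (fun=> k%:R) mX) ltry.
Qed.

End SameCharacteristic.
End CharacteristicUniqueness.

(** * Characteristic functions of independent sums *)

Section IndependentSums.
Context {R : realType} {d : measure_display} {Omega : measurableType d}.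
Variable P : probability Omega R.

(** This writes the integer part of a function as a sum of indicators of its
    upper level sets. *)
Lemma sum_nat_le_truncn (t : R) K : (Num.truncn t <= K)%N -> 0 <= t ->
  (\sum_(k < K) (k.+1%:R <= t)%R = Num.truncn t)%N.
Proof.
move=> tK t0; under eq_bigr => k _ do rewrite -truncn_ge_nat//.
rewrite -(subnKC tK) big_split_ord/=.
rewrite [X in (X + _)%N](eq_bigr (fun=> 1%N)); last by move=> i _; rewrite ltn_ord.
rewrite [X in (_ + X)%N](eq_bigr (fun=> 0%N)); last first.
  by move=> i _; rewrite ltnNge leq_addr.
by rewrite sum_nat_const card_ord muln1 sum_nat_const muln0 addn0.
Qed.

(** The integer parts of (m + 1) g, divided by m + 1, converge to g and are
    finite sums of indicators. *)
Lemma mean_factor_ge0 (W X : Omega -> R) (kappa M : R) (g : R -> R) :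
  bounded_rv W -> measurable_fun setT X ->
  (forall B, measurable B -> mean P (fun w => W w * \1_B (X w)) =
                             kappa * mean P (fun w => \1_B (X w))) ->
  measurable_fun setT g -> (forall x, 0 <= g x <= M) ->
  mean P (fun w => W w * g (X w)) = kappa * mean P (fun w => g (X w)).
Proof.
move=> bW mX WX mg gM.
have g0 x : 0 <= g x by case/andP : (gM x).
pose B k m : set R := [set x | k.+1%:R <= m.+1%:R * g x].
have mB k m : measurable (B k m).
  rewrite -[B k m]setTI; apply: measurable_fun_ler => //.
  by apply: measurable_funM.
pose K m := Num.truncn (m.+1%:R * M).
pose G m x : R := m.+1%:R^-1 * \sum_(k < K m) \1_(B k m) x.
have GE m x : G m x = m.+1%:R^-1 * (Num.truncn (m.+1%:R * g x))%:R.
  rewrite /G -(@sum_nat_le_truncn _ (K m)); last 2 first.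
  - by apply: le_truncn; rewrite ler_wpM2l//; case/andP : (gM x).
  - by rewrite mulr_ge0.
  rewrite natr_sum; congr (_ * _); apply: eq_bigr => k _.
  by rewrite indicE/=; congr ((nat_of_bool _)%:R); apply/idP/idP => [/set_mem|/mem_set].
have m0 m : 0 < m.+1%:R :> R by [].
have Gg m x : g x - m.+1%:R^-1 <= G m x <= g x.
  have := truncn_itv (mulr_ge0 (ltW (m0 m)) (g0 x)); rewrite GE => /andP[h1 h2].
  rewrite ler_pdivrMl// h1 andbT ler_pdivlMl// mulrBr mulfV ?gt_eqF//.
  by rewrite lerBlDr natr1 ltW.
have G0 m x : 0 <= G m x by rewrite GE mulr_ge0// invr_ge0.
have cG x : G m x @[m --> \oo] --> g x.
  apply: (squeeze_cvgr (f := fun m => g x - m.+1%:R^-1) (h := fun=> g x)).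
  - by apply: nearW => m; exact: Gg.
  - rewrite -[X in _ --> X]subr0; apply: cvgB; [exact: cvg_cst|exact: cvg_harmonic].
  - exact: cvg_cst.
have bI k m : bounded_rv (fun w => \1_(B k m) (X w) : R).
  exact: bounded_rv_indic.
have bS m (I : seq 'I_(K m)) : bounded_rv (fun w => \sum_(k <- I) \1_(B k m) (X w) : R).
  elim: I => [|i I IH].
    by under eq_fun do rewrite big_nil; exact: bounded_rv_cst.
  by under eq_fun do rewrite big_cons; exact: bounded_rvD.
have bWS m (I : seq 'I_(K m)) :
    bounded_rv (fun w => W w * \sum_(k <- I) \1_(B k m) (X w) : R) by exact: bounded_rvM.
have e m : mean P (fun w => W w * G m (X w)) = kappa * mean P (fun w => G m (X w)).
  rewrite /G; under [in LHS]eq_fun do rewrite mulrCA.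
  rewrite meanZ; last exact: bWS.
  rewrite meanZ; last exact: bS.
  rewrite mulrCA; congr (_ * _).
  elim: (index_enum _) => [|i I IH].
    under eq_fun do rewrite big_nil mulr0.
    by under [in RHS]eq_fun do rewrite big_nil; rewrite !mean_cst mulr0.
  under eq_fun do rewrite big_cons mulrDr.
  under [in RHS]eq_fun do rewrite big_cons.
  rewrite meanD; [|exact: bounded_rvM|exact: bWS].
  rewrite meanD; [|exact: bI|exact: bS].
  by rewrite IH WX// mulrDr.
have mG m : measurable_fun setT (fun w => G m (X w)).
  by have [] := bounded_rvZ (m.+1%:R^-1) (bS m (index_enum _)).
have [mW [N WN]] := bW.
have N0 : 0 <= N by apply: le_trans (WN point).
have c1 : mean P (fun w => W w * G m (X w)) @[m --> \oo] -->
          mean P (fun w => W w * g (X w)).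
  apply: (mean_cvg (M := N * M)).
  - by move=> m; exact: measurable_funM.
  - move=> m w; rewrite normrM ler_pM// ger0_norm//.
    by case/andP : (Gg m (X w)) => _ /le_trans; apply; case/andP : (gM (X w)).
  - by move=> w; apply: cvgM; [exact: cvg_cst|exact: cG].
have c2 : kappa * mean P (fun w => G m (X w)) @[m --> \oo] -->
          kappa * mean P (fun w => g (X w)).
  apply: cvgM; first exact: cvg_cst.
  apply: (mean_cvg (M := M)) => //.
  move=> m w; rewrite ger0_norm//.
  by case/andP : (Gg m (X w)) => _ /le_trans; apply; case/andP : (gM (X w)).
apply: (cvg_unique _ c1) => //=.
have -> : (fun m => mean P (fun w => W w * G m (X w))) =
  (fun m => kappa * mean P (fun w => G m (X w))) by apply/funext.
exact: c2.
Qed.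

(** Adding M makes g non-negative; B = setT in the hypothesis gives the mean
    of W, hence the contribution of the added constant. *)
Lemma mean_factor (W X : Omega -> R) (kappa M : R) (g : R -> R) :
  bounded_rv W -> measurable_fun setT X ->
  (forall B, measurable B -> mean P (fun w => W w * \1_B (X w)) =
                             kappa * mean P (fun w => \1_B (X w))) ->
  measurable_fun setT g -> (forall x, `|g x| <= M) ->
  mean P (fun w => W w * g (X w)) = kappa * mean P (fun w => g (X w)).
Proof.
move=> bW mX WX mg gM.
have bgX : bounded_rv (fun w => g (X w)).
  by split; [exact: measurableT_comp|exists M].
have WE : mean P W = kappa.
  have := WX setT measurableT.
  under eq_fun do rewrite indicT mulr1.
  by under [in RHS]eq_fun do rewrite indicT; rewrite mean_cst mulr1.
have := @mean_factor_ge0 W X kappa (2 * M) (fun x => g x + M) bW mX WX.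
have -> : mean P (fun w => W w * (g (X w) + M)) =
          mean P (fun w => W w * g (X w)) + M * kappa.
  rewrite -WE -meanZ// -meanD//; first by congr mean; apply/funext => w; ring.
  - exact: bounded_rvM.
  - exact: bounded_rvZ.
have -> : mean P (fun w => g (X w) + M) = mean P (fun w => g (X w)) + M.
  by rewrite meanD//; [rewrite mean_cst|exact: bounded_rv_cst].
have h1 : measurable_fun setT (fun x => g x + M) by exact: measurable_funD.
have h2 x : 0 <= g x + M <= 2 * M.
  by have := gM x; rewrite ler_norml => /andP[? ?]; apply/andP; split; lra.
by move=> /(_ h1 h2); rewrite mulrDr [M * _]mulrC => /addIr.
Qed.

Section Characteristic.
Variables (n : nat) (X : nat -> Omega -> R) (phi : nat -> R).
Hypothesis mX : forall i, measurable_fun setT (X i).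
Hypothesis indepX : forall B : nat -> set R, (forall i, measurable (B i)) ->
  mean P (fun w => \prod_(0 <= i < n) \1_(B i) (X i w)) =
  \prod_(0 <= i < n) mean P (fun w => \1_(B i) (X i w)).
Hypothesis phiE : forall i, mean P (fun w => cos (X i w)) = phi i.
Hypothesis sinX0 : forall i, mean P (fun w => sin (X i w)) = 0.

Let S k w := \sum_(0 <= i < k) X i w.

Let mS k : measurable_fun setT (S k).
Proof. exact: measurable_sum. Qed.

(** Each step replaces the indicator of X k by its cosine and its sine, by
    mean_factor; in the addition formulas for S k + X k, every term with a sine
    has mean 0. Keeping the indicators of the remaining variables is what makes
    the induction go through. *)
Let partial k : (k <= n)%N -> forall B : nat -> set R, (forall i, measurable (B i)) ->
  mean P (fun w => cos (S k w) * \prod_(k <= i < n) \1_(B i) (X i w)) =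
    \prod_(0 <= i < k) phi i *
    \prod_(k <= i < n) mean P (fun w => \1_(B i) (X i w)) /\
  mean P (fun w => sin (S k w) * \prod_(k <= i < n) \1_(B i) (X i w)) = 0.
Proof.
elim: k => [_ B mB|k IH kn B mB].
  split.
    rewrite big_geq// mul1r -indepX//; congr mean; apply/funext => w.
    by rewrite [S 0%N w]big_geq// cos0 mul1r.
  rewrite (_ : (fun _ => _) = fun=> 0) ?mean_cst//; apply/funext => w.
  by rewrite [S 0%N w]big_geq// sin0 mul0r.
have {}IH := IH (ltnW kn).
pose Q w := \prod_(k.+1 <= i < n) \1_(B i) (X i w) : R.
pose q := \prod_(k.+1 <= i < n) mean P (fun w => \1_(B i) (X i w)).
pose f := \prod_(0 <= i < k) phi i.
have bQ : bounded_rv Q by apply: bounded_rv_prod => i; exact: bounded_rv_indic.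
have bC : bounded_rv (fun w => cos (S k w) * Q w).
  by apply: bounded_rvM => //; exact: bounded_rv_cos.
have bS : bounded_rv (fun w => sin (S k w) * Q w).
  by apply: bounded_rvM => //; exact: bounded_rv_sin.
have IHD D : measurable D ->
    mean P (fun w => (cos (S k w) * Q w) * \1_D (X k w)) =
      (f * q) * mean P (fun w => \1_D (X k w)) /\
    mean P (fun w => (sin (S k w) * Q w) * \1_D (X k w)) =
      0 * mean P (fun w => \1_D (X k w)).
  move=> mD; pose B' i := if i == k then D else B i.
  have mB' i : measurable (B' i) by rewrite /B'; case: ifP.
  have eQ w : \prod_(k <= i < n) \1_(B' i) (X i w) = \1_D (X k w) * Q w.
    rewrite big_ltn// /B' eqxx; congr (_ * _).
    by apply: eq_big_nat => i /andP[ki _]; rewrite gtn_eqF.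
  have eq : \prod_(k <= i < n) mean P (fun w => \1_(B' i) (X i w)) =
      mean P (fun w => \1_D (X k w)) * q.
    rewrite big_ltn// /B' eqxx; congr (_ * _).
    by apply: eq_big_nat => i /andP[ki _]; rewrite gtn_eqF.
  have [c s] := IH B' mB'; split.
    rewrite -mulrA [q * _]mulrC -eq -c; congr mean.
    by apply/funext => w; rewrite eQ mulrA mulrAC.
  by rewrite mul0r -s; congr mean; apply/funext => w; rewrite eQ mulrA mulrAC.
have mcos : measurable_fun setT (@cos R).
  by apply: continuous_measurable_fun; exact: continuous_cos.
have msin : measurable_fun setT (@sin R).
  by apply: continuous_measurable_fun; exact: continuous_sin.
have cos1 (x : R) : `|cos x| <= 1 by rewrite ler_norml cos_geN1 cos_le1.
have sin1 (x : R) : `|sin x| <= 1 by rewrite ler_norml sin_geN1 sin_le1.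
have bmul V (g : R -> R) : bounded_rv V -> measurable_fun setT g ->
    (forall x, `|g x| <= 1) -> bounded_rv (fun w => V w * g (X k w)).
  move=> bV mg g1; apply: bounded_rvM => //; split; last by exists 1.
  exact: measurableT_comp.
have CC := mean_factor bC (mX k) (fun D mD => (IHD D mD).1) mcos cos1.
have CS := mean_factor bC (mX k) (fun D mD => (IHD D mD).1) msin sin1.
have SC := mean_factor bS (mX k) (fun D mD => (IHD D mD).2) mcos cos1.
have SS := mean_factor bS (mX k) (fun D mD => (IHD D mD).2) msin sin1.
have SE w : S k.+1 w = S k w + X k w by rewrite /S big_nat_recr.
split.
- transitivity (mean P (fun w => (cos (S k w) * Q w) * cos (X k w)) -
                mean P (fun w => (sin (S k w) * Q w) * sin (X k w))).
    rewrite -meanB; [|exact: bmul|exact: bmul]; congr mean; apply/funext => w.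
    by rewrite SE cosD mulrBl; congr (_ - _); rewrite mulrAC.
  by rewrite CC SS phiE mul0r subr0 big_nat_recr//= mulrAC.
- transitivity (mean P (fun w => (sin (S k w) * Q w) * cos (X k w)) +
                mean P (fun w => (cos (S k w) * Q w) * sin (X k w))).
    rewrite -meanD; [|exact: bmul|exact: bmul]; congr mean; apply/funext => w.
    by rewrite SE sinD mulrDl; congr (_ + _); rewrite mulrAC.
  by rewrite SC CS sinX0 mul0r mulr0 addr0.
Qed.

Lemma mean_cos_independent_sum :
  mean P (fun w => cos (\sum_(0 <= i < n) X i w)) = \prod_(0 <= i < n) phi i.
Proof.
have [+ _] := partial (leqnn n) (fun=> measurableT).
rewrite [X in _ * X]big_geq// mulr1 => <-; congr mean; apply/funext => w.
by rewrite big_geq// mulr1.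
Qed.

Lemma mean_sin_independent_sum :
  mean P (fun w => sin (\sum_(0 <= i < n) X i w)) = 0.
Proof.
have [_ e] := partial (leqnn n) (fun=> measurableT); rewrite -[RHS]e.
by congr mean; apply/funext => w; rewrite big_geq// mulr1.
Qed.

End Characteristic.
End IndependentSums.

Local Open Scope complex_scope.

(** * Complex-valued functions and their energy *)

Section ComplexModulus.
Context {R : realType}.
Implicit Types (z u : R[i]) (r : R).

Lemma CmodE z : Cmod z = Num.sqrt (complex.Re z ^+ 2 + complex.Im z ^+ 2).
Proof. by case: z. Qed.

Let Cmod_normc z : Cmod z = Normc.normc z.
Proof. by case: z. Qed.

Lemma Cmod_ge0 z : 0 <= Cmod z.
Proof. by rewrite CmodE sqrtr_ge0. Qed.

Lemma CmodD z u : Cmod (z + u) <= Cmod z + Cmod u.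
Proof. by rewrite !Cmod_normc; exact: le_normcD. Qed.

Lemma CmodM z u : Cmod (z * u) = Cmod z * Cmod u.
Proof. by rewrite !Cmod_normc; exact: Normc.normcM. Qed.

Lemma CmodN z : Cmod (- z) = Cmod z.
Proof. by rewrite !Cmod_normc; exact: normcN. Qed.

Lemma CmodR r : Cmod r%:C = `|r|.
Proof. by rewrite CmodE/= expr0n/= addr0 sqrtr_sqr. Qed.

Lemma Cmod0 : Cmod (0 : R[i]) = 0.
Proof. by rewrite (CmodR 0) normr0. Qed.

Lemma Cmod_conj z : Cmod z^* = Cmod z.
Proof. by rewrite !CmodE; case: z => a b /=; rewrite sqrrN. Qed.

Lemma normr_Re_le z : `|complex.Re z| <= Cmod z.
Proof. by rewrite CmodE -sqrtr_sqr ler_wsqrtr// lerDl sqr_ge0. Qed.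

Context {d : measure_display} {T : measurableType d}.
Implicit Types f g : T -> R[i].

Lemma measurable_complexP f : measurable_fun setT f <->
  measurable_fun setT (fun x => complex.Re (f x)) /\
  measurable_fun setT (fun x => complex.Im (f x)).
Proof.
split=> [mf|[mr mi]].
  have mp : measurable_fun setT (fun x => complex_pair (f x)).
    move=> _ B mB; rewrite setTI.
    rewrite (_ : _ @^-1` B = f @^-1` (@complex_pair R @^-1` B))//.
    rewrite -[X in measurable X]setTI; apply: mf => //.
    by exists B => //; rewrite setTI.
  by move/measurable_fun_pairP : mp.
have mp : measurable_fun setT (fun x => complex_pair (f x)).
  exact/measurable_fun_pairP.
move=> _ _ [B mB <-]; rewrite !setTI.
rewrite (_ : _ @^-1` _ = (fun x => complex_pair (f x)) @^-1` B)//.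
by rewrite -[X in measurable X]setTI; exact: mp.
Qed.

Lemma measurable_Re f : measurable_fun setT f ->
  measurable_fun setT (fun x => complex.Re (f x)).
Proof. by move=> /measurable_complexP[]. Qed.

Lemma measurable_complexD f g : measurable_fun setT f -> measurable_fun setT g ->
  measurable_fun setT (fun x => f x + g x).
Proof.
move=> /measurable_complexP[fr fi] /measurable_complexP[gr gi].
apply/measurable_complexP; split.
  rewrite (_ : (fun x => _) = (fun x => complex.Re (f x)) \+ (fun x => complex.Re (g x))).
    exact: measurable_funD.
  by apply/funext => x /=; case: (f x) (g x) => ? ? [? ?].
rewrite (_ : (fun x => _) = (fun x => complex.Im (f x)) \+ (fun x => complex.Im (g x))).
  exact: measurable_funD.
by apply/funext => x /=; case: (f x) (g x) => ? ? [? ?].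
Qed.

Lemma measurable_complexM f g : measurable_fun setT f -> measurable_fun setT g ->
  measurable_fun setT (fun x => f x * g x).
Proof.
move=> /measurable_complexP[fr fi] /measurable_complexP[gr gi].
apply/measurable_complexP; split.
  rewrite (_ : (fun x => _) = (fun x => complex.Re (f x) * complex.Re (g x)
    - complex.Im (f x) * complex.Im (g x))).
    by apply: measurable_funB; exact: measurable_funM.
  by apply/funext => x /=; case: (f x) (g x) => ? ? [? ?].
rewrite (_ : (fun x => _) = (fun x => complex.Re (f x) * complex.Im (g x)
  + complex.Im (f x) * complex.Re (g x))).
  by apply: measurable_funD; exact: measurable_funM.
by apply/funext => x /=; case: (f x) (g x) => ? ? [? ?].
Qed.

Lemma measurable_complexR (f : T -> R) : measurable_fun setT f ->
  measurable_fun setT (fun x => (f x)%:C).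
Proof. by move=> mf; apply/measurable_complexP; split. Qed.

Lemma measurable_complexZ r f : measurable_fun setT f ->
  measurable_fun setT (fun x => r%:C * f x).
Proof. by move=> mf; apply: measurable_complexM => //; exact: measurable_cst. Qed.

Lemma measurable_complexB f g : measurable_fun setT f -> measurable_fun setT g ->
  measurable_fun setT (fun x => f x - g x).
Proof.
move=> mf mg; under eq_fun do rewrite -[- _]mulN1r.
apply: measurable_complexD => //; apply: measurable_complexM => //.
Qed.

Lemma measurable_complex_sum I (s : seq I) (h : I -> T -> R[i]) :
  (forall i, measurable_fun setT (h i)) ->
  measurable_fun setT (fun x => \sum_(i <- s) h i x).
Proof.
move=> mh; elim: s => [|i s IH].
  by under eq_fun do rewrite big_nil; exact: measurable_cst.
by under eq_fun do rewrite big_cons; exact: measurable_complexD.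
Qed.

Lemma measurable_Cmod f : measurable_fun setT f ->
  measurable_fun setT (fun x => Cmod (f x)).
Proof.
move=> /measurable_complexP[fr fi]; under eq_fun do rewrite CmodE.
apply: (measurableT_comp (f := @Num.sqrt R)).
  by apply: continuous_measurable_fun; exact: sqrt_continuous.
by apply: measurable_funD; exact: measurable_funX.
Qed.

End ComplexModulus.

Section Energy.
Context {R : realType} {d' : measure_display} {E : measurableType d'}.
Variables (mu : {measure set E -> \bar R}) (alpha : R).
Hypothesis alpha_gt0 : 0 < alpha.
Implicit Types f g : E -> R[i].

(** The alpha-th power of the norm of L^alpha(mu), the scale parameter of the
    stable integral of f. *)
Definition energy f : \bar R := (\int[mu]_x (Cmod (f x) `^ alpha)%:E)%E.

Lemma energy_ge0 f : (0 <= energy f)%E.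
Proof. by apply: integral_ge0 => x _; rewrite lee_fin powR_ge0. Qed.

Lemma measurable_Cmod_powR f : measurable_fun setT f ->
  measurable_fun setT (fun x => (Cmod (f x) `^ alpha)%:E).
Proof.
move=> mf; apply/measurable_EFinP.
by apply: (measurableT_comp (measurable_powR alpha)); exact: measurable_Cmod.
Qed.

(** If y <= delta x then x + y <= (1 + delta) x, and otherwise
    x + y <= (1 + 1/delta) y. *)
Lemma powRD_le (delta x y : R) : 0 < delta -> 0 <= x -> 0 <= y ->
  (x + y) `^ alpha <= (1 + delta) `^ alpha * x `^ alpha +
                      (1 + delta^-1) `^ alpha * y `^ alpha.
Proof.
move=> d0 x0 y0; have a0 := ltW alpha_gt0.
have d10 : 0 <= 1 + delta by rewrite addr_ge0// ltW.
have d20 : 0 <= 1 + delta^-1 by rewrite addr_ge0// invr_ge0 ltW.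
rewrite -!powRM//; have [yx|xy] := leP y (delta * x).
  rewrite -[leLHS]addr0 lerD ?powR_ge0// ge0_ler_powR ?nnegrE ?addr_ge0 ?mulr_ge0//.
  by rewrite mulrDl mul1r lerD2l.
rewrite -[leLHS]add0r lerD ?powR_ge0// ge0_ler_powR ?nnegrE ?addr_ge0 ?mulr_ge0//.
by rewrite mulrDl mul1r addrC lerD2l mulrC ler_pdivlMr// mulrC ltW.
Qed.

(** This replaces Minkowski's inequality, which fails for alpha < 1. A small
    delta shows that the energy is continuous. *)
Lemma energyD_le (delta : R) f g : 0 < delta ->
  measurable_fun setT f -> measurable_fun setT g ->
  (energy (fun x => f x + g x)%R <= ((1 + delta) `^ alpha)%:E * energy f +
                     ((1 + delta^-1) `^ alpha)%:E * energy g)%E.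
Proof.
move=> d0 mf mg; rewrite /energy.
rewrite -!ge0_integralZl//; try exact: measurable_Cmod_powR;
  try by move=> x _; rewrite lee_fin powR_ge0.
all: try by rewrite lee_fin powR_ge0.
rewrite -ge0_integralD//.
- apply: ge0_le_integral => //.
  + by move=> x _; rewrite lee_fin powR_ge0.
  + by apply: measurable_Cmod_powR; exact: measurable_complexD.
  + by apply: emeasurable_funD; apply: measurable_funeM; exact: measurable_Cmod_powR.
  + move=> x _; rewrite -!EFinM -EFinD lee_fin.
    apply: le_trans (powRD_le d0 (Cmod_ge0 _) (Cmod_ge0 _)).
    by rewrite ge0_ler_powR ?nnegrE ?addr_ge0 ?Cmod_ge0 ?CmodD// ltW.
- by move=> x _; rewrite -EFinM lee_fin mulr_ge0 ?powR_ge0.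
- by apply: measurable_funeM; exact: measurable_Cmod_powR.
- by move=> x _; rewrite -EFinM lee_fin mulr_ge0 ?powR_ge0.
- by apply: measurable_funeM; exact: measurable_Cmod_powR.
Qed.

Lemma energyZ (r : R) f : measurable_fun setT f ->
  energy (fun x => r%:C * f x) = ((`|r| `^ alpha)%:E * energy f)%E.
Proof.
move=> mf; rewrite /energy -ge0_integralZl//.
- by apply: eq_integral => x _; rewrite CmodM CmodR powRM ?Cmod_ge0.
- exact: measurable_Cmod_powR.
- by move=> x _; rewrite lee_fin powR_ge0.
Qed.

End Energy.

(** * Stable integrals of elementary functions *)
Section StableField.
Context {R : realType} {d d' : measure_display}.
Context {Omega : measurableType d} (P : probability Omega R).
Context {E : measurableType d'} (mu : {measure set E -> \bar R}) (alpha : R).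
Hypotheses (alpha_gt0 : 0 < alpha) (alpha_le2 : alpha <= 2).

Definition finite_measurable (A : set E) := measurable A /\ (mu A < +oo)%E.

(** The common core of the real and of the complex isotropic random measures:
    xi c A stands for the real part of c * M A.  The coefficients c range over
    a real subspace of the complex numbers, the real line in the real case. *)
Record stable_field (S : set R[i]) (xi : R[i] -> set E -> Omega -> R) : Prop := {
  sf_coef0 : S 0;
  sf_coefD : forall c e, S c -> S e -> S (c + e);
  sf_coefZ : forall (r : R) c, S c -> S (r%:C * c);
  sf_measurable : forall c A, finite_measurable A -> measurable_fun setT (xi c A);
  sf_add : forall c e A w, xi (c + e) A w = xi c A w + xi e A w;
  sf_scale : forall (r : R) c A w, xi (r%:C * c) A w = r * xi c A w;
  sf_setU : forall c A B, finite_measurable A -> finite_measurable B ->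
    A `&` B = set0 -> {ae P, forall w, xi c (A `|` B) w = xi c A w + xi c B w};
  sf_indep : forall n (c : nat -> R[i]) (A : nat -> set E),
    (forall i, finite_measurable (A i)) ->
    (forall i j, (i < j < n)%N -> A i `&` A j = set0) ->
    forall B : nat -> set R, (forall i, measurable (B i)) ->
    mean P (fun w => \prod_(0 <= i < n) \1_(B i) (xi (c i) (A i) w)) =
    \prod_(0 <= i < n) mean P (fun w => \1_(B i) (xi (c i) (A i) w));
  sf_cos : forall c A, S c -> finite_measurable A ->
    mean P (fun w => cos (xi c A w)) = expR (- (Cmod c `^ alpha * fine (mu A)));
  sf_sin : forall c A, S c -> finite_measurable A ->
    mean P (fun w => sin (xi c A w)) = 0 }.

Lemma finite_measurable0 : finite_measurable set0.
Proof. by split => //; rewrite measure0. Qed.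

Lemma finite_measurableS A B : finite_measurable B -> measurable A ->
  A `<=` B -> finite_measurable A.
Proof.
move=> [mB Bfin] mA AB; split=> //; apply: le_lt_trans Bfin.
by apply: le_measure => //; rewrite inE.
Qed.

Lemma finite_measurableI A B : finite_measurable A -> finite_measurable B ->
  finite_measurable (A `&` B).
Proof.
move=> fA fB; apply: (finite_measurableS fA); last exact: subIsetl.
by apply: measurableI; [case: fA|case: fB].
Qed.

Lemma finite_measurableD A B : finite_measurable A -> finite_measurable B ->
  finite_measurable (A `\` B).
Proof.
move=> fA fB; apply: (finite_measurableS fA); last exact: subDsetl.
by apply: measurableD; [case: fA|case: fB].
Qed.

Lemma mean_ae_eq (f g : Omega -> R) : bounded_rv f -> bounded_rv g ->
  {ae P, forall w, f w = g w} -> mean P f = mean P g.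
Proof.
move=> [mf _] [mg _] fg; rewrite /mean /Rintegral; congr fine.
apply: ae_eq_integral => //; try exact/measurable_EFinP.
by apply: filterS fg => w /= -> _.
Qed.

Section Elementary.
Variables (S : set R[i]) (xi : R[i] -> set E -> Omega -> R).
Hypothesis sf : stable_field S xi.
Implicit Types (l : seq (R[i] * set E)) (A : set E) (c : R[i]).

(** A list of pairs (c, A) represents the sum of the functions c 1_A; the sets
    may overlap, which makes sums of functions plain concatenations. *)
Fixpoint elementary l : Prop :=
  if l is a :: l' then [/\ S a.1, finite_measurable a.2 & elementary l'] else True.

Definition elem_fun l (x : E) : R[i] := \sum_(a <- l) a.1 *+ (x \in a.2).

Definition elem_int l (w : Omega) : R := \sum_(a <- l) xi a.1 a.2 w.

Fixpoint elem_supp l : set E :=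
  if l is a :: l' then a.2 `|` elem_supp l' else set0.

Fixpoint elem_disjoint l : Prop :=
  if l is a :: l' then a.2 `&` elem_supp l' = set0 /\ elem_disjoint l' else True.

Lemma elementary_cat l1 l2 : elementary l1 -> elementary l2 ->
  elementary (l1 ++ l2).
Proof.
by elim: l1 => // a l1 IH /= [Sa fa l1e] l2e; split => //; exact: IH.
Qed.

Lemma elem_fun_cons a l x : elem_fun (a :: l) x = a.1 *+ (x \in a.2) + elem_fun l x.
Proof. by rewrite /elem_fun big_cons. Qed.

Lemma elem_int_cons a l w : elem_int (a :: l) w = xi a.1 a.2 w + elem_int l w.
Proof. by rewrite /elem_int big_cons. Qed.

Lemma measurable_elem_fun l : elementary l -> measurable_fun setT (elem_fun l).
Proof.
elim: l => [_|a l IH /= [_ [ma _] /IH ml]].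
  by rewrite /elem_fun; under eq_fun do rewrite big_nil; exact: measurable_cst.
rewrite (funext (elem_fun_cons a l)); under eq_fun do rewrite -mulr_natr.
apply: measurable_complexD => //; apply: measurable_complexM => //.
rewrite (_ : (fun x => _) = fun x => (\1_(a.2) x : R)%:C).
  by apply: measurable_complexR; exact: measurable_indic.
by apply/funext => x; rewrite indicE rmorph_nat.
Qed.

Lemma measurable_elem_int l : elementary l -> measurable_fun setT (elem_int l).
Proof.
elim: l => [_|a l IH /= [_ fa /IH ml]].
  by rewrite /elem_int; under eq_fun do rewrite big_nil; exact: measurable_cst.
rewrite (funext (elem_int_cons a l)).
by apply: measurable_funD => //; exact: sf_measurable sf _ _ fa.
Qed.

Lemma elem_fun_out l x : ~ elem_supp l x -> elem_fun l x = 0.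
Proof.
elim: l => [_|a l IH /= /not_orP[ax lx]]; first by rewrite /elem_fun big_nil.
by rewrite elem_fun_cons memNset// mulr0n add0r IH.
Qed.

(** This adds c 1_A to a list with disjoint sets: each set B is cut along A, and
    the part of A outside B is passed on to the next sets. *)
Fixpoint elem_refine c A l : seq (R[i] * set E) :=
  if l is (e, B) :: l' then
    (e + c, B `&` A) :: (e, B `\` A) :: elem_refine c (A `\` B) l'
  else [:: (c, A)].

Lemma elem_refine_elementary c A l : S c -> finite_measurable A ->
  elementary l -> elementary (elem_refine c A l).
Proof.
move=> Sc; elim: l A => [|[e B] l IH] A fA //= [Se fB el].
split; [exact: sf_coefD sf _ _ Se Sc|exact: finite_measurableI|split => //].
  exact: finite_measurableD.
by apply: IH => //; exact: finite_measurableD.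
Qed.

Lemma elem_refine_fun c A l x :
  elem_fun (elem_refine c A l) x = c *+ (x \in A) + elem_fun l x.
Proof.
elim: l A => [|[e B] l IH] A.
  by rewrite /= elem_fun_cons /=.
rewrite /= !elem_fun_cons /= IH in_setI !in_setD.
case: (x \in A); case: (x \in B); rewrite /= ?mulr1n ?mulr0n ?add0r ?addr0//.
by rewrite [e + c]addrC addrA.
Qed.

Lemma elem_refine_supp c A l : elem_supp (elem_refine c A l) `<=` A `|` elem_supp l.
Proof.
elim: l A => [|[e B] l IH] A x /=; first by [].
move=> [[]//|[[]//|]]; first by left.
- by move=> Bx _; right; left.
- by move=> /IH [[Ax _]|]; [left|right; right].
Qed.

Lemma elem_refine_disjoint c A l :
  elem_disjoint l -> elem_disjoint (elem_refine c A l).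
Proof.
elim: l A => [|[e B] l IH] A /=; first by rewrite setI0.
move=> [Bl /IH dl]; split; last split => //.
  rewrite -subset0 => x [[Bx Ax]] [[]//|/elem_refine_supp[[]//|lx]].
  by rewrite -Bl.
rewrite -subset0 => x [[Bx Ax]] /elem_refine_supp[[]//|lx].
by rewrite -Bl.
Qed.

Lemma elem_refine_int c A l : finite_measurable A -> elementary l ->
  {ae P, forall w, elem_int (elem_refine c A l) w = xi c A w + elem_int l w}.
Proof.
elim: l A => [|[e B] l IH] A fA /=.
  by move=> _; apply: aeW => w; rewrite /= elem_int_cons.
move=> [_ fB el].
have fAB : finite_measurable (A `\` B) by exact: finite_measurableD.
have fBA : finite_measurable (B `\` A) by exact: finite_measurableD.
have fI : finite_measurable (B `&` A) by exact: finite_measurableI.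
have hA := sf_setU sf c fI fAB.
have hB := sf_setU sf e fI fBA.
have eA : (B `&` A) `|` (A `\` B) = A by rewrite setIC setUIDK.
have eB : (B `&` A) `|` (B `\` A) = B by rewrite setUIDK.
rewrite eA in hA; rewrite eB in hB.
have nA : B `&` A `&` (A `\` B) = set0.
  by rewrite -subset0 => x [[Bx _] [_]].
have nB : B `&` A `&` (B `\` A) = set0.
  by rewrite -subset0 => x [[_ Ax] [_]].
apply: filterS3 (IH _ fAB el) (hA nA) (hB nB) => w h1 h2 h3.
by rewrite !elem_int_cons /= h1 (sf_add sf) h2 h3; ring.
Qed.

(** Cutting along the sets one by one makes any elementary list disjoint,
    without changing the function and, almost surely, the integral. *)
Definition disjointify l := foldr (fun a => elem_refine a.1 a.2) [::] l.

Lemma disjointifyP l : elementary l ->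
  [/\ elementary (disjointify l), elem_disjoint (disjointify l),
      elem_fun (disjointify l) = elem_fun l &
      {ae P, forall w, elem_int (disjointify l) w = elem_int l w}].
Proof.
elim: l => [_|a l IH /= [Sa fa /IH[el dl fl il]]].
  by split => //; exact: aeW.
split.
- exact: elem_refine_elementary.
- exact: elem_refine_disjoint.
- by apply/funext => x; rewrite elem_refine_fun fl elem_fun_cons.
- apply: filterS2 (elem_refine_int a.1 fa el) il => w -> ->.
  by rewrite elem_int_cons.
Qed.

Lemma elem_disjoint_nth l i j : elem_disjoint l -> (i < j < size l)%N ->
  (nth (0, set0) l i).2 `&` (nth (0, set0) l j).2 = set0.
Proof.
have supp l' k : (k < size l')%N -> (nth (0, set0) l' k).2 `<=` elem_supp l'.
  elim: l' k => [//|a l' IH] [_|k kl]; first exact: subsetUl.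
  by apply: subset_trans (IH k kl) _; exact: subsetUr.
elim: l i j => [|a l IH] i [|j]; rewrite ?ltn0 ?andbF//.
case: i => [|i] /= [al dl]; last by move=> ij; exact: IH.
move=> jl; rewrite -subset0 => x [xa xj].
by have : (a.2 `&` elem_supp l) x by [split => //; exact: supp xj]; rewrite al.
Qed.

Let elem_nth l i : elementary l -> S (nth (0, set0) l i).1 /\
  finite_measurable (nth (0, set0) l i).2.
Proof.
elim: l i => [|a l IH] [|i] /=; try by move=> _; split; [exact: sf_coef0 sf|exact: finite_measurable0].
  by case.
by case=> _ _ /IH.
Qed.

(** At each point at most one term of the sum is not zero, so the power of the
    modulus can be taken term by term. *)
Lemma energy_disjoint l : elementary l -> elem_disjoint l ->
  energy mu alpha (elem_fun l) =
  (\sum_(a <- l) Cmod a.1 `^ alpha * fine (mu a.2))%:E.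
Proof.
have a0 : alpha != 0 by rewrite gt_eqF.
elim: l => [_ _|a l IH /= [Sa fa el] [al dl]].
  rewrite big_nil /energy integral0_eq// => x _.
  by rewrite /elem_fun big_nil Cmod0 powR0.
rewrite big_cons EFinD -IH// EFinM fineK; last first.
  by case: fa => ma ?; rewrite ge0_fin_numE.
have ma : measurable a.2 by case: fa.
rewrite /energy -(setIT a.2) -(integral_indic mu measurableT ma).
rewrite -ge0_integralZl//; first last.
- by rewrite lee_fin powR_ge0.
- by apply/measurable_EFinP; exact: measurable_indic.
rewrite -ge0_integralD//; first last.
- by apply: measurable_Cmod_powR; exact: measurable_elem_fun.
- by move=> x _; rewrite lee_fin powR_ge0.
- by apply/measurable_EFinP; apply: measurable_funM => //; exact: measurable_indic.
- by move=> x _; rewrite lee_fin mulr_ge0 ?powR_ge0.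
apply: eq_integral => x _; rewrite elem_fun_cons indicE -EFinM -EFinD; congr EFin.
have [xa|xa] := boolP (x \in a.2); last by rewrite mulr0n mulr0 !add0r.
rewrite mulr1n mulr1 elem_fun_out ?addr0 ?Cmod0 ?powR0 ?addr0// => lx.
by have : set0 x by rewrite -al; split => //; exact/set_mem.
Qed.

Lemma energy_elem_fin l : elementary l ->
  energy mu alpha (elem_fun l) \is a fin_num.
Proof. by move=> /disjointifyP[el dl <- _]; rewrite energy_disjoint. Qed.

(** After disjointification the terms are independent, so the mean of the
    cosine of their sum is the product of the means of the cosines. *)
Lemma mean_elem_int l : elementary l ->
  mean P (fun w => cos (elem_int l w)) =
    expR (- fine (energy mu alpha (elem_fun l))) /\
  mean P (fun w => sin (elem_int l w)) = 0.
Proof.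
move=> el; have ml := measurable_elem_int el.
have [el' dl' fl il] := disjointifyP el.
have ml' := measurable_elem_int el'.
rewrite -fl; move: (disjointify l) el' dl' il ml' {fl} => k ek dk ik mk.
have -> : mean P (fun w => cos (elem_int l w)) = mean P (fun w => cos (elem_int k w)).
  apply: mean_ae_eq; [exact: bounded_rv_cos|exact: bounded_rv_cos|].
  by apply: filterS ik => w ->.
have -> : mean P (fun w => sin (elem_int l w)) = mean P (fun w => sin (elem_int k w)).
  apply: mean_ae_eq; [exact: bounded_rv_sin|exact: bounded_rv_sin|].
  by apply: filterS ik => w ->.
rewrite energy_disjoint//=.
pose c i := (nth (0, set0) k i).1; pose A i := (nth (0, set0) k i).2.
have iE w : elem_int k w = \sum_(0 <= i < size k) xi (c i) (A i) w.
  by rewrite /elem_int (big_nth (0, set0)).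
have cA i := elem_nth i ek.
have mX i : measurable_fun setT (xi (c i) (A i)).
  by apply: (sf_measurable sf); case: (cA i).
have ind := sf_indep sf c (fun i => (cA i).2)
  (fun i j ij => elem_disjoint_nth dk ij).
have fcos i := sf_cos sf (cA i).1 (cA i).2.
have fsin i := sf_sin sf (cA i).1 (cA i).2.
under eq_fun do rewrite iE; under [in X in _ /\ X]eq_fun do rewrite iE.
split; last exact: (mean_sin_independent_sum mX ind fcos fsin).
rewrite (mean_cos_independent_sum mX ind fcos fsin) (big_nth (0, set0)).
rewrite -sumrN; elim: (index_iota _ _) => [|i s IH].
  by rewrite !big_nil expR0.
by rewrite !big_cons expRD IH.
Qed.

End Elementary.

(** * Characteristic functions of stable integrals *)
Section Approximation.

Lemma lipschitz1 (g dg : R -> R) (a b : R) :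
  (forall x, is_derive x (1 : R) g (dg x)) -> (forall x, `|dg x| <= 1) ->
  continuous g -> `|g a - g b| <= `|a - b|.
Proof.
move=> gd dg1 cg; wlog ab : a b / a <= b => [hw|].
  by have [/hw//|/ltW/hw] := leP a b; rewrite distrC (distrC a).
have [c _ e] := MVT_segment ab (fun x _ => gd x) (continuous_subspaceT cg).
by rewrite distrC e normrM (distrC a) ler_piMl.
Qed.

Lemma lipschitz_cos (a b : R) : `|cos a - cos b| <= `|a - b|.
Proof.
apply: (@lipschitz1 _ (fun x => - sin x)); last exact: continuous_cos.
by move=> x; rewrite normrN sin_max.
Qed.

Lemma lipschitz_sin (a b : R) : `|sin a - sin b| <= `|a - b|.
Proof.
apply: (@lipschitz1 _ cos); last exact: continuous_sin.
by move=> x; rewrite cos_max.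
Qed.

Lemma expRN_lipschitz (a b : R) : 0 <= a -> 0 <= b ->
  `|expR (- a) - expR (- b)| <= `|a - b|.
Proof.
wlog ab : a b / a <= b => [hw a0 b0|a0 _].
  have [/hw|/ltW/hw] := leP a b; first exact.
  by rewrite distrC (distrC a); exact.
rewrite ger0_norm ?subr_ge0 ?ler_expR ?lerN2// distrC ger0_norm ?subr_ge0//.
have -> : - b = - a + - (b - a) by ring.
have := expR_ge1Dx (- (b - a)); rewrite expRD.
have : expR (- a) <= 1 by rewrite -expR0 ler_expR oppr_le0.
have := expR_gt0 (- a); have : 0 <= b - a by rewrite subr_ge0.
move: (expR (- a)) (expR (- (b - a))) => u v; nra.
Qed.

Lemma measurable_far (Y Z : Omega -> R) (e : R) :
  measurable_fun setT Y -> measurable_fun setT Z ->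
  measurable [set w | e <= `|Z w - Y w|].
Proof.
move=> mY mZ; rewrite -[X in measurable X]setTI.
apply: (@measurable_fun_ler _ _ _ setT (cst e) (fun w => `|Z w - Y w|)) => //.
by apply: measurableT_comp => //; exact: measurable_funB.
Qed.

(** Where Z and Y differ by less than e, so do g Z and g Y; the complement has
    probability less than e, and there they differ by at most 2. *)
Lemma mean_lipschitz_close (g : R -> R) (Y Z : Omega -> R) (e : R) :
  measurable_fun setT g -> (forall x, `|g x| <= 1) ->
  (forall a b, `|g a - g b| <= `|a - b|) ->
  measurable_fun setT Y -> measurable_fun setT Z -> 0 < e ->
  (P [set w | (e <= `|Z w - Y w|)%R] < e%:E)%E ->
  `|mean P (fun w => g (Z w)) - mean P (fun w => g (Y w))| <= 3 * e.
Proof.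
move=> mg g1 gl mY mZ e0 Pe.
pose A := [set w | e <= `|Z w - Y w|].
have mA : measurable A by exact: measurable_far.
have bg (X : Omega -> R) : measurable_fun setT X -> bounded_rv (fun w => g (X w)).
  by move=> mX; split; [exact: measurableT_comp|exists 1].
have bA : bounded_rv (\1_A : Omega -> R).
  split; first exact: measurable_indic.
  by exists 1 => w; rewrite indicE; case: (_ \in _); rewrite ?normr1 ?normr0.
have bd : bounded_rv (fun w => g (Z w) - g (Y w)) by apply: bounded_rvB; exact: bg.
have bD : bounded_rv (fun w => e + 2 * \1_A w).
  by apply: bounded_rvD; [exact: bounded_rv_cst|exact: bounded_rvZ].
have mD : mean P (fun w => e + 2 * \1_A w) <= 3 * e.
  rewrite meanD; [|exact: bounded_rv_cst|exact: bounded_rvZ].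
  rewrite mean_cst meanZ// mean_indic//.
  have : fine (P A) <= e.
    by rewrite -lee_fin fineK ?fin_num_measure// ltW.
  lra.
have gD w : `|g (Z w) - g (Y w)| <= e + 2 * \1_A w.
  rewrite indicE; have [wA|/negP wA] := boolP (w \in A).
    rewrite mulr1; apply: le_trans (ler_normB _ _) _.
    by have := g1 (Z w); have := g1 (Y w); lra.
  rewrite mulr0 addr0; apply: le_trans (gl _ _) _; rewrite leNgt; apply/negP => h.
  by apply: wA; apply/mem_set; exact: ltW.
rewrite -meanB; [|exact: bg|exact: bg].
rewrite ler_norml; apply/andP; split.
  rewrite lerNl; apply: le_trans mD; rewrite -mulN1r -meanZ//.
  apply: le_mean => //; first exact: bounded_rvZ.
  by move=> w; rewrite mulN1r; have := gD w; rewrite ler_norml => /andP[]; lra.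
apply: le_trans mD.
by apply: le_mean => // w; have := gD w; rewrite ler_norml => /andP[].
Qed.

Variables (S : set R[i]) (xi : R[i] -> set E -> Omega -> R).
Hypothesis sf : stable_field S xi.

(** Elementary functions approximate f in energy while their integrals
    approximate Y in probability. Since the sets of an elementary function may
    overlap, this relation is visibly stable under linear combinations. *)
Definition stable_int (f : E -> R[i]) (Y : Omega -> R) : Prop :=
  [/\ measurable_fun setT f, (energy mu alpha f < +oo)%E, measurable_fun setT Y &
      forall e : R, 0 < e -> exists l, [/\ elementary S l,
        (energy mu alpha (fun x => elem_fun l x - f x)%R < e%:E)%E &
        (P [set w | (e <= `|elem_int xi l w - Y w|)%R] < e%:E)%E]].

Let powR_le_expr2 (x : R) : 1 <= x -> x `^ alpha <= x ^+ 2.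
Proof.
move=> x1; rewrite -powR_mulrn ?(le_trans ler01)//; exact: ler_powR.
Qed.

Let energyD_le_cst : exists2 c : R, 0 < c &
  forall f g : E -> R[i], measurable_fun setT f -> measurable_fun setT g ->
  (energy mu alpha (fun x => f x + g x)%R <=
    c%:E * energy mu alpha f + c%:E * energy mu alpha g)%E.
Proof.
exists ((1 + 1) `^ alpha) => [|f g mf mg]; first by rewrite powR_gt0.
by have := energyD_le mu alpha_gt0 ltr01 mf mg; rewrite invr1.
Qed.

Lemma stable_intD f g (Y Z : Omega -> R) : stable_int f Y -> stable_int g Z ->
  stable_int (fun x => f x + g x) (fun w => Y w + Z w).
Proof.
have [c c0 cD] := energyD_le_cst.
move=> [mf ef mY aY] [mg eg mZ aZ]; split.
- exact: measurable_complexD.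
- apply: le_lt_trans (cD _ _ mf mg) _.
  move: (energy _ _ f) (energy _ _ g) ef eg => a b ay bY.
  by apply: lte_add_pinfty; apply: lte_mul_pinfty => //; rewrite lee_fin ltW.
- exact: measurable_funD.
move=> e e0; pose e' := e / (2 * c + 2).
have e8 : 0 < e' by rewrite divr_gt0//; lra.
have e'E : (2 * c + 2) * e' = e by rewrite mulrC divfK//; lra.
have ce0 : 0 < c * e' by rewrite mulr_gt0.
have [l [el fl Yl]] := aY _ e8; have [k [ek fk Zk]] := aZ _ e8.
exists (l ++ k).
have ml := measurable_elem_fun el; have mk := measurable_elem_fun ek.
have il := measurable_elem_int sf el; have ik := measurable_elem_int sf ek.
split; first exact: elementary_cat.
- rewrite (_ : (fun x => _) = fun x => (elem_fun l x - f x) + (elem_fun k x - g x)); last first.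
    by apply/funext => x; rewrite /elem_fun big_cat/=; ring.
  apply: le_lt_trans (cD _ _ _ _) _; try exact: measurable_complexB.
  apply: (@lt_le_trans _ _ (c%:E * (e')%:E + c%:E * (e')%:E)%E).
    move: (energy _ _ _) (energy _ _ _) fl fk => a b ae be.
    by apply: lteD; rewrite (@lte_pmul2l _ c%:E).
  by rewrite -!EFinM -EFinD lee_fin -e'E; lra.
- pose A := [set w | e' <= `|elem_int xi l w - Y w|].
  pose B := [set w | e' <= `|elem_int xi k w - Z w|].
  have mA : measurable A by exact: measurable_far.
  have mB : measurable B by exact: measurable_far.
  have sAB : [set w | e <= `|elem_int xi (l ++ k) w - (Y w + Z w)|] `<=` A `|` B.
    move=> w /=; have [h|h] := leP e' `|elem_int xi l w - Y w|; first by left.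
    have [h'|h'] := leP e' `|elem_int xi k w - Z w|; first by right.
    rewrite /elem_int big_cat/= -/(elem_int xi l w) -/(elem_int xi k w).
    rewrite (_ : _ - _ = (elem_int xi l w - Y w) + (elem_int xi k w - Z w)); last by ring.
    move=> /le_trans/(_ (ler_normD _ _)); rewrite -e'E.
    move: `|_ - Y w| `|_ - Z w| h h' => u v; nra.
  have mlk : measurable_fun setT (elem_int xi (l ++ k)).
    by apply: (measurable_elem_int sf); exact: elementary_cat.
  have PAB : (P [set w | (e <= `|elem_int xi (l ++ k) w - (Y w + Z w)|)%R] <=
              P (A `|` B))%E.
    apply: le_measure; rewrite ?inE//; last exact: measurableU.
    by apply: measurable_far => //; exact: measurable_funD.
  apply: le_lt_trans PAB _.
  have PU : (P (A `|` B) <= P A + P B)%E by exact: measureU2.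
  apply: le_lt_trans PU _.
  apply: (@lt_le_trans _ _ ((e')%:E + (e')%:E)%E); first exact: lteD.
  by rewrite -EFinD lee_fin -e'E; lra.
Qed.

Lemma stable_intZ r f (Y : Omega -> R) : stable_int f Y ->
  stable_int (fun x => r%:C * f x) (fun w => r * Y w).
Proof.
move=> [mf ef mY aY]; split.
- exact: measurable_complexZ.
- by rewrite energyZ// lte_mul_pinfty// lee_fin powR_ge0.
- exact: measurable_funM.
move=> e e0; pose K := 1 + `|r| + `|r| `^ alpha.
have r0 := normr_ge0 r; have ra0 := powR_ge0 `|r| alpha.
have K0 : 0 < K by rewrite /K; lra.
have eK : 0 < e / K by rewrite divr_gt0.
have [l [el fl Yl]] := aY _ eK; exists [seq (r%:C * a.1, a.2) | a <- l].
have fE x : elem_fun [seq (r%:C * a.1, a.2) | a <- l] x = r%:C * elem_fun l x.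
  by rewrite /elem_fun big_map mulr_sumr; apply: eq_bigr => a _; rewrite mulrnAr.
have iE w : elem_int xi [seq (r%:C * a.1, a.2) | a <- l] w = r * elem_int xi l w.
  rewrite /elem_int big_map mulr_sumr; apply: eq_bigr => a _.
  by rewrite (sf_scale sf).
have ml := measurable_elem_fun el; have il := measurable_elem_int sf el.
have K1 : 1 <= K by rewrite /K; lra.
have eKe : e / K <= e by rewrite ler_pdivrMr//; nra.
split.
- elim: l el {fl Yl fE iE ml il} => // a l IH /= [Sa fa /IH el]; split => //.
  exact: sf_coefZ sf _ _ Sa.
- rewrite (_ : (fun x => _) = fun x => r%:C * (elem_fun l x - f x)); last first.
    by apply/funext => x; rewrite fE mulrBr.
  rewrite energyZ; last exact: measurable_complexB.
  apply: (@le_lt_trans _ _ ((`|r| `^ alpha)%:E * (e / K)%:E)%E).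
    by rewrite lee_wpmul2l// ?lee_fin// ltW.
  rewrite -EFinM lte_fin mulrA ltr_pdivrMr// mulrC ltr_pM2l// /K; lra.
- apply: le_lt_trans (lt_le_trans Yl _); last by rewrite lee_fin.
  apply: le_measure; rewrite ?inE.
  + rewrite (_ : [set w | _] = [set w | e <= `|r * elem_int xi l w - r * Y w|]).
      by apply: measurable_far; exact: measurable_funM.
    by apply/seteqP; split => w /=; rewrite iE.
  + exact: measurable_far.
  move=> w /=; rewrite iE -mulrBr normrM => h; rewrite ler_pdivrMr//.
  apply: le_trans h _; rewrite mulrC ler_wpM2l// /K; lra.
Qed.

Lemma stable_int_sum (I : Type) (s : seq I) (theta : I -> R)
    (f : I -> E -> R[i]) (Y : I -> Omega -> R) :
  (forall i, stable_int (f i) (Y i)) ->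
  stable_int (fun x => \sum_(i <- s) (theta i)%:C * f i x)
             (fun w => \sum_(i <- s) theta i * Y i w).
Proof.
move=> fY; elim: s => [|i s IH].
  under eq_fun do rewrite big_nil; under [X in stable_int _ X]eq_fun do rewrite big_nil.
  have e0 : energy mu alpha (fun=> 0) = 0%E.
    by rewrite /energy integral0_eq// => x _; rewrite Cmod0 powR0// gt_eqF.
  split; [exact: measurable_cst|by rewrite e0|exact: measurable_cst|].
  move=> e e_gt0; exists [::]; split => //.
    by rewrite /elem_fun; under eq_fun do rewrite big_nil subr0; rewrite e0.
  rewrite (_ : [set w | _] = set0) ?measure0// -subset0 => w /=.
  by rewrite /elem_int big_nil subr0 normr0 leNgt e_gt0.
under eq_fun do rewrite big_cons; under [X in stable_int _ X]eq_fun do rewrite big_cons.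
by apply: stable_intD => //; exact: stable_intZ.
Qed.

Let energy_close (f g : E -> R[i]) (delta eta : R) : 0 < delta ->
  measurable_fun setT f -> measurable_fun setT g ->
  energy mu alpha f \is a fin_num -> energy mu alpha g \is a fin_num ->
  (energy mu alpha (fun x => f x - g x)%R <= eta%:E)%E ->
  fine (energy mu alpha f) <= (1 + delta) `^ alpha * fine (energy mu alpha g) +
     (1 + delta^-1) `^ alpha * eta.
Proof.
move=> d0 mf mg ff fg fge.
have := energyD_le mu alpha_gt0 d0 mg (measurable_complexB mf mg).
rewrite (_ : (fun x => g x + (f x - g x)) = f); last by apply/funext => x; ring.
have := energy_ge0 mu alpha (fun x => f x - g x).
have := powR_ge0 (1 + delta^-1) alpha.
move: (_ `^ alpha) (_ `^ alpha) => D C C0.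
move: (energy mu alpha (fun x => _ - _)) fge.
move: (energy mu alpha f) (energy mu alpha g) ff fg.
move=> [a| |] [b| |] //= _ _ [c| |] //=; rewrite -!EFinM -EFinD !lee_fin => ce c0 h.
by apply: le_trans h _; rewrite lerD2l ler_wpM2l.
Qed.

(** Elementary functions close to f have integrals close to Y in probability
    and energies close to the energy of f, so the characteristic function
    passes to the limit. *)
Lemma mean_stable_int f Y : stable_int f Y ->
  mean P (fun w => cos (Y w)) = expR (- fine (energy mu alpha f)) /\
  mean P (fun w => sin (Y w)) = 0.
Proof.
move=> [mf ef mY aY].
have ff : energy mu alpha f \is a fin_num by rewrite ge0_fin_numE// energy_ge0.
pose I := fine (energy mu alpha f).
have I0 : 0 <= I by rewrite fine_ge0// energy_ge0.
have mcos : measurable_fun setT (@cos R).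
  by apply: continuous_measurable_fun; exact: continuous_cos.
have msin : measurable_fun setT (@sin R).
  by apply: continuous_measurable_fun; exact: continuous_sin.
split; last first.
  apply/eqP; rewrite -normr_le0; apply/ler_addgt0Pr => e e0; rewrite add0r.
  have e3 : 0 < e / 3 by rewrite divr_gt0.
  have [l [el _ Yl]] := aY _ e3.
  have := mean_lipschitz_close msin (@sin_max R) lipschitz_sin mY
    (measurable_elem_int sf el) e3 Yl.
  rewrite (mean_elem_int sf el).2 sub0r normrN => /le_trans; apply; lra.
apply/eqP; rewrite -subr_eq0 -normr_le0; apply/ler_addgt0Pr => e0 e00; rewrite add0r.
pose e := e0 / 5; have e_gt0 : 0 < e by rewrite divr_gt0.
(* With delta <= 1 and alpha <= 2, (1 + delta)^alpha <= 1 + 3 delta, and the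
   energies of f and of its approximation differ by at most 2 e. *)
pose delta := Num.min 1 (e / (12 * I + 1)).
have d0 : 0 < delta by rewrite lt_min ltr01 divr_gt0//; lra.
have d1 : delta <= 1 by rewrite ge_min lexx.
have dI : 12 * I * delta <= e.
  have : delta <= e / (12 * I + 1) by rewrite ge_min lexx orbT.
  rewrite ler_pdivlMr; last by lra.
  by rewrite mulrC => h; apply: le_trans h; rewrite ler_pM2r//; lra.
pose D := (1 + delta) `^ alpha; pose C := (1 + delta^-1) `^ alpha.
have D1 : D <= 1 + 3 * delta.
  by apply: le_trans (powR_le_expr2 _) _; [rewrite lerDl ltW|rewrite expr2; nra].
have D0 : 1 <= D.
  have h : 1 <= 1 + delta by rewrite lerDl ltW.
  by apply: le_trans (ler_powR h (ltW alpha_gt0)); rewrite powRr0.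
have C0 : 0 < C by rewrite powR_gt0// ltr_wpDr// invr_ge0 ltW.
pose eta := Num.min e (e / (4 * C)).
have eta0 : 0 < eta by rewrite lt_min e_gt0 divr_gt0// mulr_gt0.
have etae : eta <= e by rewrite ge_min lexx.
have etaC : 4 * (C * eta) <= e.
  have : eta <= e / (4 * C) by rewrite ge_min lexx orbT.
  by rewrite ler_pdivlMr ?mulr_gt0// => h; apply: le_trans h; rewrite mulrA mulrC.
have [l [el fl Yl]] := aY _ eta0.
have ml := measurable_elem_fun el.
have fl' := energy_elem_fin sf el.
pose J := fine (energy mu alpha (elem_fun l)).
have J0 : 0 <= J by rewrite fine_ge0// energy_ge0.
have JI : J <= D * I + C * eta := energy_close d0 ml mf fl' ff (ltW fl).
have IJ : I <= D * J + C * eta.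
  have eE : energy mu alpha (fun x => f x - elem_fun l x) =
      energy mu alpha (fun x => elem_fun l x - f x).
    by apply: eq_integral => x _; rewrite -CmodN opprB.
  have fl2 : (energy mu alpha (fun x => f x - elem_fun l x)%R <= eta%:E)%E.
    by rewrite eE; exact: ltW.
  exact: energy_close d0 mf ml ff fl' fl2.
have dist : `|J - I| <= 2 * e.
  by rewrite ler_norml; apply/andP; split; nra.
have := mean_lipschitz_close mcos (@cos_max R) lipschitz_cos mY
    (measurable_elem_int sf el) eta0 Yl.
rewrite (mean_elem_int sf el).1 -/J -/I distrC => h.
have h2 := expRN_lipschitz J0 I0.
apply: le_trans (ler_distD (expR (- J)) _ _) _.
apply: le_trans (lerD h (le_trans h2 dist)) _.
have -> : e0 = 3 * e + 2 * e by rewrite /e; field.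
by rewrite lerD2r ler_pM2l.
Qed.

(** The energies of the linear combinations of the kernels are the exponents of
    the joint characteristic functions of the integrals. *)
Lemma stable_int_eq_fdd (T : Type) (F G : T -> E -> R[i]) (X Y : T -> Omega -> R) :
  (forall t, stable_int (F t) (X t)) -> (forall t, stable_int (G t) (Y t)) ->
  (forall (I : Type) (s : seq I) (theta : I -> R) (t : I -> T),
    energy mu alpha (fun x => \sum_(i <- s) (theta i)%:C * F (t i) x) =
    energy mu alpha (fun x => \sum_(i <- s) (theta i)%:C * G (t i) x)) ->
  eq_fdd P X Y.
Proof.
move=> FX GY FG n t B mB.
have mX i : measurable_fun setT (X (tnth t i)) by case: (FX (tnth t i)).
have mY i : measurable_fun setT (Y (tnth t i)) by case: (GY (tnth t i)).
have hX theta := mean_stable_int (stable_int_sum (index_enum 'I_n) theta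
  (fun i => FX (tnth t i))).
have hY theta := mean_stable_int (stable_int_sum (index_enum 'I_n) theta
  (fun i => GY (tnth t i))).
apply: (eq_law_characteristic mX mY _ _ mB) => theta.
  by rewrite (hX theta).1 (hY theta).1 FG.
by rewrite (hX theta).2 (hY theta).2.
Qed.

End Approximation.

End StableField.

(** * Stable random measures as stable fields *)

Section Membership.
Context {R : realType} {d' : measure_display} {E : measurableType d'}.
Variables (mu : {measure set E -> \bar R}) (alpha : R).
Hypothesis alpha_gt0 : 0 < alpha.

Lemma Lfun_powRP (f : E -> R) : f \in Lfun mu alpha%:E <->
  measurable_fun setT f /\ (\int[mu]_x (`|f x| `^ alpha)%:E < +oo)%E.
Proof.
have intE : (\int[mu]_x (`|(EFin \o f) x| `^ alpha) = \int[mu]_x (`|f x| `^ alpha)%:E)%E.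
  by apply: eq_integral => x _.
split=> [/andP[/set_mem mf /set_mem]|[mf ff]].
  rewrite /= /finite_norm unlock /Lnorm /= intE => h; split => //.
  by apply: (lty_poweRy _ h); rewrite invr_eq0 gt_eqF.
apply/andP; split; first exact/mem_set.
apply/mem_set; rewrite /= /finite_norm unlock /Lnorm /= intE.
exact: poweR_lty.
Qed.

Lemma energy_real (f : E -> R) :
  energy mu alpha (fun x => (f x)%:C) = (\int[mu]_x (`|f x| `^ alpha)%:E)%E.
Proof. by apply: eq_integral => x _; rewrite CmodR. Qed.

Lemma Lfun_energyP (f : E -> R) : f \in Lfun mu alpha%:E <->
  measurable_fun setT f /\ (energy mu alpha (fun x => (f x)%:C)%C < +oo)%E.
Proof. by rewrite energy_real; exact: Lfun_powRP. Qed.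

Lemma LalphaCP (f : E -> R[i]) : LalphaC mu alpha f <->
  measurable_fun setT f /\ (energy mu alpha f < +oo)%E.
Proof.
have eE : (\int[mu]_x (`|Cmod (f x)| `^ alpha)%:E = energy mu alpha f)%E.
  by apply: eq_integral => x _; rewrite ger0_norm// Cmod_ge0.
split=> [[mf /Lfun_powRP[_]]|[mf ff]]; first by rewrite eE.
by split => //; apply/Lfun_powRP; split; [exact: measurable_Cmod|rewrite eE].
Qed.

End Membership.

Section FromRandomMeasures.
Context {R : realType} {d d' : measure_display}.
Context {Omega : measurableType d} (P : probability Omega R).
Context {E : measurableType d'} (mu : {measure set E -> \bar R}) (alpha : R).
Hypothesis alpha_gt0 : 0 < alpha.

Lemma mean_expectation (f : Omega -> R) : fine 'E_P[f] = mean P f.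
Proof. by rewrite /mean /Rintegral unlock. Qed.

(** Independence passes to measurable functions of the values of M; the
    indicators turn it into a statement about means of products. *)
Lemma scattered_indep d'' (V : measurableType d'') (M : set E -> {RV P >-> V})
    (L : R[i] -> V -> R) :
  (forall c, measurable_fun setT (L c)) -> independently_scattered mu M ->
  forall n (c : nat -> R[i]) (A : nat -> set E),
  (forall i, finite_measurable mu (A i)) ->
  (forall i j, (i < j < n)%N -> A i `&` A j = set0) ->
  forall B : nat -> set R, (forall i, measurable (B i)) ->
  mean P (fun w => \prod_(0 <= i < n) \1_(B i) (L (c i) (M (A i) w))) =
  \prod_(0 <= i < n) mean P (fun w => \1_(B i) (L (c i) (M (A i) w))).
Proof.
move=> mL Mi n c A fA dA B mB.
have tA : trivIset setT (fun i : 'I_n => A i).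
  apply/trivIsetP => i j _ _ ij; have [ltij|ltji|eij] := ltngtP i j.
  - by apply: dA; rewrite ltij ltn_ord.
  - by rewrite setIC; apply: dA; rewrite ltji ltn_ord.
  - by move: ij; rewrite (val_inj eij) eqxx.
pose B' i : set V := L (c i) @^-1` B i.
have mB' i : measurable (B' i).
  by rewrite -[X in measurable X]setTI; exact: mL.
pose C i : set Omega := M (A i) @^-1` B' i.
have mC i : measurable (C i).
  by rewrite -[X in measurable X]setTI; exact: measurable_funP.
have PE i : P (C i) = (mean P (fun w => \1_(B i) (L (c i) (M (A i) w))))%:E.
  by rewrite -[LHS]fineK ?fin_num_measure// -mean_indic.
have := Mi n (fun i : 'I_n => A i) (fun i => fA i) tA (fun i : 'I_n => B' i)
  (fun i => mB' i).
rewrite -/C => /(congr1 fine) PC.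
have -> : mean P (fun w => \prod_(0 <= i < n) \1_(B i) (L (c i) (M (A i) w))) =
    fine (P (\bigcap_(i in [set: 'I_n]) C i)).
  rewrite -mean_indic; last by apply: fin_bigcap_measurable.
  congr mean; apply/funext => w; rewrite big_mkord indicE.
  have [/set_mem wC|/negP wC] := boolP (w \in _).
    by apply: big1 => i _; rewrite indicE mem_set//; exact: (wC i).
  apply/eqP; rewrite prodf_seq_eq0; apply/hasP; apply: contrapT => h.
  apply: wC; apply/mem_set => i _; apply: contrapT => hi; apply: h.
  by exists i; rewrite ?mem_index_enum//= indicE memNset.
rewrite PC big_mkord; under eq_bigr => i _ do rewrite PE.
by rewrite prodEFin.
Qed.

(** Apply the hypothesis to A, B and then only empty sets: the convergence of
    the partial sums forces nu set0 to vanish. *)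
Lemma additive_setU (nu : set E -> Omega -> R) :
  (forall A : (set E)^nat, (forall i, measurable (A i)) -> trivIset setT A ->
    (mu (\bigcup_i A i) < +oo)%E ->
    {ae P, forall w, (fun n => \sum_(i < n) nu (A i) w) @ \oo --> nu (\bigcup_i A i) w}) ->
  forall A B, finite_measurable mu A -> finite_measurable mu B ->
  A `&` B = set0 -> {ae P, forall w, nu (A `|` B) w = nu A w + nu B w}.
Proof.
move=> nuA A B [mA fA] [mB fB] AB.
pose F i := if i is 0%N then A else if i is 1%N then B else set0.
have UF : \bigcup_i F i = A `|` B.
  apply/seteqP; split => [x [[|[|i]] _ //= Fx]|x [Ax|Bx]]; [by left|by right| |].
    by exists 0%N.
  by exists 1%N.
have mF i : measurable (F i) by case: i => [|[|i]] //=.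
have tF : trivIset setT F.
  apply/trivIsetP => -[|[|i]] [|[|j]] _ _ //= _; rewrite ?setI0 ?set0I//.
  by rewrite setIC.
have fU : (mu (\bigcup_i F i) < +oo)%E.
  rewrite UF; have h : (mu (A `|` B) <= mu A + mu B)%E by exact: measureU2.
  by apply: le_lt_trans h _; rewrite lte_add_pinfty.
have := nuA F mF tF fU; rewrite UF; apply: filterS => w.
set l := nu _ w => cl.
have SE n : \sum_(i < n.+2) nu (F i) w = nu A w + nu B w + n%:R * nu set0 w.
  rewrite big_ord_recl big_ord_recl/= -addrA; congr (_ + (_ + _)).
  by rewrite sumr_const card_ord mulr_natl.
have c2 : (nu A w + nu B w + n%:R * nu set0 w) @[n --> \oo] --> l.
  rewrite -(cvg_shiftn 2) in cl; apply: cvg_trans cl; apply: near_eq_cvg.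
  by apply: nearW => n /=; rewrite addn2 SE.
have c3 : (nu A w + nu B w + n.+1%:R * nu set0 w) @[n --> \oo] --> l.
  by rewrite -(cvg_shiftS) in c2.
have c4 : (nu A w + nu B w + n.+1%:R * nu set0 w) -
    (nu A w + nu B w + n%:R * nu set0 w) @[n --> \oo] --> l - l by exact: cvgB.
have c5 : (fun=> nu set0 w) @ \oo --> (0 : R).
  move: c4; rewrite subrr; apply: cvg_trans; apply: near_eq_cvg; apply: nearW => n.
  by rewrite -natr1; ring.
have z0 : nu set0 w = 0.
  by have /cvg_lim <- // := c5; rewrite lim_cst.
have c6 : (fun=> nu A w + nu B w) @ \oo --> l.
  move: c2; apply: cvg_trans; apply: near_eq_cvg; apply: nearW => n.
  by rewrite z0 mulr0 addr0.
by have /cvg_lim <- // := c6; rewrite lim_cst.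
Qed.

Lemma SaS_stable_field (M : set E -> {RV P >-> R}) : SaS_measure mu alpha M ->
  stable_field P mu alpha [set c | complex.Im c = 0]
    (fun c A w => complex.Re c * M A w).
Proof.
move=> [Mi Ma Mc]; split => //=.
- by move=> [a b] [c e] /= -> ->; rewrite addr0.
- by move=> r [a b] /= ->; rewrite !mul0r !mulr0 addr0.
- by move=> c A _; apply: measurable_funM => //; exact: measurable_funP.
- by move=> [a b] [c e] A w /=; rewrite mulrDl.
- by move=> r [a b] A w /=; rewrite mul0r subr0 mulrA.
- move=> c A B fA fB AB.
  apply: (@additive_setU (fun A w => complex.Re c * M A w)) => // F mF tF fF.
  apply: filterS (Ma F mF tF fF) => w cw.
  under eq_fun do rewrite -mulr_sumr.
  by apply: cvgM; [exact: cvg_cst|exact: cw].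
- move=> n c A fA dA B mB.
  apply: (@scattered_indep _ R M (fun c v => complex.Re c * v)) => //.
  by move=> e; exact: measurable_funM.
- move=> [a b] A /= b0 [mA fA].
  have := congr1 (@complex.Re R) (Mc A mA fA a); rewrite /= mean_expectation => ->.
  by rewrite CmodE /= b0 expr0n addr0 sqrtr_sqr.
- move=> [a b] A /= b0 [mA fA].
  by have := congr1 (@complex.Im R) (Mc A mA fA a); rewrite /= mean_expectation.
Qed.

Lemma measurable_ReM (c : R[i]) : measurable_fun setT (fun v => complex.Re (c * v)).
Proof.
apply: measurable_Re; apply: measurable_complexM; first exact: measurable_cst.
exact: measurable_id.
Qed.

Lemma isotropic_stable_field (M : set E -> {RV P >-> R[i]}) :
  isotropic_SaS_measure mu alpha M ->
  stable_field P mu alpha setT (fun c A w => complex.Re (c * M A w)).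
Proof.
move=> [Mi Ma Mc]; split => //=.
- move=> c A _; apply: (measurableT_comp (measurable_ReM c)).
  exact: measurable_funP.
- by move=> c e A w /=; rewrite mulrDl raddfD.
- move=> r c A w /=; rewrite -mulrA.
  by case: (c * _) => a b /=; rewrite mul0r subr0.
- move=> c A B fA fB AB.
  apply: (@additive_setU (fun A w => complex.Re (c * M A w))) => // F mF tF fF.
  apply: filterS (Ma F mF tF fF) => w cw.
  rewrite -[X in _ --> X]add0r; apply: (@cvg_trans _ ((fun n =>
    (\sum_(i < n) complex.Re (c * M (F i) w) - complex.Re (c * M (\bigcup_i F i) w)) +
     complex.Re (c * M (\bigcup_i F i) w)) @ \oo)).
    by apply: near_eq_cvg; apply: nearW => n; rewrite subrK.
  apply: cvgD; last exact: cvg_cst.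
  apply/norm_cvg0P.
  have cM : Cmod c * Cmod (\sum_(i < n) M (F i) w - M (\bigcup_i F i) w)
      @[n --> \oo] --> 0.
    by rewrite -(mulr0 (Cmod c)); apply: cvgM; [exact: cvg_cst|exact: cw].
  apply: (squeeze_cvgr (f := fun=> 0) _ _ cM); last exact: cvg_cst.
  apply: nearW => n; rewrite normr_ge0/= -CmodM.
  by rewrite -raddf_sum -mulr_sumr -raddfB -mulrBr normr_Re_le.
- move=> n c A fA dA B mB.
  apply: (@scattered_indep _ R[i] M (fun c v => complex.Re (c * v))) => //.
  exact: measurable_ReM.
- move=> c A _ [mA fA]; have := Mc A mA fA (conjc c); rewrite Cmod_conj.
  have -> : Num.conj (conjc c) = c by exact: conjcK.
  by move=> /(congr1 (@complex.Re R)); rewrite /= mean_expectation.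
- move=> c A _ [mA fA]; have := Mc A mA fA (conjc c).
  have -> : Num.conj (conjc c) = c by exact: conjcK.
  by move=> /(congr1 (@complex.Im R)); rewrite /= mean_expectation.
Qed.

(** The value 0 is left out, because its level set may have infinite measure. *)
Lemma fimfun_elementary (V : pzRingType) (S : set R[i]) (emb : V -> R[i]) (f : E -> V) :
  finite_set (range f) -> emb 0 = 0 ->
  (forall c, c != 0 -> S (emb c) /\ finite_measurable mu (f @^-1` [set c])) ->
  exists l, [/\ elementary mu S l, forall x, elem_fun l x = emb (f x) &
    forall (xi : R[i] -> set E -> Omega -> R) w,
      elem_int xi l w = \sum_(c <- fset_set (range f) | c != 0)
                           xi (emb c) (f @^-1` [set c]) w].
Proof.
move=> fr emb0 fc; pose s := fset_set (range f).
exists [seq (emb c, f @^-1` [set c]) | c <- s & c != 0]; split.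
- elim: (enum_fset s) => //= c t IH; case: ifPn => //= c0; have [] := fc c c0.
  by split.
- move=> x; rewrite /elem_fun big_map big_filter.
  have [fx0|fx0] := eqVneq (f x) 0.
    rewrite fx0 emb0 big1// => c /= c0; rewrite memNset ?mulr0n//= => fxc.
    by move: c0; rewrite -fxc fx0 eqxx.
  rewrite -big_filter (bigD1_seq (f x))/=; last 2 first.
  + by rewrite mem_filter fx0 /s in_fset_set//; apply/mem_set; exists x.
  + by rewrite filter_uniq// fset_uniq.
  rewrite mem_set// mulr1n big1 ?addr0// => c cx.
  by rewrite memNset ?mulr0n//= => fxc; move: cx; rewrite -fxc eqxx.
- by move=> xi w; rewrite /elem_int big_map big_filter.
Qed.

Lemma cvge0_lt (u : nat -> \bar R) (e : R) : 0 < e -> u @ \oo --> 0%E ->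
  \forall n \near \oo, (u n < e%:E)%E.
Proof.
move=> e0 cu; apply: (cu [set y | (y < e%:E)%E]).
by apply: open_nbhs_nbhs; split; [exact: open_ereal_lt_ereal|rewrite /= lte_fin].
Qed.

Import HBSimple.

Lemma is_stable_integral_stable_int (M : set E -> {RV P >-> R}) (f : E -> R)
    (Y : {RV P >-> R}) : is_stable_integral mu alpha M f Y ->
  stable_int P mu alpha [set c | complex.Im c = 0]
    (fun c A w => complex.Re c * M A w) (fun x => (f x)%:C) Y.
Proof.
move=> [/(Lfun_powRP _ alpha_gt0)[mf ff] [s [sfin sf sY]]]; split.
- exact: measurable_complexR.
- by rewrite energy_real.
- exact: measurable_funP.
move=> e e0.
have : \forall n \near \oo, (\int[mu]_x (`|s n x - f x| `^ alpha)%:E < e%:E)%E /\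
   (P [set w | (e <= `|simple_integral M (s n) w - Y w|)%R] < e%:E)%E.
  by apply: filterI; [exact: cvge0_lt sf|exact: cvge0_lt (sY e e0)].
move=> [n _ /(_ n (leqnn n))[n1 n2]].
have [] := @fimfun_elementary R [set c | complex.Im c = 0] (fun r => r%:C) (s n).
- exact: fimfunP.
- by [].
- move=> c c0; split => //; split.
    by rewrite -[X in measurable X]setTI; apply: measurable_funP.
  apply: le_lt_trans (sfin n); apply: le_measure; rewrite ?inE.
  + by rewrite -[X in measurable X]setTI; apply: measurable_funP.
  + by rewrite -[X in measurable X]setTI; apply: measurable_funP => //; exact: measurableC.
  + by move=> x /= ->; exact/eqP.
move=> l [el fl il]; exists l; split; first exact: el.
- rewrite (_ : (fun x => _) = fun x => (s n x - f x)%:C); last first.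
    by apply/funext => x; rewrite fl rmorphB.
  by rewrite energy_real.
- rewrite (_ : [set w | _] = [set w | e <= `|simple_integral M (s n) w - Y w|])//.
  apply/funext => w /=; congr (is_true (_ <= `|_ - _|)); rewrite il.
  rewrite /simple_integral fsbig_finite; last exact: fimfunP.
  by rewrite big_mkcond; apply: eq_bigr => c _; case: eqVneq => //= ->; rewrite mul0r.
Qed.

Lemma is_stable_Cintegral_stable_int (M : set E -> {RV P >-> R[i]}) (f : E -> R[i])
    (Z : {RV P >-> R[i]}) : is_stable_Cintegral mu alpha M f Z ->
  stable_int P mu alpha setT (fun c A w => complex.Re (c * M A w)) f
    (fun w => complex.Re (Z w)).
Proof.
move=> [/(LalphaCP _ alpha_gt0)[mf ff] [s [sfin sf sY]]].
have mZ : measurable_fun setT Z by exact: measurable_funP.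
split => //; first exact: measurable_Re.
move=> e e0.
have : \forall n \near \oo, (\int[mu]_x (Cmod (s n x - f x) `^ alpha)%:E < e%:E)%E /\
   (P [set w | (e <= Cmod (simple_Cintegral M (s n) w - Z w))%R] < e%:E)%E.
  by apply: filterI; [exact: cvge0_lt sf|exact: cvge0_lt (sY e e0)].
move=> [n _ /(_ n (leqnn n))[n1 n2]].
have m1 (c : R[i]) : measurable [set c].
  exists [set complex_pair c]; last first.
    rewrite setTI; apply/seteqP; split => [x|x /= ->//].
    by case: x c => [a b] [a' b'] /= [-> ->].
  rewrite (_ : [set complex_pair c] = [set complex.Re c] `*` [set complex.Im c]).
    by apply: measurableX.
  by apply/seteqP; split => [[a b] /= [-> ->]|[a b] /= [-> ->]].
have [ms mus] := sfin n.
have [] := @fimfun_elementary R[i] setT id (s n).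
- exact: fimfunP.
- by [].
- move=> c c0; split => //; split.
    by rewrite -[X in measurable X]setTI; apply: ms.
  apply: le_lt_trans mus; apply: le_measure; rewrite ?inE.
  + by rewrite -[X in measurable X]setTI; apply: ms.
  + by rewrite -[X in measurable X]setTI; apply: ms => //; exact: measurableC.
  + by move=> x /= ->; exact/eqP.
move=> l [el fl il]; exists l; split; first exact: el.
- rewrite (_ : (fun x => _) = fun x => s n x - f x); first exact: n1.
  by apply/funext => x; rewrite fl.
- have iE w : elem_int (fun c A w => complex.Re (c * M A w)) l w =
      complex.Re (simple_Cintegral M (s n) w).
    rewrite il /simple_Cintegral fsbig_finite; last exact: fimfunP.
    rewrite raddf_sum big_mkcond; apply: eq_bigr => c _.
    by case: eqVneq => //= ->; rewrite mul0r.
  have mS : measurable_fun setT (simple_Cintegral M (s n)).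
    rewrite (_ : simple_Cintegral M (s n) = fun w =>
        \sum_(c <- fset_set (range (s n))) c * M (s n @^-1` [set c]) w); last first.
      by apply/funext => w; rewrite /simple_Cintegral fsbig_finite//; exact: fimfunP.
    apply: measurable_complex_sum => c; apply: measurable_complexM.
      exact: measurable_cst.
    exact: measurable_funP.
  apply: le_lt_trans n2; apply: le_measure; rewrite ?inE.
  + under eq_set do rewrite iE.
    by apply: measurable_far; exact: measurable_Re.
  + rewrite -[X in measurable X]setTI.
    apply: (@measurable_fun_ler _ _ _ setT (cst e)) => //.
    by apply: measurable_Cmod; exact: measurable_complexB.
  + by move=> w /=; rewrite iE -raddfB => /le_trans; apply; exact: normr_Re_le.
Qed.

End FromRandomMeasures.

(** * Norm, balls and Haar measure of the p-adic numbers *)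

Section PadicNorm.
Context {R : realType} {p : nat} {p_pr : prime p}.
Local Notation Zp := (padic_int p_pr).
Local Notation Qp := (padic p_pr).
Local Notation iota := (@Zp_to_Qp p p_pr).
Local Notation pnorm := (@padic_norm p p_pr R).
Implicit Types (x y a h t : Qp) (u z : Zp) (k l : int).

Lemma natp_gt1 : 1 < p%:R :> R.
Proof. by rewrite ltr1n prime_gt1. Qed.

Lemma natp_gt0 : 0 < p%:R :> R.
Proof. exact: lt_trans ltr01 natp_gt1. Qed.

Lemma expz_gt0 k : 0 < p%:R ^ k :> R.
Proof. by rewrite exprz_gt0// natp_gt0. Qed.

Lemma iota_unit_neq0 u : u \is a GRing.unit -> iota u != 0.
Proof. by move=> uU; rewrite tofrac_eq0; apply: contraTneq uU => ->; rewrite unitr0. Qed.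

Lemma pnorm0 : pnorm 0 = 0.
Proof. by rewrite /padic_norm eqxx. Qed.

Lemma pnormE k u : u \is a GRing.unit -> pnorm (p%:R ^ k * iota u) = p%:R ^ (- k).
Proof.
move=> uU; rewrite /padic_norm padic_valE// ifF//; apply/negbTE.
by rewrite mulf_neq0 ?expfz_neq0 ?padic_p_neq0 ?iota_unit_neq0.
Qed.

Lemma pnorm_ge0 x : 0 <= pnorm x.
Proof. by rewrite /padic_norm; case: ifP => // _; exact/ltW/expz_gt0. Qed.

Lemma pnorm_eq0 x : (pnorm x == 0) = (x == 0).
Proof. by rewrite /padic_norm; case: ifP; rewrite ?eqxx// gt_eqF// expz_gt0. Qed.

Lemma pnorm_gt0 x : (0 < pnorm x) = (x != 0).
Proof. by rewrite lt_neqAle pnorm_ge0 andbT eq_sym pnorm_eq0. Qed.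

Lemma pnorm_neq0E x : x != 0 -> exists k, pnorm x = p%:R ^ k.
Proof. by move=> x0; rewrite /padic_norm (negbTE x0); eexists. Qed.

Lemma pnormM x y : pnorm (x * y) = pnorm x * pnorm y.
Proof.
have [->|x0] := eqVneq x 0; first by rewrite mul0r pnorm0 mul0r.
have [->|y0] := eqVneq y 0; first by rewrite mulr0 pnorm0 mulr0.
have [k [u uU ->]] := padic_decomp x0; have [l [v vU ->]] := padic_decomp y0.
rewrite mulrACA -expfzDr ?padic_p_neq0// -rmorphM !pnormE ?unitrM ?uU//.
by rewrite opprD expfzDr// gt_eqF// natp_gt0.
Qed.

Lemma pnormN x : pnorm (- x) = pnorm x.
Proof.
have [->|x0] := eqVneq x 0; first by rewrite oppr0.
have [k [u uU ->]] := padic_decomp x0.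
by rewrite -mulrN -rmorphN !pnormE// unitrN.
Qed.

Lemma pnormB x y : pnorm (x - y) = pnorm (y - x).
Proof. by rewrite -pnormN opprB. Qed.

Lemma pnorm1 : pnorm 1 = 1.
Proof. by have := pnormE 0 (unitr1 Zp); rewrite expr0z rmorph1 mul1r oppr0. Qed.

Lemma pnormV x : pnorm x^-1 = (pnorm x)^-1.
Proof.
have [->|x0] := eqVneq x 0; first by rewrite invr0 pnorm0 invr0.
apply: (mulfI (x := pnorm x)); first by rewrite pnorm_eq0.
by rewrite -pnormM !mulfV ?pnorm1// pnorm_eq0.
Qed.

Lemma pnorm_expz k : pnorm (p%:R ^ k) = p%:R ^ (- k).
Proof. by have := pnormE k (unitr1 Zp); rewrite rmorph1 mulr1. Qed.

Lemma pnorm_le x k : pnorm x <= p%:R ^ (- k) <-> exists z, x = p%:R ^ k * iota z.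
Proof.
split=> [|[z ->]].
  have [->|x0] := eqVneq x 0; first by exists 0; rewrite rmorph0 mulr0.
  have [l [u uU ->]] := padic_decomp x0; rewrite pnormE// ler_eXz2l ?natp_gt1// lerN2 => kl.
  exists (p%:R ^+ `|l - k|%N * u).
  rewrite rmorphM rmorphXn /= rmorph_nat mulrA exprnP gez0_abs ?subr_ge0//.
  by rewrite -expfzDr ?padic_p_neq0// subrKC.
rewrite pnormM pnorm_expz ler_piMr//; first exact/ltW/expz_gt0.
have [->|z0] := eqVneq z 0; first by rewrite rmorph0 pnorm0.
have [n [u [uU ->]]] := padic_int_decomp z0.
rewrite rmorphM rmorphXn /= rmorph_nat exprnP pnormE//.
by rewrite -(expr0z (p%:R : R)) ler_eXz2l ?natp_gt1// oppr_le0.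
Qed.

Lemma pnorm_le1 x : Zp_set x <-> pnorm x <= 1.
Proof.
rewrite -(expr0z (p%:R : R)) -{1}oppr0 pnorm_le; split=> [[z _ <-]|[z ->]].
  by exists z; rewrite expr0z mul1r.
by exists z; rewrite ?expr0z ?mul1r.
Qed.

Lemma pnorm_nat n : pnorm n%:R <= 1.
Proof. by apply/pnorm_le1; exists n%:R; rewrite // rmorph_nat. Qed.

Lemma pnormD_le x y (r : R) : pnorm x <= r -> pnorm y <= r -> pnorm (x + y) <= r.
Proof.
wlog xy : x y / pnorm x <= pnorm y => [hw xr yr|xr yr].
  have [h|/ltW h] := leP (pnorm x) (pnorm y); first exact: hw.
  by rewrite addrC; exact: hw.
apply: le_trans yr; have [y0|y0] := eqVneq y 0.
  by move: xy; rewrite y0 pnorm0 addr0.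
have [k yk] := pnorm_neq0E y0.
have /pnorm_le[z xz] : pnorm x <= p%:R ^ (- - k) by rewrite opprK -yk.
have /pnorm_le[w yw] : pnorm y <= p%:R ^ (- - k) by rewrite opprK -yk.
rewrite yk -[k in leRHS]opprK; apply/pnorm_le; exists (z + w).
by rewrite rmorphD mulrDr xz yw.
Qed.

Lemma pnormD_max x y : pnorm (x + y) <= Num.max (pnorm x) (pnorm y).
Proof. by apply: pnormD_le; rewrite le_max lexx ?orbT. Qed.

(** In an ultrametric triangle the two longest sides are equal. *)
Lemma pnormB_eq x t : pnorm t < pnorm x -> pnorm (t - x) = pnorm x.
Proof.
move=> tx; apply/le_anti/andP; split.
  by apply: pnormD_le; [exact: ltW|rewrite pnormN].
have := pnormD_max t (x - t); rewrite subrKC pnormB le_max => /orP[|//].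
by rewrite leNgt tx.
Qed.

Lemma padic_ballE x n : padic_ball x n = [set y | pnorm (y - x) <= p%:R ^- n].
Proof.
apply/seteqP; split=> y /=.
  move=> [_ [z _ <-] <-]; rewrite addrAC subrr add0r.
  by rewrite exprnN; apply/pnorm_le; exists z.
rewrite exprnN => /pnorm_le[z e]; exists (iota z); first by exists z.
by apply/eqP; rewrite eq_sym addrC -subr_eq e.
Qed.

Lemma exp_pinv_lt (e : R) : 0 < e -> exists n, p%:R ^- n < e.
Proof.
move=> e0; have p1 : `|(p%:R : R)^-1| < 1.
  by rewrite ger0_norm ?invr_ge0 ?ltW ?natp_gt0// invf_lt1 ?natp_gt1 ?natp_gt0.
have /cvgr0Pnorm_lt/(_ e e0)[n _ hn] := cvg_expr p1.
by exists n; have := hn n (leqnn n); rewrite ger0_norm ?exprn_ge0 ?invr_ge0 ?ltW ?natp_gt0// exprVn.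
Qed.

Lemma padic_openP (A : set Qp) : (forall x, A x -> exists2 e : R, 0 < e &
  forall y, pnorm (y - x) < e -> A y) -> open A.
Proof.
move=> hA; rewrite openE => x /hA[e e0 he].
have [n ne] := exp_pinv_lt e0; exists n => // y.
by rewrite padic_ballE /= => yx; apply: he; exact: le_lt_trans yx ne.
Qed.

Lemma padic_open_measurable (A : set Qp) : open A -> measurable A.
Proof. by move=> oA; exact: sub_sigma_algebra. Qed.

Lemma open_pnorm_lt x (r : R) : open [set y | pnorm (y - x) < r].
Proof.
apply: padic_openP => y /= yr; exists (r - 0).
  by rewrite subr0; apply: le_lt_trans yr; exact: pnorm_ge0.
move=> z zy; rewrite -(subrK y z) -addrA.
apply: le_lt_trans (pnormD_max _ _) _.
by rewrite gt_max yr andbT -[r]subr0.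
Qed.

Lemma open_pnorm_le x (r : R) : 0 < r -> open [set y | pnorm (y - x) <= r].
Proof.
move=> r0; apply: padic_openP => y /= yr; exists r => // z zy.
rewrite -(subrK y z) -addrA; apply: le_trans (pnormD_max _ _) _.
by rewrite ge_max yr andbT ltW.
Qed.

Lemma measurable_pnorm : measurable_fun setT pnorm.
Proof.
apply: (measurability _ (RGenInftyO.measurableE R)) => _ [_ [c ->] <-].
rewrite setTI (_ : _ @^-1` _ = [set y | pnorm (y - 0) < c]).
  by apply: padic_open_measurable; exact: open_pnorm_lt.
by apply/seteqP; split => y /=; rewrite in_itv/= subr0.
Qed.

(** The preimage of any set under a locally constant function is open. *)
Lemma measurable_locally_constant d (T : measurableType d) (f : Qp -> T) :
  (forall x, exists2 e : R, 0 < e & forall y, pnorm (y - x) < e -> f y = f x) ->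
  measurable_fun setT f.
Proof.
move=> fl _ B mB; rewrite setTI; apply: padic_open_measurable.
apply: padic_openP => x /= Bfx; have [e e0 he] := fl x.
by exists e => // y /he /= ->.
Qed.

Lemma measurable_affine a h : measurable_fun setT (fun x : Qp => a * x + h).
Proof.
have [->|a0] := eqVneq a 0.
  rewrite (_ : (fun x : Qp => 0 * x + h) = cst h); first exact: measurable_cst.
  by apply/funext => x; rewrite mul0r add0r.
apply: (@measurability _ _ Qp Qp setT _ [set A | open A]) => //.
move=> _ [A oA <-]; rewrite setTI; apply: padic_open_measurable.
apply: padic_openP => x /=; move: oA; rewrite openE => /(_ (a * x + h)) /[apply].
move=> [n _ hn]; exists (p%:R ^- n / pnorm a).
  by rewrite divr_gt0 ?pnorm_gt0// invr_gt0 exprn_gt0// natp_gt0.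
move=> y; rewrite ltr_pdivlMr ?pnorm_gt0// mulrC -pnormM => yx; apply: hn.
rewrite padic_ballE /= (_ : a * y + h - _ = a * (y - x)) ?ltW//; ring.
Qed.

Lemma pnorm_iota_le z n : pnorm (iota z) <= p%:R ^- n <-> z n = 0%N.
Proof.
rewrite exprnN pnorm_le; split=> [[w]|zn].
  have -> : p%:R ^ n * iota w = iota (p%:R ^+ n * w).
    by rewrite rmorphM rmorphXn /= rmorph_nat.
  move=> /eqP; rewrite tofrac_eq => /eqP ->.
  by rewrite -natrX residueM residue_nat modnn mul0n mod0n.
have [->|z0] := eqVneq z 0; first by exists 0; rewrite rmorph0 mulr0.
have [a [u [uU e]]] := padic_int_decomp z0; move: zn; rewrite e.
have [na _|an] := leqP n a.
  exists (p%:R ^+ (a - n) * u); rewrite !rmorphM !rmorphXn /= !rmorph_nat mulrA.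
  by rewrite -exprD subnKC.
rewrite -natrX residueM residue_nat modnMml => /eqP; rewrite -/(dvdn _ _).
rewrite -{1}(subnKC (ltnW an)) expnD dvdn_pmul2l ?expp_gt0// => pu.
move: uU; rewrite padic_int_unitE (@residueE _ _ _ 1 n); last by case: (n) an.
rewrite expn1 -/(dvdn _ _) (dvdn_trans _ pu)// dvdn_exp// subn_gt0//.
Qed.

Lemma pnorm_residue z n : pnorm (iota z - (z n)%:R) <= p%:R ^- n.
Proof.
rewrite -(rmorph_nat iota) -rmorphB; apply/pnorm_iota_le.
set y := z - _; have : z n = (y + (z n)%:R) n by rewrite /y subrK.
rewrite residueD residue_nat modnDmr => /eqP.
rewrite -{1}[z n]residue_mod -{1}[z n]add0n eqn_modDr mod0n residue_mod.
by move=> /eqP <-.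
Qed.

Lemma padic_ball_eq x y n : padic_ball x n y -> padic_ball x n = padic_ball y n.
Proof.
rewrite !padic_ballE /= => yx; apply/seteqP; split => z /= zx.
  by rewrite -(subrK x z) -addrA; apply: pnormD_le => //; rewrite pnormB.
by rewrite -(subrK y z) -addrA; apply: pnormD_le.
Qed.

(** Each ball is centred at a fraction with denominator a power of p, so there
    are countably many balls. *)
Definition nat_ball (i : nat * nat * nat) : set Qp :=
  padic_ball (p%:R ^- i.1.1 * i.1.2%:R) i.2.

Lemma padic_ball_nat x n : exists k j : nat, padic_ball x n = nat_ball (k, j, n).
Proof.
have [k [z ->]] : exists (k : nat) z, x = p%:R ^- k * iota z.
  have [->|x0] := eqVneq x 0; first by exists 0%N, 0; rewrite rmorph0 mulr0.
  have [l xl] := pnorm_neq0E x0; exists `|l|%N.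
  rewrite exprnN; apply/pnorm_le; rewrite xl ler_eXz2l ?natp_gt1// opprK.
  by rewrite abszE ler_norm.
exists k, (z (k + n)%N); apply: padic_ball_eq; rewrite padic_ballE /=.
rewrite pnormB -mulrBr pnormM exprnN pnorm_expz opprK.
apply: le_trans (ler_wpM2l (ltW (expz_gt0 _)) (pnorm_residue _ _)) _.
rewrite -[p%:R ^ k]/(p%:R ^+ k) exprD invfM mulrA mulfV ?mul1r//.
by rewrite expf_neq0// gt_eqF// natp_gt0.
Qed.

Lemma measurable_padic_ball x n : measurable (padic_ball x n).
Proof.
apply: padic_open_measurable; rewrite padic_ballE; apply: open_pnorm_le.
by rewrite invr_gt0 exprn_gt0// natp_gt0.
Qed.

Definition ball_enum (n : nat) : set Qp :=
  if @choice.unpickle (nat * nat * nat)%type n is Some i then nat_ball i else set0.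

Lemma padic_ball_enum x n : exists i, padic_ball x n = ball_enum i.
Proof.
have [k [j ->]] := padic_ball_nat x n.
by exists (choice.pickle (k, j, n)); rewrite /ball_enum choice.pickleK.
Qed.

Lemma padic_ball_refl x n : padic_ball x n x.
Proof.
by rewrite padic_ballE /= subrr pnorm0 invr_ge0 exprn_ge0// ltW// natp_gt0.
Qed.

Lemma open_bigcup_ball (A : set Qp) : open A ->
  A = \bigcup_(i in [set i | ball_enum i `<=` A]) ball_enum i.
Proof.
rewrite openE => oA; apply/seteqP; split => [x Ax|x [i /= iA ix]]; last exact: iA.
have [n _ nA] := oA x Ax; have [i e] := padic_ball_enum x n.
by exists i; rewrite /= -e//; exact: padic_ball_refl.
Qed.

(** A pi-system, because two balls are disjoint or nested. *)
Let balls : set (set Qp) :=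
  [set A | A = set0 \/ exists x n, A = padic_ball x n].

Let balls_enum i : balls (ball_enum i).
Proof. by rewrite /ball_enum; case: choice.unpickle => [[[k j] n]|]; [right; do 2 eexists|left]. Qed.

Let balls_measurable : @measurable _ Qp = <<s balls >>.
Proof.
apply/seteqP; split.
  apply: smallest_sub; first exact: smallest_sigma_algebra.
  move=> A /= oA; rewrite (open_bigcup_ball oA).
  apply: (@bigcup_measurable _ (g_sigma_algebraType balls)) => i _.
  apply: sub_sigma_algebra; exact: balls_enum.
apply: smallest_sub; first exact: sigma_algebra_measurable.
by move=> A [->//|[x [n ->]]]; exact: measurable_padic_ball.
Qed.

Let balls_setI : setI_closed balls.
Proof.
move=> A B [->|[x [m ->]]]; first by rewrite set0I; left.
move=> [->|[y [n ->]]]; first by rewrite setI0; left.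
wlog mn : x y m n / (m <= n)%N => [hw|].
  by have [/hw//|/ltnW nm] := leqP m n; rewrite setIC; exact: hw.
have [->|/set0P[z [xz yz]]] := eqVneq (padic_ball x m `&` padic_ball y n) set0.
  by left.
right; exists z, n; rewrite (padic_ball_eq xz) (padic_ball_eq yz).
apply/setIidPr; rewrite !padic_ballE => t /= /le_trans; apply.
by rewrite lef_pV2 ?posrE ?exprn_gt0 ?natp_gt0// ler_eXn2l ?natp_gt1.
Qed.

(** The balls are a generating pi-system, as every open set is a union of balls
    and there are only countably many of them. *)
Lemma padic_measure_unique (m1 m2 : {measure set Qp -> \bar R}) :
  (forall x n, m1 (padic_ball x n) = m2 (padic_ball x n)) ->
  (forall x n, (m1 (padic_ball x n) < +oo)%E) ->
  forall A, measurable A -> m1 A = m2 A.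
Proof.
move=> m12 m1fin; apply: (measure_unique balls ball_enum) => //.
- apply/seteqP; split => // x _; have [i e] := padic_ball_enum x 0.
  by exists i; rewrite // -e; exact: padic_ball_refl.
- by move=> A [->|[x [n ->]]]; rewrite ?measure0.
- by move=> i; have [->|[x [n ->]]] := balls_enum i; rewrite ?measure0.
Qed.

Section Haar.
Variable m : {measure set Qp -> \bar R}.
Hypothesis m_haar : padic_haar m.

Lemma haar_translate x (A : set Qp) : measurable A ->
  m [set y | A (y - x)] = m A.
Proof.
move=> mA; rewrite -(m_haar.1 x A mA); congr (m _).
apply/seteqP; split => [y /= Ayx|_ [z Az <-] /=]; last by rewrite addrAC subrr add0r.
by exists (y - x); rewrite // subrKC.
Qed.

Let B k : set Qp := [set y | pnorm y <= p%:R ^ (- k)].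

Let mB k : measurable (B k).
Proof.
have -> : B k = [set y | pnorm (y - 0) <= p%:R ^ (- k)].
  by apply/seteqP; split => y /=; rewrite subr0.
by apply: padic_open_measurable; apply: open_pnorm_le; exact: expz_gt0.
Qed.

(** A ball is the disjoint union of p translates of the next smaller one. *)
Let haar_step k : m (B k) = (p%:R%:E * m (B (k + 1)))%E.
Proof.
pose c (j : nat) : Qp := p%:R ^ k * j%:R.
pose F j := [set y | B (k + 1) (y - c j)].
have mF j : measurable (F j).
  rewrite (_ : F j = [set y | pnorm (y - c j) <= p%:R ^ (- (k + 1))])//.
  by apply: padic_open_measurable; apply: open_pnorm_le; exact: expz_gt0.
have k1 : p%:R ^ (- (k + 1)) <= p%:R ^ (- k) :> R.
  by rewrite ler_eXz2l ?natp_gt1// lerN2 lerDl.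
have BF : B k = \big[setU/set0]_(j < p) F j.
  rewrite -bigcup_mkord; apply/seteqP; split => y /=.
    move=> /pnorm_le[z ->]; exists (z 1%N) => /=.
      by have := residue_lt z 1; rewrite expn1.
    rewrite /F /= /B /= /c -mulrBr pnormM pnorm_expz opprD expfzDr ?gt_eqF ?natp_gt0//.
    by rewrite ler_wpM2l ?(ltW (expz_gt0 _))//; have := pnorm_residue z 1.
  move=> [j _]; rewrite /B /= => yj; rewrite -(subrK (c j) y).
  apply: pnormD_le; first exact: le_trans k1.
  by rewrite /c pnormM pnorm_expz ler_piMr ?pnorm_nat// ltW// expz_gt0.
have tF : trivIset setT (fun j : 'I_p => F j).
  apply/trivIsetP => i j _ _ ij; rewrite -subset0 => y [/= yi yj].
  case/eqP: ij; apply/val_inj => /=.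
  have : pnorm (c i - c j) <= p%:R ^ (- (k + 1)).
    rewrite (_ : c i - c j = (y - c j) - (y - c i)); last by ring.
    by apply: pnormD_le => //; rewrite pnormN.
  rewrite /c -mulrBr pnormM pnorm_expz opprD expfzDr ?gt_eqF ?natp_gt0//.
  rewrite ler_pM2l ?expz_gt0//.
  rewrite -!(rmorph_nat iota) -rmorphB => /(pnorm_iota_le _ 1) h.
  have : (i%:R : Zp) 1%N = ((i%:R - j%:R : Zp) + j%:R) 1%N by rewrite subrK.
  rewrite residueD h !residue_nat expn1 add0n modn_mod.
  by rewrite !modn_small.
rewrite BF (@measure_bigsetU_ord _ _ _ m p xpredT (fun j => F j))//.
rewrite (eq_bigr (fun=> m (B (k + 1)))); last first.
  by move=> j _; rewrite -(haar_translate (c j) (mB (k + 1))).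
by rewrite sumr_const card_ord mule_natl.
Qed.

Let mule_natp_inj (x : \bar R) (y : R) : (y%:E = p%:R%:E * x)%E -> (x = (y / p%:R)%:E)%E.
Proof.
have p0 := natp_gt0; case: x => [x [->]| |].
- by rewrite mulrAC mulfV ?gt_eqF// mul1r.
- by rewrite mulry gtr0_sg// mul1e.
- by rewrite mulrNy gtr0_sg// mul1e.
Qed.

Lemma haar_ball0 k : m (B k) = (p%:R ^ (- k))%:E.
Proof.
have p0 : (p%:R : R) != 0 by rewrite gt_eqF// natp_gt0.
have m0 : m (B 0) = 1%E.
  rewrite -m_haar.2; congr (m _); apply/seteqP; split => y; rewrite /B /= oppr0 expr0z.
    by move=> h; exact/pnorm_le1.
  by move=> h; exact/pnorm_le1.
have up (n : nat) : m (B n) = (p%:R ^ (- n%:Z))%:E.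
  elim: n => [|n IH]; first by rewrite m0 oppr0 expr0z.
  have := haar_step n; rewrite IH -PoszD addn1 => /mule_natp_inj ->.
  by rewrite -addn1 PoszD opprD expfzDr.
have down (n : nat) : m (B (- n%:Z)) = (p%:R ^ n)%:E.
  elim: n => [|n IH]; first by rewrite oppr0 m0 expr0z.
  rewrite haar_step (_ : - n.+1%:Z + 1 = - n%:Z).
    by rewrite IH -EFinM -exprSz.
  by rewrite -addn1 PoszD opprD subrK.
case: k => n; first exact: up.
by rewrite NegzE opprK down.
Qed.

Lemma haar_ball x k : m [set y | pnorm (y - x) <= p%:R ^ (- k)] = (p%:R ^ (- k))%:E.
Proof. by rewrite -haar_ball0 -(haar_translate x (mB k)). Qed.

Lemma haar_padic_ball x n : m (padic_ball x n) = (p%:R ^ (- n%:Z))%:E.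
Proof. by rewrite padic_ballE exprnN haar_ball. Qed.

(** A point lies in balls of arbitrarily small measure. *)
Lemma haar_set1 x : m [set x] = 0%E.
Proof.
have mx : measurable [set x].
  have -> : [set x] = ~` [set y | pnorm (y - x) != 0].
    apply/seteqP; split => y /=; first by move=> ->; rewrite subrr pnorm0 eqxx.
    by move=> /negP; rewrite negbK pnorm_eq0 subr_eq0 => /eqP.
  apply: measurableC; apply: padic_open_measurable; apply: padic_openP => y /= yx.
  exists (pnorm (y - x)); first by rewrite lt_neqAle eq_sym yx pnorm_ge0.
  move=> z zy; rewrite (_ : z - x = (z - y) - (x - y)); last by ring.
  by rewrite pnormB_eq [pnorm (x - y)]pnormB.
apply/eqP; rewrite eq_le measure_ge0 andbT; apply/lee_addgt0Pr => e e0.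
have [n ne] := exp_pinv_lt e0; rewrite add0e.
apply: (@le_trans _ _ (m [set y | pnorm (y - x) <= p%:R ^ (- n%:Z)])).
  apply: le_measure; rewrite ?inE//.
    by apply: padic_open_measurable; apply: open_pnorm_le; exact: expz_gt0.
  by move=> y /= ->; rewrite subrr pnorm0 ltW// expz_gt0.
by rewrite haar_ball lee_fin -exprnN ltW.
Qed.

(** The image of Haar measure under the affine map and a multiple of Haar measure
    agree on balls. *)
Lemma haar_affine a h (f : Qp -> \bar R) : a != 0 -> measurable_fun setT f ->
  (forall x, 0 <= f x)%E ->
  (\int[m]_x f (a * x + h)%R = (pnorm a)^-1%:E * \int[m]_x f x)%E.
Proof.
move=> a0 mf f0; pose phi x : Qp := a * x + h.
have mphi : measurable_fun setT phi := measurable_affine a h.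
have na0 : 0 < pnorm a by rewrite pnorm_gt0.
have r0 : 0 <= (pnorm a)^-1 by rewrite invr_ge0 pnorm_ge0.
have E1 : (\int[m]_x f (phi x) = \int[pushforward m phi]_y f y)%E.
  have := ge0_integral_pushforward mphi m measurableT mf (fun y _ => f0 y).
  by rewrite preimage_setT => ->.
rewrite [LHS]E1 -[((pnorm a)^-1)]/((NngNum r0)%:num) -ge0_integral_mscale//.
apply: eq_measure_integral => A mA _.
have ball x n : m (phi @^-1` padic_ball x n) = ((pnorm a)^-1 * p%:R ^ (- n%:Z))%:E.
  have [k ak] := pnorm_neq0E a0; rewrite padic_ballE exprnN.
  rewrite (_ : phi @^-1` _ = [set y | pnorm (y - (x - h) / a) <= p%:R ^ (- (n%:Z + k))]).
    rewrite haar_ball; congr EFin.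
    by rewrite ak opprD expfzDr ?gt_eqF ?natp_gt0// mulrC invr_expz.
  have phiE y : phi y - x = (y - (x - h) / a) * a.
    by rewrite mulrBl divfK// /phi mulrC opprB addrA.
  have rE : p%:R ^ (- (n%:Z + k)) = p%:R ^ (- n%:Z) / pnorm a :> R.
    by rewrite ak opprD expfzDr ?gt_eqF ?natp_gt0// invr_expz.
  by apply/seteqP; split => y /=; rewrite phiE rE pnormM ler_pdivlMr.
apply: padic_measure_unique mA.
- move=> x n; transitivity ((pnorm a)^-1%:E * m (padic_ball x n))%E; last by [].
  by rewrite haar_padic_ball -EFinM; exact: ball.
- by move=> x n; rewrite [X in (X < _)%E]ball ltry.
Qed.

End Haar.
End PadicNorm.

(** * Integrability of powers of the norm *)

Section GeometricShells.
Context {R : realType} {d' : measure_display} {E : measurableType d'}.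
Variable mu : {measure set E -> \bar R}.

(** The integral over the n-th shell is at most the n-th term of a geometric
    series. *)
Lemma integral_shells (f : E -> R) (F : nat -> set E) (c : nat -> R) (C q : R) :
  measurable_fun setT f -> (forall x, 0 <= f x) ->
  (forall n, measurable (F n)) -> trivIset setT F ->
  (forall x, f x != 0 -> exists n, F n x) ->
  (forall n x, F n x -> f x <= c n) ->
  (forall n, (c n)%:E * mu (F n) <= (C * q ^+ n)%:E)%E ->
  0 <= q < 1 -> (\int[mu]_x (f x)%:E < +oo)%E.
Proof.
move=> mf f0 mF tF fF fc cF /andP[q0 q1]; pose D := \bigcup_n F n.
have meF A : measurable_fun A (fun x => (f x)%:E).
  by apply: measurable_funTS; exact/measurable_EFinP.
have -> : (\int[mu]_x (f x)%:E = \int[mu]_(x in D) (f x)%:E)%E.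
  rewrite [RHS]integral_mkcond; apply: eq_integral => x _; rewrite patchE.
  case: ifPn => // /negP xD; congr EFin; apply/eqP/negPn/negP => /fF[n xn].
  by apply: xD; apply/mem_set; exists n.
rewrite ge0_integral_bigcup//; last by move=> x _; rewrite lee_fin.
have cg : (\sum_(0 <= i < n) (C * q ^+ i)%:E)%E @[n --> \oo] --> (C * (1 - q)^-1)%:E.
  have h : series (geometric C q) n @[n --> \oo] --> C * (1 - q)^-1.
    by apply: cvg_geometric_series; rewrite ger0_norm.
  apply/fine_cvgP; split; first by apply: nearW => n; rewrite sumEFin.
  apply: cvg_trans h; apply: near_eq_cvg; apply: nearW => n /=.
  by rewrite sumEFin /series.
apply: (@le_lt_trans _ _ (\sum_(i <oo) (C * q ^+ i)%:E)%E); last first.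
  by rewrite (cvg_lim _ cg)// ltry.
apply: lee_nneseries => [n _ _|n _]; first by apply: integral_ge0 => x _; rewrite lee_fin.
apply: le_trans (cF n).
have -> : ((c n)%:E * mu (F n) = \int[mu]_(x in F n) (c n)%:E)%E.
  by rewrite integral_cst.
apply: ge0_le_integral => //.
- by move=> x _; rewrite lee_fin.
- by move=> x xF; rewrite lee_fin; exact: fc xF.
Qed.

End GeometricShells.

Section PadicIntegrability.
Context {R : realType} {p : nat} {p_pr : prime p}.
Local Notation Qp := (padic p_pr).
Local Notation pnorm := (@padic_norm p p_pr R).
Variables (m : {measure set Qp -> \bar R}) (m_haar : padic_haar m).
Implicit Types (x y a h t : Qp) (k l : int).

(** A power of the norm is constant on each sphere, and a sphere has at most
    the measure of its ball. *)
Lemma integral_pnorm_powR (r C q : R) (g : nat -> int) (f : Qp -> R) :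
  injective g -> measurable_fun setT f -> (forall x, 0 <= f x) ->
  (forall x, f x != 0 -> exists n, pnorm x = p%:R ^ g n) ->
  (forall x, f x <= pnorm x `^ r) ->
  (forall n, (p%:R ^ g n) `^ (r + 1) <= C * q ^+ n) -> 0 <= q < 1 ->
  (\int[m]_x (f x)%:E < +oo)%E.
Proof.
move=> gI mf f0 fg fr gC q01.
have pg n : 0 < p%:R ^ g n :> R by exact: expz_gt0.
apply: (integral_shells (F := fun n => [set x | pnorm x = p%:R ^ g n])
  (c := fun n => (p%:R ^ g n) `^ r) mf f0 _ _ fg _ _ q01).
- move=> n; rewrite -[X in measurable X]setTI.
  exact: (measurable_pnorm measurableT (measurable_set1 (p%:R ^ g n))).
- apply/trivIsetP => i j _ _ ij; rewrite -subset0 => x [/= -> e].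
  case/eqP: ij; apply: gI; apply/eqP; rewrite eq_le.
  by rewrite -!(@ler_eXz2l R p%:R (natp_gt1 (p_pr := p_pr))) e lexx.
- by move=> n x /= <-; exact: fr.
- move=> n; apply: (@le_trans _ _ (((p%:R ^ g n) `^ r)%:E * (p%:R ^ g n)%:E)%E).
    rewrite lee_wpmul2l// ?lee_fin ?powR_ge0//.
    have := haar_ball0 m_haar (- g n); rewrite opprK => <-.
    apply: le_measure; rewrite ?inE.
    + rewrite -[X in measurable X]setTI.
      exact: (measurable_pnorm measurableT (measurable_set1 (p%:R ^ g n))).
    + rewrite (_ : [set _ | _] = [set y | pnorm (y - 0) <= p%:R ^ g n]).
        by apply: padic_open_measurable; apply: open_pnorm_le; exact: pg.
      by apply/seteqP; split => y /=; rewrite subr0.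
    + by move=> x /= ->.
  rewrite -EFinM lee_fin; apply: le_trans (gC n).
  by rewrite powRD ?powRr1 ?(ltW (pg n))//; apply/implyP => _; rewrite gt_eqF.
Qed.

Let powR_expz (k : int) (s : R) : (p%:R ^ k) `^ s = p%:R `^ (k%:~R * s).
Proof. by rewrite powRrM powR_intmul// ltW// natp_gt0. Qed.

Let powR_expzD (N : int) (n : nat) (s : R) :
  p%:R `^ ((N%:~R + n%:R) * s) = p%:R `^ (N%:~R * s) * (p%:R `^ s) ^+ n :> R.
Proof.
have p0 : (p%:R : R) != 0 by rewrite gt_eqF// natp_gt0.
rewrite mulrDl powRD; last by apply/implyP.
by congr (_ * _); rewrite mulrC powRrM powR_mulrn// powR_ge0.
Qed.

Let powRN_lt1 (s : R) : 0 < s -> 0 <= (p%:R : R) `^ (- s) < 1.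
Proof.
move=> s0; rewrite powR_ge0 powRN invf_lt1 ?powR_gt0 ?natp_gt0//=.
have e : 1 = 1 `^ s :> R by rewrite powR1.
by rewrite [ltLHS]e gt0_ltr_powR ?nnegrE ?natp_gt1// ltW// natp_gt0.
Qed.

(** The sphere of radius p^(N - n) contributes at most p^((N - n) s). *)
Lemma integral_near (N : int) (s : R) : 0 < s -> s != 1 ->
  (\int[m]_x (pnorm x `^ (s - 1) * \1_[set y | (pnorm y <= p%:R ^ N)%R] x)%:E < +oo)%E.
Proof.
move=> s0 s1; have s10 : s - 1 != 0 by rewrite subr_eq0.
pose g (n : nat) : int := N - n%:Z.
apply: (@integral_pnorm_powR (s - 1) (p%:R `^ (N%:~R * s)) (p%:R `^ (- s)) g).
- by move=> i j; rewrite /g => /addrI/oppr_inj[].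
- apply: measurable_funM.
    by apply: (measurableT_comp (measurable_powR (s - 1))); exact: measurable_pnorm.
  apply: measurable_indic; rewrite -[X in measurable X]setTI.
  apply: (@measurable_fun_ler _ _ _ setT pnorm (cst (p%:R ^ N))) => //.
  exact: measurable_pnorm.
- by move=> x; rewrite mulr_ge0 ?powR_ge0// indicE.
- move=> x; rewrite mulf_eq0 negb_or indicE => /andP[h1 h2].
  have x0 : x != 0 by apply: contraNneq h1 => ->; rewrite pnorm0 powR0.
  have xN : pnorm x <= p%:R ^ N.
    by move: h2; case: (boolP (_ \in _)) => [/set_mem//|_]; rewrite eqxx.
  have [k xk] := pnorm_neq0E (R := R) x0; move: xN; rewrite xk ler_eXz2l ?natp_gt1// => kN.
  by exists `|N - k|%N; rewrite /g gez0_abs ?subr_ge0// opprB addrC subrK.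
- by move=> x; rewrite indicE ler_piMr ?powR_ge0// lern1 leq_b1.
- move=> n; rewrite subrK powR_expz.
  have -> : (g n)%:~R * s = N%:~R * s + (- s) * n%:~R by rewrite /g rmorphB /=; ring.
  rewrite powRD; last by apply/implyP => _; rewrite gt_eqF// natp_gt0.
  by rewrite [p%:R `^ (- s * _)]powRrM powR_intmul ?powR_ge0.
- exact: powRN_lt1.
Qed.

(** The sphere of radius p^(N + n) contributes at most p^(-(N + n) s). *)
Lemma integral_far (N : int) (s : R) : 0 < s ->
  (\int[m]_x (pnorm x `^ (- s - 1) * \1_[set y | (p%:R ^ N <= pnorm y)%R] x)%:E < +oo)%E.
Proof.
move=> s0; pose g (n : nat) : int := N + n%:Z.
apply: (@integral_pnorm_powR (- s - 1) (p%:R `^ (N%:~R * - s)) (p%:R `^ (- s)) g).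
- by move=> i j; rewrite /g => /addrI[].
- apply: measurable_funM.
    by apply: (measurableT_comp (measurable_powR (- s - 1))); exact: measurable_pnorm.
  apply: measurable_indic; rewrite -[X in measurable X]setTI.
  apply: (@measurable_fun_ler _ _ _ setT (cst (p%:R ^ N)) pnorm) => //.
  exact: measurable_pnorm.
- by move=> x; rewrite mulr_ge0 ?powR_ge0// indicE.
- move=> x; rewrite mulf_eq0 negb_or indicE => /andP[_ h2].
  have xN : p%:R ^ N <= pnorm x.
    by move: h2; case: (boolP (_ \in _)) => [/set_mem//|_]; rewrite eqxx.
  have x0 : x != 0 by rewrite -(pnorm_gt0 (R := R)); apply: lt_le_trans xN; exact: expz_gt0.
  have [k xk] := pnorm_neq0E (R := R) x0; move: xN; rewrite xk ler_eXz2l ?natp_gt1// => kN.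
  by exists `|k - N|%N; rewrite /g gez0_abs ?subr_ge0// subrKC.
- by move=> x; rewrite indicE ler_piMr ?powR_ge0// lern1 leq_b1.
- move=> n; rewrite subrK powR_expz /g rmorphD /=.
  by rewrite (powR_expzD N n (- s)).
- exact: powRN_lt1.
Qed.

End PadicIntegrability.

(** * The additive character *)
Section PadicCharacter.
Context {R : realType} {p : nat} {p_pr : prime p}.
Local Notation Zp := (padic_int p_pr).
Local Notation Qp := (padic p_pr).
Local Notation iota := (@Zp_to_Qp p p_pr).
Local Notation pnorm := (@padic_norm p p_pr R).
Local Notation chi := (@padic_char p p_pr R).
Implicit Types (x y t : Qp).

Definition expi (r : R) : R[i] := cos r +i* sin r.

Lemma expiD (r s : R) : expi (r + s) = expi r * expi s.
Proof. by rewrite /expi cosD sinD; congr (_ +i* _); rewrite addrC. Qed.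

Lemma expi0 : expi 0 = 1.
Proof. by rewrite /expi cos0 sin0. Qed.

Lemma expi_2pi (n : nat) : expi (2 * pi * n%:R) = 1.
Proof.
elim: n => [|n IH]; first by rewrite mulr0 expi0.
rewrite -[n.+1]addn1 natrD mulrDr expiD IH mul1r mulr1 /expi.
by rewrite -[2 * pi]add0r mulr_natl cosD2pi sinD2pi cos0 sin0.
Qed.

Lemma Cmod_expi r : Cmod (expi r) = 1.
Proof. by rewrite CmodE /= cos2Dsin2 sqrtr1. Qed.

(** The defining formula persists for fractions that are not in lowest terms;
    this makes the character additive over a common denominator. *)
Lemma padic_charE (k : nat) (z : Zp) :
  chi (p%:R ^- k * iota z) = expi (2 * pi * ((z k)%:R / (p ^ k)%:R)).
Proof.
have pn n : (p ^ n)%:R != 0 :> R by rewrite pnatr_eq0 -lt0n expp_gt0.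
have [zk|zk] := eqVneq (z k) 0%N.
  rewrite zk mul0r mulr0 expi0 padic_char_Zp//; apply/(pnorm_le1 (R := R)).
  have /(pnorm_iota_le (R := R)) := zk; rewrite !exprnN pnormM pnorm_expz opprK => h.
  by rewrite mulrC -ler_pdivlMr ?expz_gt0// mul1r invr_expz.
have z0 : z != 0 by apply: contraNneq zk => ->; rewrite residue0.
have [j [u [uU ze]]] := padic_int_decomp z0.
have jk : (j < k)%N.
  rewrite ltnNge; apply: contra zk => kj; rewrite ze -natrX residueM residue_nat.
  by rewrite modnMml -(subnKC kj) expnD -mulnA modnMr.
have kE : k = ((k - j) + j)%N by rewrite subnK// ltnW.
have -> : p%:R ^- k * iota z = p%:R ^- (k - j) * iota u :> Qp.
  rewrite ze rmorphM rmorphXn /= rmorph_nat {1}kE exprD invfM mulrA -[_ * _ * p%:R ^+ j]mulrA.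
  by rewrite mulVf ?mulr1// expf_neq0// padic_p_neq0.
rewrite padic_char_unit ?subn_gt0// /expi -mulrA.
have -> : (z k)%:R / (p ^ k)%:R = (u (k - j)%N)%:R / (p ^ (k - j))%:R :> R.
  have -> : z k = (p ^ j * u (k - j)%N)%N.
    rewrite ze -natrX residueM residue_nat modnMml (@residueE _ _ u (k - j) k) ?leq_subr//.
    by rewrite muln_modr -expnD subnKC// ltnW.
  rewrite {2}kE expnD mulnC !natrM.
  rewrite invfM.
  by rewrite mulrACA mulfV ?mulr1.
by [].
Qed.

Lemma padic_common_denominator x y : exists (k : nat) (z w : Zp),
  x = p%:R ^- k * iota z /\ y = p%:R ^- k * iota w.
Proof.
have den t : exists N : nat, forall k : nat, (N <= k)%N -> exists z, t = p%:R ^- k * iota z.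
  have [->|t0] := eqVneq t 0; first by exists 0%N => k _; exists 0; rewrite rmorph0 mulr0.
  have [l tl] := pnorm_neq0E (R := R) t0; exists `|l|%N => k lk.
  rewrite exprnN; apply/(pnorm_le (R := R)); rewrite tl ler_eXz2l ?natp_gt1// opprK.
  by apply: le_trans (ler_norm _) _; rewrite -abszE lez_nat.
have [M hM] := den x; have [N hN] := den y.
have [z xz] := hM _ (leq_maxl M N); have [w yw] := hN _ (leq_maxr M N).
by exists (maxn M N), z, w.
Qed.

Lemma padic_charD x y : chi (x + y) = chi x * chi y.
Proof.
have [k [z [w [-> ->]]]] := padic_common_denominator x y.
rewrite -mulrDr -rmorphD !padic_charE -expiD -mulrDr -mulrDl -natrD residueD.
have pk : (p ^ k)%:R != 0 :> R by rewrite pnatr_eq0 -lt0n expp_gt0.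
have e : (z k + w k)%:R / (p ^ k)%:R = ((z k + w k) %/ p ^ k)%:R +
    ((z k + w k) %% p ^ k)%:R / (p ^ k)%:R :> R.
  by rewrite {1}(divn_eq (z k + w k) (p ^ k)) natrD natrM mulrDl mulfK.
by rewrite [in RHS]e [in RHS]mulrDr expiD expi_2pi mul1r.
Qed.

Lemma Cmod_padic_char x : Cmod (chi x) = 1.
Proof.
have [k [z [_ [-> _]]]] := padic_common_denominator x x.
by rewrite padic_charE Cmod_expi.
Qed.

Lemma padic_char_small x : pnorm x <= 1 -> chi x = 1.
Proof. by move=> x1; apply: padic_char_Zp; exact/(pnorm_le1 (R := R)). Qed.

(** The character is locally constant, being additive and trivial near 0. *)
Lemma measurable_padic_char t : measurable_fun setT (fun x => chi (t * x)).
Proof.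
apply: (measurable_locally_constant (R := R)) => x.
have [->|t0] := eqVneq t 0; first by exists 1 => // y _; rewrite !mul0r.
have nt : 0 < pnorm t by rewrite pnorm_gt0.
exists (pnorm t)^-1; first by rewrite invr_gt0.
move=> y yx; rewrite -[y](subrK x) mulrDr padic_charD padic_char_small ?mul1r//.
by rewrite pnormM -ler_pdivlMl// mulr1 ltW.
Qed.

End PadicCharacter.

(** * Integrability of the p-adic kernels *)
Section KernelIntegrability.
Context {R : realType} {p : nat} {p_pr : prime p}.
Local Notation Qp := (padic p_pr).
Local Notation pnorm := (@padic_norm p p_pr R).
Variables (alpha : R) (alpha_gt0 : 0 < alpha).
Variables (m : {measure set Qp -> \bar R}) (m_haar : padic_haar m).
Implicit Types (x y a h t : Qp).

Let alpha_neq0 : alpha != 0. Proof. by rewrite gt_eqF. Qed.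

Lemma energy_affine a h (f : Qp -> R[i]) : a != 0 -> measurable_fun setT f ->
  energy m alpha (fun x => f (a * x + h)) =
  ((pnorm a)^-1%:E * energy m alpha f)%E.
Proof.
move=> a0 mf.
rewrite /energy (haar_affine m_haar h (f := fun x => (Cmod (f x) `^ alpha)%:E) a0)//.
  exact: measurable_Cmod_powR.
by move=> x; rewrite lee_fin powR_ge0.
Qed.

Lemma energy_le (f g : Qp -> R[i]) : measurable_fun setT f -> measurable_fun setT g ->
  (forall x, Cmod (f x) <= Cmod (g x)) -> (energy m alpha f <= energy m alpha g)%E.
Proof.
move=> mf mg fg; apply: ge0_le_integral => //.
- by move=> x _; rewrite lee_fin powR_ge0.
- exact: measurable_Cmod_powR.
- exact: measurable_Cmod_powR.
- by move=> x _; rewrite lee_fin ge0_ler_powR ?nnegrE ?Cmod_ge0// ltW.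
Qed.

Lemma energyD_fin (f g : Qp -> R[i]) : measurable_fun setT f -> measurable_fun setT g ->
  (energy m alpha f < +oo)%E -> (energy m alpha g < +oo)%E ->
  (energy m alpha (fun x => f x + g x)%R < +oo)%E.
Proof.
move=> mf mg; have := energyD_le m alpha_gt0 ltr01 mf mg.
move: (energy _ _ _) (energy _ _ f) (energy _ _ g) => c a b h fa fb.
by apply: le_lt_trans h _; apply: lte_add_pinfty; apply: lte_mul_pinfty => //; rewrite lee_fin powR_ge0.
Qed.

Lemma energyZ_fin (r : R) (f : Qp -> R[i]) : measurable_fun setT f ->
  (energy m alpha f < +oo)%E -> (energy m alpha (fun x => r%:C * f x)%R < +oo)%E.
Proof.
by move=> mf ff; rewrite energyZ//; apply: lte_mul_pinfty => //; rewrite lee_fin powR_ge0.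
Qed.

Lemma measurable_pnormB t : measurable_fun setT (fun x => pnorm (t - x)).
Proof.
have -> : (fun x => pnorm (t - x)) = (fun x => pnorm (-1 * x + t)).
  by apply/funext => x; rewrite mulN1r addrC.
by apply: (measurableT_comp measurable_pnorm); exact: measurable_affine.
Qed.

Lemma measurable_pnorm_ball (r : R) : measurable [set y : Qp | pnorm y <= r].
Proof.
rewrite -[X in measurable X]setTI.
by apply: (@measurable_fun_ler _ _ _ setT pnorm (cst r)) => //; exact: measurable_pnorm.
Qed.

Lemma energy_near (r : R) (N : int) : 0 < r * alpha + 1 -> r != 0 ->
  (energy m alpha (fun x => (pnorm x `^ r * \1_[set y | (pnorm y <= p%:R ^ N)%R] x)%:C)
    < +oo)%E.
Proof.
move=> ra r0; rewrite energy_real.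
have := integral_near m_haar N ra; rewrite -subr_eq0 addrK mulf_neq0// => /(_ isT).
congr (_ < _)%E; apply: eq_integral => x _; congr EFin; rewrite indicE.
case: (_ \in _); last by rewrite !mulr0 normr0 powR0.
by rewrite !mulr1 ger0_norm ?powR_ge0// powRrM.
Qed.

(** An increment of a function of the norm is supported in a ball, where each
    of its two terms can be integrated separately. *)
Lemma energy_increment (g : R -> R) t : measurable_fun setT g -> t != 0 ->
  (energy m alpha (fun x : Qp => (g (pnorm x) * \1_[set y | (pnorm y <= pnorm t)%R] x)%R%:C)
    < +oo)%E ->
  (energy m alpha (fun x : Qp => (g (pnorm (t - x)%R) - g (pnorm x))%R%:C) < +oo)%E.
Proof.
move=> mg t0 fb; pose B := [set y : Qp | pnorm y <= pnorm t].
pose b x := (g (pnorm x) * \1_B x)%:C.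
have mb : measurable_fun setT b.
  apply: measurable_complexR; apply: measurable_funM.
    by apply: (measurableT_comp mg); exact: measurable_pnorm.
  by apply: measurable_indic; exact: measurable_pnorm_ball.
have mbt : measurable_fun setT (fun x => b (-1 * x + t)).
  by apply: (measurableT_comp mb); exact: measurable_affine.
(* Outside the ball both terms cancel, as t - x and x have the same norm. *)
rewrite (_ : (fun x => _) = fun x => b (-1 * x + t) + (-1)%:C * b x); last first.
  apply/funext => x; rewrite -rmorphM -rmorphD; congr (_%:C).
  rewrite mulN1r [- x + t]addrC mulN1r !indicE.
  have [xt|xt] := leP (pnorm x) (pnorm t).
    by rewrite !mem_set ?mulr1//= /B/= pnormD_le// pnormN.
  have e := pnormB_eq xt.
  by rewrite !memNset ?mulr0 ?e ?subrr//= /B/= ?e; apply/negP; rewrite -ltNge.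
apply: (energyD_fin mbt (measurable_complexZ (-1) mb)).
- rewrite energy_affine ?oppr_eq0 ?oner_neq0//.
  by apply: lte_mul_pinfty => //; rewrite lee_fin invr_ge0 pnorm_ge0.
- exact: energyZ_fin.
Qed.

Lemma linear_kernel0 (H : R) : linear_kernel alpha H (0 : Qp) = (fun=> 0).
Proof. by apply/funext => x; rewrite /linear_kernel sub0r pnormN subrr. Qed.

Lemma log_kernel0 : log_kernel R (0 : Qp) = (fun=> 0).
Proof. by apply/funext => x; rewrite /log_kernel sub0r pnormN subrr. Qed.

Let energy0 : energy m alpha (fun=> 0) = 0%E.
Proof. by rewrite /energy integral0_eq// => x _; rewrite Cmod0 powR0. Qed.

Lemma measurable_log_kernel t : measurable_fun setT (log_kernel R t).
Proof.
apply: measurable_funB.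
  by apply: (measurableT_comp (@measurable_ln R)); exact: measurable_pnormB.
by apply: (measurableT_comp (@measurable_ln R)); exact: measurable_pnorm.
Qed.

Lemma measurable_linear_kernel (H : R) t : measurable_fun setT (linear_kernel alpha H t).
Proof.
apply: measurable_funB; apply: (measurableT_comp (measurable_powR (H - alpha^-1))).
  exact: measurable_pnormB.
exact: measurable_pnorm.
Qed.

Lemma energy_linear_kernel (H : R) t : 0 < H -> H != alpha^-1 ->
  (energy m alpha (fun x => (linear_kernel alpha H t x)%:C) < +oo)%E.
Proof.
move=> H0 Ha; have [->|t0] := eqVneq t 0; first by rewrite linear_kernel0 energy0.
apply: (@energy_increment (fun y : R => y `^ (H - alpha^-1)) t) => //.
have [N ->] := pnorm_neq0E (R := R) t0; apply: energy_near; last by rewrite subr_eq0.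
by rewrite mulrBl mulVf// subrK mulr_gt0.
Qed.

(** Apply ln z <= z to z = y^c and to z = y^(-c). *)
Lemma normr_ln_le (c y : R) : 0 < c -> 0 < y -> `|ln y| <= c^-1 * (y `^ c + y `^ (- c)).
Proof.
move=> c0 y0; have lnp (s : R) : s * ln y <= y `^ s.
  by rewrite -ln_powR ltW// ln_sublinear// powR_gt0.
have := lnp c; have := lnp (- c); have := powR_ge0 y c; have := powR_ge0 y (- c).
move: (y `^ c) (y `^ (- c)) (ln y) => u v l v0 u0 h1 h2.
rewrite ler_pdivlMl// -{1}(gtr0_norm c0) -normrM ler_norml.
by apply/andP; split; lra.
Qed.

(** With c = 1 / (2 alpha), the powers |x|^c and |x|^(-c) that dominate the
    logarithm have finite energy near 0. *)
Lemma energy_log_kernel t :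
  (energy m alpha (fun x => (log_kernel R t x)%:C) < +oo)%E.
Proof.
have [->|t0] := eqVneq t 0; first by rewrite log_kernel0 energy0.
apply: (@energy_increment (@ln R) t) => //.
have [N ->] := pnorm_neq0E (R := R) t0.
pose B := [set y : Qp | pnorm y <= p%:R ^ N]; pose c := (2 * alpha)^-1.
have c0 : 0 < c by rewrite invr_gt0 mulr_gt0.
have ca : c * alpha = 2^-1 by rewrite /c invfM mulfVK.
pose u (s : R) x := (pnorm x `^ s * \1_B x)%:C.
have mB : measurable B by exact: measurable_pnorm_ball.
have mu s : measurable_fun setT (u s).
  apply: measurable_complexR; apply: measurable_funM; last exact: measurable_indic.
  by apply: (measurableT_comp (measurable_powR s)); exact: measurable_pnorm.
have fu : (energy m alpha (u c) < +oo)%E.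
  by apply: energy_near; rewrite ?ca ?gt_eqF//; lra.
have fv : (energy m alpha (u (- c)%R) < +oo)%E.
  by apply: energy_near; rewrite ?mulNr ?ca ?oppr_eq0 ?gt_eqF//; lra.
apply: le_lt_trans (energyZ_fin c^-1 (measurable_complexD (mu c) (mu (- c)))
  (energyD_fin (mu c) (mu (- c)) fu fv)).
apply: energy_le.
- apply: measurable_complexR; apply: measurable_funM; last exact: measurable_indic.
  by apply: (measurableT_comp (@measurable_ln R)); exact: measurable_pnorm.
- by apply: measurable_complexZ; exact: measurable_complexD.
move=> x; rewrite /u -rmorphD -rmorphM !CmodR -mulrDl mulrA !normrM.
rewrite ler_wpM2r//; have [->|x0] := eqVneq x 0.
  by rewrite pnorm0 ln0// normr0 mulr_ge0.
rewrite -normrM; apply: le_trans (normr_ln_le c0 _) (ler_norm _).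
by rewrite pnorm_gt0.
Qed.

Lemma measurable_harmonizable_kernel (H : R) t :
  measurable_fun setT (harmonizable_kernel alpha H t).
Proof.
apply: measurable_complexM.
  by apply: measurable_complexB; [exact: measurable_padic_char|exact: measurable_cst].
apply: measurable_complexR.
by apply: (measurableT_comp (measurable_powR (- H - alpha^-1))); exact: measurable_pnorm.
Qed.

(** The kernel vanishes near 0, where the character is trivial. *)
Lemma energy_harmonizable_kernel (H : R) t : 0 < H ->
  (energy m alpha (harmonizable_kernel alpha H t) < +oo)%E.
Proof.
move=> H0; have [->|t0] := eqVneq t 0.
  rewrite (_ : harmonizable_kernel alpha H 0 = fun=> 0) ?energy0//.
  apply/funext => x; rewrite /harmonizable_kernel mul0r padic_char_small ?subrr ?mul0r//.
  by rewrite pnorm0.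
have [N tN] := pnorm_neq0E (R := R) t0.
pose B := [set y : Qp | p%:R ^ (- N) <= pnorm y].
pose b x := (pnorm x `^ (- H - alpha^-1) * \1_B x)%:C.
have mB : measurable B.
  rewrite -[X in measurable X]setTI.
  by apply: (@measurable_fun_ler _ _ _ setT (cst (p%:R ^ (- N))) pnorm) => //;
    exact: measurable_pnorm.
have mb : measurable_fun setT b.
  apply: measurable_complexR; apply: measurable_funM; last exact: measurable_indic.
  by apply: (measurableT_comp (measurable_powR (- H - alpha^-1))); exact: measurable_pnorm.
have fb : (energy m alpha b < +oo)%E.
  rewrite energy_real; have := @integral_far _ _ _ m m_haar (- N) (H * alpha).
  rewrite mulr_gt0// => /(_ isT); congr (_ < _)%E.
  apply: eq_integral => x _; congr EFin; rewrite indicE.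
  case: (_ \in _); last by rewrite !mulr0 normr0 powR0.
  by rewrite !mulr1 ger0_norm ?powR_ge0// -powRrM mulrBl mulVf// mulNr.
apply: le_lt_trans (energyZ_fin 2 mb fb); apply: energy_le => //.
- exact: measurable_harmonizable_kernel.
- exact: measurable_complexZ.
move=> x; rewrite /b -rmorphM /harmonizable_kernel CmodM !CmodR indicE.
have [xB|/negP xB] := boolP (x \in B).
  rewrite mulr1 normrM ler_wpM2r// ger0_norm//.
  apply: le_trans (CmodD _ _) _; rewrite Cmod_padic_char CmodN (CmodR 1) normr1.
  by rewrite lexx.
rewrite padic_char_small ?subrr ?Cmod0 ?mul0r ?normr_ge0//.
have xN : pnorm x < p%:R ^ (- N).
  by rewrite ltNge; apply/negP => h; apply: xB; exact/mem_set.
by rewrite pnormM tN mulrC -ler_pdivlMr ?expz_gt0// mul1r invr_expz ltW.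
Qed.

End KernelIntegrability.

(** * Self-similarity of the p-adic kernels *)

Section SelfSimilarKernels.
Context {R : realType} {p : nat} {p_pr : prime p}.
Local Notation Qp := (padic p_pr).
Local Notation pnorm := (@padic_norm p p_pr R).
Variables (alpha : R) (alpha_gt0 : 0 < alpha) (alpha_le2 : alpha <= 2).
Variables (m : {measure set Qp -> \bar R}) (m_haar : padic_haar m).
Context {d : measure_display} {Omega : measurableType d} (P : probability Omega R).
Variables (S : set R[i]) (xi : R[i] -> set Qp -> Omega -> R).
Hypothesis sf : stable_field P m alpha S xi.
Implicit Types (x t a b h : Qp).

Let alpha_neq0 : alpha != 0. Proof. by rewrite gt_eqF. Qed.

Lemma ae_energy (f g : Qp -> R[i]) : measurable_fun setT f -> measurable_fun setT g ->
  {ae m, forall x, f x = g x} -> energy m alpha f = energy m alpha g.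
Proof.
move=> mf mg fg; apply: ae_eq_integral => //.
- exact: measurable_Cmod_powR.
- exact: measurable_Cmod_powR.
- by apply: filterS fg => x fg _; rewrite fg.
Qed.

Let powR_mulB1 (y s : R) : 0 < y -> y * y `^ (s - 1) = y `^ s.
Proof.
move=> y0; rewrite -{1}(powRr1 (ltW y0)) -powRD; first by congr (_ `^ _); ring.
by rewrite (gt_eqF y0) implybT.
Qed.

Section Kernel.
Variables (K : Qp -> Qp -> R[i]) (H : R) (X : Qp -> {RV P >-> R}).
Hypothesis KX : forall t, stable_int P m alpha S xi (K t) (X t).

Let mK t : measurable_fun setT (K t). Proof. by have [] := KX t. Qed.

Let combo (I : Type) (s : seq I) (theta : I -> R) (t : I -> Qp) x : R[i] :=
  \sum_(i <- s) (theta i)%:C * K (t i) x.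

Let mcombo I s theta (t : I -> Qp) : measurable_fun setT (@combo I s theta t).
Proof.
by apply: measurable_complex_sum => i; exact: measurable_complexZ.
Qed.

(** A dilation of time is undone by a dilation of the space variable, except at
    the singular points of the logarithm. *)
Hypothesis K_scale : forall a, a != 0 -> exists b (r : R),
  [/\ b != 0, pnorm b * `|r| `^ alpha = (pnorm a `^ H) `^ alpha &
      forall t, {ae m, forall x, K (a * t) (b * x) = r%:C * K t x}].

(** The factor u, of modulus one, does not depend on t, so it factors out of
    linear combinations. *)
Hypothesis K_shift : forall h, exists b (u : Qp -> R[i]),
  (forall x, Cmod (u x) = 1) /\
  forall t x, K (t + h) x - K h x = u x * K t (x - b).

Let combo_scale a : a != 0 -> forall I s theta (t : I -> Qp),
  energy m alpha (@combo I s theta (fun i => a * t i)) =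
  (((pnorm a `^ H) `^ alpha)%:E * energy m alpha (combo s theta t))%E.
Proof.
move=> a0 I s theta t; have [b [r [b0 br Kb]]] := K_scale a0.
have e1 := energy_affine alpha m_haar 0 b0 (mcombo s theta (fun i => a * t i)).
have nb : 0 < pnorm b by rewrite pnorm_gt0.
have -> : energy m alpha (combo s theta (fun i => a * t i)) =
    ((pnorm b)%:E * energy m alpha (fun x => combo s theta (fun i => a * t i)%R (b * x + 0)%R))%E.
  by rewrite e1 muleA -EFinM divff ?mul1e// gt_eqF.
rewrite -br EFinM -muleA; congr (_ * _)%E.
rewrite -(energyZ m alpha r (mcombo s theta t)).
apply: (ae_energy (measurableT_comp (mcombo s theta (fun i => a * t i))
  (measurable_affine (R := R) b 0)) (measurable_complexZ r (mcombo s theta t))).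
rewrite /combo; elim: s {e1} => [|i s IH].
  by apply: nearW => x /=; rewrite !big_nil mulr0.
apply: filterS2 IH (Kb (t i)) => x /=; rewrite !big_cons mulrDr addr0 => -> ->.
by rewrite mulrCA.
Qed.

Let combo_shift h I s theta (t : I -> Qp) :
  energy m alpha (fun x => \sum_(i <- s) (theta i)%:C * (K (t i + h) x - K h x)) =
  energy m alpha (@combo I s theta t).
Proof.
have [b [u [u1 Ku]]] := K_shift h.
have -> : energy m alpha (combo s theta t) =
    energy m alpha (fun x => combo s theta t (1 * x + - b)).
  by rewrite (energy_affine alpha m_haar (- b) (oner_neq0 _)) ?pnorm1 ?invr1 ?mul1e.
apply: eq_integral => x _; congr (_%:E); congr (_ `^ _).
rewrite mul1r -[RHS]mul1r -(u1 x) -CmodM /combo big_distrr/=; congr Cmod.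
by apply: eq_bigr => i _; rewrite Ku mulrCA.
Qed.

(** Both defining identities of a self-similar process with stationary
    increments reduce to changes of variables in the energy of a linear
    combination of kernels. *)
Lemma stable_int_sssi : padic_sssi_index H X.
Proof.
split=> [a a0|h].
  apply: (stable_int_eq_fdd alpha_gt0 alpha_le2 sf
    (F := fun t => K (a * t)) (G := fun t x => (pnorm a `^ H)%:C * K t x)).
  - by move=> t; exact: KX.
  - by move=> t; apply: stable_intZ.
  - move=> I s theta t; have := combo_scale a0 s theta t; rewrite /combo => ->.
    rewrite -[in LHS](ger0_norm (powR_ge0 (pnorm a) H)) -energyZ; last exact: mcombo.
    apply: eq_integral => x _; congr (_%:E); congr (_ `^ _); congr Cmod.
    by rewrite big_distrr/=; apply: eq_bigr => i _; rewrite mulrCA.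
apply: (stable_int_eq_fdd alpha_gt0 alpha_le2 sf
  (F := fun t x => K (t + h) x - K h x) (G := K)
  (X := fun t w => X (t + h) w - X h w) (Y := X) _ KX).
  move=> t; have := stable_intD alpha_gt0 sf (KX (t + h))
    (stable_intZ sf (-1) (KX h)).
  have -> : (fun x => K (t + h) x + (-1)%:C * K h x) = (fun x => K (t + h) x - K h x).
    by apply/funext => x; rewrite rmorphN1 mulN1r.
  by have -> : (fun w => X (t + h) w + -1 * X h w) = (fun w => X (t + h) w - X h w)
    by apply/funext => w; rewrite mulN1r.
by move=> I s theta t; exact: combo_shift.
Qed.

End Kernel.

Section RealKernels.
Variable X : Qp -> {RV P >-> R}.

(** Translating the variable turns an increment of the process into the
    process itself. *)
Lemma difference_kernel_shift (g : R -> R) h : exists b (u : Qp -> R[i]),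
  (forall x, Cmod (u x) = 1) /\
  forall t x, (g (pnorm (t + h - x)) - g (pnorm x))%:C - (g (pnorm (h - x)) - g (pnorm x))%:C
    = u x * (g (pnorm (t - (x - b))) - g (pnorm (x - b)))%:C.
Proof.
exists h, (fun=> 1); split=> [x|t x]; first by rewrite (CmodR 1) normr1.
rewrite mul1r -rmorphB; congr (_%:C); rewrite [pnorm (x - h)]pnormB.
have -> : t + h - x = t - (x - h) by ring.
ring.
Qed.

(** With the dilation by a both in time and in space, the kernel picks up the
    factor |a|^(H - 1/alpha), and Haar measure the factor |a|. *)
Lemma linear_kernel_sssi (H : R) : 0 < H -> H != alpha^-1 ->
  (forall t, stable_int P m alpha S xi (fun x => (linear_kernel alpha H t x)%:C) (X t)) ->
  padic_sssi X.
Proof.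
move=> H0 Ha KX; exists H => //; apply: (stable_int_sssi KX).
- move=> a a0; have na : 0 < pnorm a by rewrite pnorm_gt0.
  exists a, (pnorm a `^ (H - alpha^-1)); split => //.
    by rewrite ger0_norm ?powR_ge0// -!powRrM mulrBl mulVf// powR_mulB1.
  move=> t; apply: nearW => x; rewrite -rmorphM /linear_kernel -(mulrBr a t x) !pnormM.
  by rewrite !powRM -?mulrBr; try exact: pnorm_ge0.
- by move=> h; exact: (difference_kernel_shift (fun y : R => y `^ (H - alpha^-1)) h).
Qed.

(** Off the two singular points, the kernel is invariant under a common dilation
    of time and space, because ln |a| cancels; only Haar measure is scaled,
    whence the index 1/alpha. *)
Lemma log_kernel_sssi :
  (forall t, stable_int P m alpha S xi (fun x => (log_kernel R t x)%:C) (X t)) ->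
  padic_sssi X.
Proof.
move=> KX; exists alpha^-1; first by rewrite invr_gt0.
apply: (stable_int_sssi KX).
- move=> a a0; have na : 0 < pnorm a by rewrite pnorm_gt0.
  exists a, 1; split => //.
    by rewrite normr1 powR1 mulr1 -powRrM mulVf// powRr1// ltW.
  have ae_neq c : {ae m, forall x, x != c}.
    exists [set c]; split; [|exact: haar_set1|].
      have -> : [set c] = ~` (~` [set c]) by rewrite setCK.
      apply: measurableC; apply: padic_open_measurable; apply: (padic_openP (R := R)) => y yc.
      exists (pnorm (y - c)).
        by rewrite pnorm_gt0 subr_eq0; apply/eqP.
      by move=> z zy zc; move: zy; rewrite zc pnormB ltxx.
    by move=> x /=; move/negP; rewrite negbK => /eqP.
  move=> t; apply: filterS2 (ae_neq 0) (ae_neq t) => x x0 xt.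
  have ln_dilation y : y != 0 -> ln (pnorm (a * y)) = ln (pnorm a) + ln (pnorm y).
    by move=> y0; rewrite pnormM lnM// posrE pnorm_gt0.
  rewrite mul1r /log_kernel -(mulrBr a t x) (ln_dilation _ x0) ln_dilation.
    by congr (_%:C); ring.
  by rewrite subr_eq0 eq_sym.
- by move=> h; exact: (difference_kernel_shift (@ln R) h).
Qed.

(** A translation of time multiplies the kernel by a character, of modulus one;
    a dilation of time is undone by the inverse dilation of the frequency. *)
Lemma harmonizable_kernel_sssi (H : R) : 0 < H ->
  (forall t, stable_int P m alpha S xi (harmonizable_kernel alpha H t) (X t)) ->
  padic_sssi X.
Proof.
move=> H0 KX; exists H => //; apply: (stable_int_sssi KX).
- move=> a a0; have na : 0 < pnorm a by rewrite pnorm_gt0.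
  exists a^-1, (pnorm a `^ (H + alpha^-1)); split; first by rewrite invr_eq0.
    rewrite ger0_norm ?powR_ge0// -!powRrM mulrDl mulVf// pnormV.
    rewrite -[X in _ = _ `^ X](addrK 1) -powR_mulB1// addrK.
    by rewrite mulrA mulVf ?mul1r// gt_eqF.
  move=> t; apply: nearW => x; rewrite /harmonizable_kernel.
  rewrite mulrACA mulfV// mul1r mulrCA -rmorphM; congr (_ * _%:C).
  rewrite (pnormM a^-1 x) (powRM _ (pnorm_ge0 _) (pnorm_ge0 _)); congr (_ * _).
  by rewrite pnormV -powR_inv1 ?ltW// -powRrM; congr (_ `^ _); ring.
- move=> h; exists 0, (fun x => padic_char R (h * x)); split=> [x|t x].
    exact: Cmod_padic_char.
  by rewrite /harmonizable_kernel (subr0 x) (mulrDl t h x) padic_charD; ring.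
Qed.

End RealKernels.

End SelfSimilarKernels.

(** * The branching tree *)

Section CountingMeasure.
Context {R : realType} {T : measurableType default_measure_display}.

Lemma counting_card_eq {T1 T2 : choiceType} (A : set T1) (B : set T2) : (A #= B)%card ->
  counting A = counting B :> \bar R.
Proof.
move=> AB; rewrite /counting (eq_finite_set AB); case: ifPn => // /asboolP fB.
have fA : finite_set A by rewrite (eq_finite_set AB).
by congr (_%:R%:E); apply/(fcard_eq fA fB).
Qed.

(** An injection of the index set preserves the counting measure of the subsets
    of its range. *)
Lemma integral_counting_inj (phi : T -> T) (f : T -> \bar R) :
  measurable_fun setT phi -> measurable (range phi) ->
  injective phi -> measurable_fun setT f -> (forall x, 0 <= f x)%E ->
  (forall x, ~ range phi x -> f x = 0%E) ->
  (\int[counting]_x f x = \int[counting]_x f (phi x))%E.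
Proof.
move=> mphi mr phiI mf f0 fr; pose D := range phi.
have -> : (\int[counting]_x f x = \int[counting]_(x in D) f x)%E.
  rewrite [RHS]integral_mkcond; apply: eq_integral => x _; rewrite patchE.
  by case: ifPn => // /negP xD; apply: fr => xr; apply: xD; exact/mem_set.
have mfD : measurable_fun D f by exact: measurable_funTS.
have := ge0_integral_pushforward mphi (@counting T R) mr mfD (fun y _ => f0 y).
have -> : phi @^-1` D = setT by apply/seteqP; split => // x _; exists x.
move=> <-; apply: eq_measure_integral => A mA AD; rewrite /pushforward.
rewrite -[in LHS](_ : phi @` (phi @^-1` A) = A).
  by apply: counting_card_eq; apply: inj_card_eq => x y _ _; exact: phiI.
apply/seteqP; split => [_ [x /= xA <-]//|y yA].
by have [x _ xy] := AD _ yA; exists x; rewrite //= xy.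
Qed.

End CountingMeasure.

Section BRWKernel.
Context {R : realType} {p : nat} (p_pr : prime p).
Variables (alpha : R) (alpha_gt0 : 0 < alpha) (H : R) (H_gt0 : 0 < H).
Local Notation E := (brw_tree p).
Local Notation K n := (fun e : E => (brw_kernel p H n e)%:C : R[i]).
Implicit Types (e : E) (n h k a : nat).

Let node k (r : 'Z_(p ^ k.+1)) : E := existT (fun k => 'Z_(p ^ k.+1)) k r.
Let weight k : R := p%:R `^ (- (k%:R * H)).

Let p_gt0 : 0 < p%:R :> R. Proof. by rewrite ltr0n prime_gt0. Qed.
Let p_gt1 : 1 < p%:R :> R. Proof. by rewrite ltr1n prime_gt1. Qed.

Let level_gt1 k : (1 < p ^ k.+1)%N.
Proof. by rewrite -{1}(exp1n k.+1) ltn_exp2r// prime_gt1. Qed.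

Lemma measurable_brw {d : measure_display} {V : measurableType d} (f : E -> V) :
  measurable_fun setT f.
Proof. by []. Qed.

Lemma brw_kernelE n k (r : 'Z_(p ^ k.+1)) :
  brw_kernel p H n (node r) = weight k * ((r == n%:R)%:R - (r == 0)%:R) :> R.
Proof. by []. Qed.

(** The two leaves 0 and n give at most two nodes at each level, and the
    weights decrease geometrically. *)
Lemma energy_brw_kernel n : (energy counting alpha (K n) < +oo)%E.
Proof.
pose F k : set E := [set node (n%:R : 'Z_(p ^ k.+1))] `|` [set node (0 : 'Z_(p ^ k.+1))].
apply: (@integral_shells _ _ E counting _ F (fun k => weight k `^ alpha) 2
  (p%:R `^ (- (H * alpha)))).
- exact: measurable_brw.
- by move=> x; exact: powR_ge0.
- by [].
- by apply/trivIsetP => i j _ _ ij; rewrite -subset0 => x [] [] -> [] e;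
    case/eqP: ij; have := congr1 (@projT1 _ _) e.
- move=> [k r]; rewrite CmodR brw_kernelE => h; exists k; rewrite /F/= -/(node r).
  have [->|r0] := eqVneq r 0; first by right.
  have [->|rn] := eqVneq r n%:R; first by left.
  by move: h; rewrite (negbTE r0) (negbTE rn) subrr mulr0 normr0 powR0 ?eqxx// gt_eqF.
- move=> k e ek; have d1 (b c : bool) : `|b%:R - c%:R| <= 1 :> R.
    by case: b; case: c; rewrite ?subrr ?subr0 ?sub0r ?normrN ?normr0 ?normr1.
  apply: (ge0_ler_powR (ltW alpha_gt0)); rewrite ?nnegrE ?Cmod_ge0 ?powR_ge0//.
  case: ek => ->; rewrite CmodR brw_kernelE normrM (ger0_norm (powR_ge0 _ _)).
    exact: (ler_piMr (powR_ge0 _ _) (d1 _ _)).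
  exact: (ler_piMr (powR_ge0 _ _) (d1 _ _)).
- move=> k; have c1 (x : E) : ((@counting E R : {measure set E -> \bar R}) [set x] <= 1)%E.
    by rewrite /= /counting asboolT// fset_set1 cardfs1.
  apply: (@le_trans _ _ ((weight k `^ alpha)%:E * (1 + 1))%E).
    rewrite lee_wpmul2l ?lee_fin ?powR_ge0//.
    exact: le_trans (measureU2 _ _ _) (leeD (c1 _) (c1 _)).
  rewrite -EFinD -EFinM lee_fin mulrC -powRrM.
  rewrite -(powR_mulrn k (powR_ge0 _ _)) -powRrM.
  by have -> : - (k%:R * H) * alpha = - (H * alpha) * k%:R by ring.
- rewrite powR_ge0 powRN invf_lt1 ?powR_gt0//=.
  have e : 1 = 1 `^ (H * alpha) :> R by rewrite powR1.
  by rewrite [ltLHS]e gt0_ltr_powR ?mulr_gt0// ?nnegrE// ltW.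
Qed.

Let combo (I : Type) (s : seq I) (theta : I -> R) (t : I -> nat) e : R[i] :=
  \sum_(i <- s) (theta i)%:C * K (t i) e.

(** The change of variables e = phi e' for the counting measure; the nodes that
    it misses do not contribute. *)
Lemma energy_brw_inj (phi : E -> E) (F : nat -> E -> R) (r : R)
    (I : Type) (s : seq I) (theta : I -> R) (t : I -> nat) :
  injective phi -> (forall n e, F n (phi e) = r * brw_kernel p H n e) ->
  (forall n e, ~ range phi e -> F n e = 0) ->
  energy counting alpha (fun e => \sum_(i <- s) (theta i)%:C * (F (t i) e)%:C) =
  ((`|r| `^ alpha)%:E * energy counting alpha (combo s theta t))%E.
Proof.
move=> phiI Fphi Fr; rewrite -energyZ; last exact: measurable_brw.
transitivity (energy counting alpha (fun e => \sum_(i <- s) (theta i)%:C * (F (t i) (phi e))%:C)).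
  apply: (integral_counting_inj (phi := phi)
    (f := fun e => (Cmod (\sum_(i <- s) (theta i)%:C * (F (t i) e)%:C) `^ alpha)%:E)) => //.
  - by move=> x; rewrite lee_fin powR_ge0.
  - move=> x xr; rewrite big1; first by rewrite Cmod0 powR0// gt_eqF.
    by move=> i _; rewrite (Fr _ _ xr) mulr0.
apply: eq_integral => x _; congr (_%:E); congr (_ `^ _); congr Cmod.
by rewrite /combo big_distrr/=; apply: eq_bigr => i _; rewrite Fphi rmorphM mulrCA.
Qed.

(** Translation of the residues by h permutes every level. *)
Lemma energy_brw_shift h (I : Type) (s : seq I) (theta : I -> R) (t : I -> nat) :
  energy counting alpha (fun e => \sum_(i <- s) (theta i)%:C * (K (t i + h)%N e - K h e)) =
  energy counting alpha (combo s theta t).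
Proof.
pose phi e : E := node (tagged e + h%:R).
pose psi e : E := node (tagged e - h%:R).
have phiK : cancel phi psi by move=> [k r]; rewrite /phi /psi /= addrK.
have psiK : cancel psi phi by move=> [k r]; rewrite /phi /psi /= subrK.
have := @energy_brw_inj phi (fun n e => brw_kernel p H (n + h) e - brw_kernel p H h e) 1
  I s theta t (can_inj phiK).
rewrite normr1 powR1 mul1e => <-.
- by apply: eq_integral => x _; under eq_bigr do rewrite -rmorphB.
- move=> n [k r]; rewrite /phi/= !brw_kernelE mul1r -mulrBr; congr (_ * _).
  have sh (x y : 'Z_(p ^ k.+1)) : (x + h%:R == y + h%:R) = (x == y).
    exact: (inj_eq (addIr _)).
  have sh0 (x : 'Z_(p ^ k.+1)) : (x + h%:R == h%:R) = (x == 0).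
    by rewrite -[X in _ == X]add0r sh.
  by rewrite natrD sh sh0; ring.
- by move=> n e []; exists (psi e).
Qed.

Let scales (a : nat) := forall (I : Type) (s : seq I) (theta : I -> R) (t : I -> nat),
  energy counting alpha (combo s theta (fun i => (a * t i)%N)) =
  (((padic_norm R (a%:R : padic p_pr) `^ H) `^ alpha)%:E *
   energy counting alpha (combo s theta t))%E.

Let scalesM a b : scales a -> scales b -> scales (a * b).
Proof.
move=> sa sb I s theta t.
have -> : (fun i => a * b * t i)%N = (fun i => a * (b * t i))%N.
  by apply/funext => i; rewrite mulnA.
rewrite (sa I s theta (fun i => b * t i)%N) (sb I s theta t).
have -> : padic_norm R ((a * b)%:R : padic p_pr) =
    padic_norm R (a%:R : padic p_pr) * padic_norm R (b%:R : padic p_pr).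
  by rewrite -pnormM -natrM.
move: (pnorm_ge0 (R := R) (a%:R : padic p_pr)) (pnorm_ge0 (R := R) (b%:R : padic p_pr)).
move: (padic_norm _ _) (padic_norm _ _) (energy _ _ _) => x y e x0 y0.
by rewrite (powRM _ x0 y0) (powRM _ (powR_ge0 _ _) (powR_ge0 _ _)) EFinM muleA.
Qed.

(** Multiplication by an integer prime to p permutes every level. *)
Let scales_unit a : coprime p a -> scales a.
Proof.
move=> pa I s theta t.
have au k : (a%:R : 'Z_(p ^ k.+1)) \is a GRing.unit by rewrite unitZpE// coprimeXl.
pose phi e : E := node (a%:R * tagged e).
pose psi e : E := node (a%:R^-1 * tagged e).
have phiK : cancel phi psi by move=> [k r]; rewrite /phi /psi /= (mulKr (au k)).
have psiK : cancel psi phi by move=> [k r]; rewrite /phi /psi /= (mulVKr (au k)).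
rewrite (@energy_brw_inj phi (fun n e => brw_kernel p H (a * n) e) 1 I s theta t (can_inj phiK)).
- rewrite normr1 powR1.
  have -> : padic_norm R (a%:R : padic p_pr) = 1.
    have -> : a%:R = p%:R ^ 0 * Zp_to_Qp (a%:R) :> padic p_pr.
      by rewrite expr0z mul1r rmorph_nat.
    rewrite pnormE ?oppr0 ?expr0z// padic_int_unitE residue_nat expn1.
    by rewrite -/(dvdn _ _) -prime_coprime.
  by rewrite !powR1.
- move=> n [k r]; rewrite /phi/= !brw_kernelE mul1r; congr (_ * (_%:R - _%:R)).
    by rewrite natrM (inj_eq (mulrI (au k))).
  by rewrite -[X in _ == X](mulr0 a%:R) (inj_eq (mulrI (au k))).
- by move=> n e []; exists (psi e).
Qed.

(** Multiplication by p maps a level onto the multiples of p in the next one,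
    whose weight is smaller by the factor p^-H. *)
Let scales_p : scales p.
Proof.
move=> I s theta t.
pose phi e : E := node ((p * tagged e)%:R : 'Z_(p ^ (tag e).+2)).
pose psi e : E := match e with
  | existT 0%N r => node r
  | existT k.+1 r => node (((r : nat) %/ p)%:R : 'Z_(p ^ k.+1))
  end.
have phiE k n : phi (node (n%:R : 'Z_(p ^ k.+1))) = node ((p * n)%:R : 'Z_(p ^ k.+2)).
  rewrite /phi/=; congr node; apply: val_inj => /=.
  by rewrite !val_Zp_nat// muln_modr -expnS modn_mod.
have phiK : cancel phi psi.
  move=> [k r]; rewrite /phi /psi/=; congr (existT _ _ _); apply: val_inj => /=.
  have rk : (r < p ^ k.+1)%N by have := ltn_ord r; rewrite [X in (_ < X)%N]Zp_cast.
  rewrite !val_Zp_nat// [(p * r %% _)%N]modn_small; last first.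
    by rewrite [X in (_ < X)%N]expnS ltn_pmul2l// prime_gt0.
  by rewrite mulKn ?prime_gt0// modn_small.
rewrite (@energy_brw_inj phi (fun n e => brw_kernel p H (p * n) e) (p%:R `^ (- H)) I s theta t
  (can_inj phiK)).
- congr ((_ `^ _)%:E * _)%E; rewrite (ger0_norm (powR_ge0 _ _)).
  have -> : padic_norm R (p%:R : padic p_pr) = p%:R `^ (- 1).
    have := @pnorm_expz R p p_pr 1; rewrite expr1z => ->.
    by rewrite powR_inv1 ?ltW// -exprnN expr1.
  by rewrite -powRrM mulN1r.
- move=> n [k r]; rewrite -[r]natr_Zp phiE !brw_kernelE mulrA; congr (_ * (_%:R - _%:R)).
  + rewrite -powRD; last by apply/implyP => _; rewrite gt_eqF.
    by congr (_ `^ _); rewrite -natr1; ring.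
  + rewrite -!val_eqE/= !val_Zp_nat// [(p ^ k.+2)%N]expnS -!muln_modr.
    by rewrite eqn_pmul2l// prime_gt0.
  + rewrite -!val_eqE/= !val_Zp_nat// [(p ^ k.+2)%N]expnS -!muln_modr.
    by rewrite -[X in _ == X](muln0 p) eqn_pmul2l// prime_gt0.
- move=> n [[|k] r] nr; rewrite brw_kernelE.
    suff -> : (p * n)%:R = 0 :> 'Z_(p ^ 1) by rewrite subrr mulr0.
    by apply: val_inj; rewrite /= val_Zp_nat// expn1 modnMr.
  have -> : (r == (p * n)%:R) = false.
    by apply/negP => /eqP e; apply: nr; exists (node (n%:R : 'Z_(p ^ k.+1))); rewrite // phiE e.
  have -> : (r == 0) = false.
    apply/negP => /eqP e; apply: nr; exists (node (0%:R : 'Z_(p ^ k.+1))); rewrite // phiE e.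
    by rewrite muln0.
  by rewrite subrr mulr0.
Qed.

(** An integer is the product of a power of p and of an integer prime to p. *)
Lemma energy_brw_scale a : (0 < a)%N -> forall (I : Type) (s : seq I) (theta : I -> R)
    (t : I -> nat),
  energy counting alpha (fun e => \sum_(i <- s) (theta i)%:C * K (a * t i)%N e)%R =
  (((padic_norm R (a%:R : padic p_pr) `^ H) `^ alpha)%:E *
   energy counting alpha (fun e => \sum_(i <- s) (theta i)%:C * K (t i) e)%R)%E.
Proof.
move=> a0; have [b pb ->] : exists2 b, coprime p b & a = (b * p ^ logn p a)%N.
  by have [b pb e] := pfactor_coprime p_pr a0; exists b.
apply: scalesM; first exact: scales_unit.
elim: (logn p a) => [|v IH]; last by rewrite expnS; exact: scalesM.
by rewrite expn0; apply: scales_unit; rewrite coprimen1.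
Qed.

Section BRWProcess.
Hypothesis alpha_le2 : alpha <= 2.
Context {d : measure_display} {Omega : measurableType d} (P : probability Omega R).
Variables (S : set R[i]) (xi : R[i] -> set E -> Omega -> R).
Hypothesis sf : stable_field P counting alpha S xi.

Lemma brw_kernel_sssi (X : nat -> {RV P >-> R}) :
  (forall n, stable_int P counting alpha S xi (K n) (X n)) ->
  discrete_padic_sssi p_pr X.
Proof.
move=> KX; exists H => //; split=> [a a0|h].
  apply: (stable_int_eq_fdd alpha_gt0 alpha_le2 sf (F := fun n => K (a * n)%N)
    (G := fun n e => (padic_norm R (a%:R : padic p_pr) `^ H)%:C * K n e)
    (X := fun n => X (a * n)%N)).
  - by move=> n; exact: KX.
  - by move=> n; apply: stable_intZ.
  - move=> I s theta t; rewrite energy_brw_scale//.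
    rewrite -[in LHS](ger0_norm (powR_ge0 _ H)) -energyZ; last exact: measurable_brw.
    apply: eq_integral => x _; congr (_%:E); congr (_ `^ _); congr Cmod.
    by rewrite big_distrr/=; apply: eq_bigr => i _; rewrite mulrCA.
apply: (stable_int_eq_fdd alpha_gt0 alpha_le2 sf
  (F := fun n e => K (n + h)%N e - K h e) (G := fun n => K n)
  (X := fun n w => X (n + h)%N w - X h w) (Y := X) _ KX).
  move=> n; have := stable_intD alpha_gt0 sf (KX (n + h)%N) (stable_intZ sf (-1) (KX h)).
  have -> : (fun x => K (n + h)%N x + (-1)%:C * K h x) = (fun x => K (n + h)%N x - K h x).
    by apply/funext => x; rewrite rmorphN1 mulN1r.
  by have -> : (fun w => X (n + h)%N w + -1 * X h w) = (fun w => X (n + h)%N w - X h w)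
    by apply/funext => w; rewrite mulN1r.
by move=> I s theta t; exact: energy_brw_shift.
Qed.

End BRWProcess.
End BRWKernel.

(** * Self-similarity with stationary increments *)

Local Close Scope complex_scope.

Theorem theorem3p9 (R : realType) (p : nat) (p_pr : prime p) (alpha : R)
    (alpha_gt0 : 0 < alpha) (alpha_le2 : alpha <= 2)
    (m : {measure set (padic p_pr) -> \bar R}) (m_haar : padic_haar m)
    (d : measure_display) (Omega : measurableType d) (P : probability Omega R) :
  [/\
   (forall t, log_kernel R t \in Lfun m alpha%:E) /\
   forall (M : set (padic p_pr) -> {RV P >-> R})
          (X : padic p_pr -> {RV P >-> R}),
     SaS_measure m alpha M ->
     (forall t, is_stable_integral m alpha M (log_kernel R t) (X t)) ->
     padic_sssi X,
   forall H : R, 0 < H -> H != alpha^-1 ->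
   (forall t, linear_kernel alpha H t \in Lfun m alpha%:E) /\
   forall (M : set (padic p_pr) -> {RV P >-> R})
          (X : padic p_pr -> {RV P >-> R}),
     SaS_measure m alpha M ->
     (forall t, is_stable_integral m alpha M (linear_kernel alpha H t) (X t)) ->
     padic_sssi X,
   forall H : R, 0 < H ->
   (forall t, LalphaC m alpha (harmonizable_kernel alpha H t)) /\
   forall (M : set (padic p_pr) -> {RV P >-> R[i]})
          (Z : padic p_pr -> {RV P >-> R[i]})
          (X : padic p_pr -> {RV P >-> R}),
     isotropic_SaS_measure m alpha M ->
     (forall t,
        is_stable_Cintegral m alpha M (harmonizable_kernel alpha H t) (Z t)) ->
     (forall t w, X t w = complex.Re (Z t w)) ->
     padic_sssi X &
   forall H : R, 0 < H ->
   (forall n, brw_kernel p H n \in Lfun counting alpha%:E) /\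
   forall (M : set (brw_tree p) -> {RV P >-> R}) (X : nat -> {RV P >-> R}),
     SaS_measure counting alpha M ->
     (forall n, is_stable_integral counting alpha M (brw_kernel p H n) (X n)) ->
     discrete_padic_sssi p_pr X].

Proof.
split.
- split=> [t|M X MS XM].
    exact: ((Lfun_energyP m alpha_gt0 _).2
      (conj (measurable_log_kernel t) (energy_log_kernel alpha_gt0 m_haar t))).
  apply: (log_kernel_sssi alpha_gt0 alpha_le2 m_haar (SaS_stable_field MS)) => t.
  exact: (is_stable_integral_stable_int alpha_gt0 (XM t)).
- move=> H H0 Ha; split=> [t|M X MS XM].
    exact: ((Lfun_energyP m alpha_gt0 _).2
      (conj (measurable_linear_kernel alpha H t) (energy_linear_kernel alpha_gt0 m_haar t H0 Ha))).
  apply: (linear_kernel_sssi alpha_gt0 alpha_le2 m_haar (SaS_stable_field MS) H0 Ha) => t.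
  exact: (is_stable_integral_stable_int alpha_gt0 (XM t)).
- move=> H H0; split=> [t|M Z X MS ZM XZ].
    exact: ((LalphaCP m alpha_gt0 _).2 (conj (measurable_harmonizable_kernel alpha H t)
      (energy_harmonizable_kernel alpha_gt0 m_haar t H0))).
  apply: (harmonizable_kernel_sssi alpha_gt0 alpha_le2 m_haar
    (isotropic_stable_field MS) H0) => t.
  have -> : (X t : Omega -> R) = fun w => complex.Re (Z t w) by apply/funext => w; exact: XZ.
  exact: (is_stable_Cintegral_stable_int alpha_gt0 (ZM t)).
- move=> H H0; split=> [n|M X MS XM].
    exact: ((Lfun_energyP _ alpha_gt0 _).2 (conj (measurable_brw _)
      (energy_brw_kernel p_pr alpha_gt0 H0 n))).
  apply: (brw_kernel_sssi p_pr alpha_gt0 H0 alpha_le2 (SaS_stable_field MS)) => n.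
  exact: (is_stable_integral_stable_int alpha_gt0 (XM n)).
Qed.
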